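(* Under the standing assumptions (A1)–(A4), let $0<\gamma<\frac{1}{m-1}$ and $\alpha>0$, and consider Algorithm A $$\begin{aligned} \dot x&=\mathrm{Prox}_{F^m}\Big[x-\nabla F^0(x)+v+\gamma\textstyle\sum_{j=1}^{m-1}z^j\Big]-x,\\ \dot z^j&=\mathrm{Prox}_{F^j}[x-\gamma z^j]-x,\quad j=1,\dots,m-1,\\ \dot v&=-H_{nq}^{-1}(x-d)-\alpha L_{nq}v-w,\\ \dot w&=\alpha L_{nq}v,\qquad w(0)=\mathbf{0}_{nq}, \end{aligned}$$ with arbitrary initial $x(0),z(0),v(0)$. Suppose there exist $\beta$ with $\frac{(1+\gamma)(m-1)}{2c}<\beta<\frac{2}{1+\gamma}$ and $\eta>0$ such that, with $b_2=c-\frac{(1+\gamma)(m-1)}{2\beta}$ and $h^*=\min_i h_i$, $$\alpha>\frac{(\eta+1)^2}{\eta\,\lambda_2(\mathbf{L}_{nq})},\qquad \eta>\max\Big\{\frac{1}{b_2h^*}-1,\,0\Big\}.$$ Then $x(t)$ converges as $t\to\infty$, and $\lim_{t\to\infty}x(t)$ is a solution of the problem $\min_x\sum_i f_i(x_i)$ s.t. $\sum_i x_i=\sum_i d_i$.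
   Context: Standing setup: $n$ agents; agent $i$ has state $x_i\in\mathbb{R}^q$, and $x=(x_1^T,\dots,x_n^T)^T\in\mathbb{R}^{nq}$. Given $d_i\in\mathbb{R}^q$, $d=(d_1^T,\dots,d_n^T)^T$. Integer $m\ge 2$. Each local cost is $f_i=\sum_{j=0}^m f_i^j$; $F^j(x)=\sum_{i=1}^n f_i^j(x_i)$. $\nabla F^0(x)=(\nabla f_1^0(x_1)^T,\dots,\nabla f_n^0(x_n)^T)^T$. Assumptions: (A1) each $f_i^0$ is twice continuously differentiable and strongly convex with a common constant $c>m-1$, i.e. $(\nabla f_i^0(a)-\nabla f_i^0(b))^T(a-b)\ge c\|a-b\|^2$; (A2) each $f_i^j$, $j=1,\dots,m$, is a proper closed convex function; (A3) the graph is weighted, directed and strongly connected; (A4) the problem is feasible. Proximal operator: $\mathrm{prox}_f[\theta]=\arg\min_\delta\{f(\delta)+\frac12\|\delta-\theta\|^2\}$, and $\mathrm{Prox}_{F^j}[\xi]=(\mathrm{prox}_{f_1^j}[\xi_1]^T,\dots,\mathrm{prox}_{f_n^j}[\xi_n]^T)^T$ for $\xi=(\xi_1,\dots,\xi_n)\in\mathbb{R}^{nq}$. Graph: weighted adjacency matrix $\mathcal{A}=[a_{ij}]$ ($a_{ij}>0$ iff agent $i$ receives from $j$, $a_{ii}=0$), Laplacian $L_n=D^{in}-\mathcal{A}$ with $D^{in}=\mathrm{diag}(\sum_j a_{ij})$; $h$ is the positive left eigenvector with $h^TL_n=0$, $\sum_ih_i=1$; $H=\mathrm{diag}(h_1,\dots,h_n)$,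 $H_{nq}=H\otimes I_q$, $L_{nq}=L_n\otimes I_q$, $\mathbf{L}_{nq}=(H_{nq}L_{nq}+L_{nq}^TH_{nq})/2$, and $\lambda_2(\cdot)$ denotes the second smallest eigenvalue of a symmetric matrix. *)

(* Defs.v *)
From Stdlib Require Import Reals Lra.
Open Scope R_scope.

Fixpoint rsum (n : nat) (f : nat -> R) : R :=
  match n with
  | O => 0
  | S p => rsum p f + f p
  end.

(** Vectors of R^q are modelled as [nat -> R], only coordinates [< q] matter.
    States in R^{nq} are [nat -> nat -> R] : agent index, coordinate index. *)

Inductive ER : Type := Fin (r : R) | PInf.

Definition ERle (a b : ER) : Prop :=
  match a, b with
  | _, PInf => True
  | PInf, Fin _ => False
  | Fin x, Fin y => x <= y
  end.

Definition ERadd (a b : ER) : ER :=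
  match a, b with
  | Fin x, Fin y => Fin (x + y)
  | _, _ => PInf
  end.

Definition ERgtR (a : ER) (r : R) : Prop :=
  match a with PInf => True | Fin x => r < x end.

Definition local {A : Type} (q : nat) (F : (nat -> R) -> A) : Prop :=
  forall y y', (forall k, (k < q)%nat -> y k = y' k) -> F y = F y'.

Definition sqnorm (q : nat) (y : nat -> R) : R := rsum q (fun k => y k * y k).

Definition vsub (y y' : nat -> R) : nat -> R := fun k => y k - y' k.

Definition proper_fun (q : nat) (f : (nat -> R) -> ER) : Prop :=
  exists y, f y <> PInf.

Definition convex_fun (f : (nat -> R) -> ER) : Prop :=
  forall a b th ra rb, 0 < th < 1 -> f a = Fin ra -> f b = Fin rb ->
    exists r, f (fun k => th * a k + (1 - th) * b k) = Fin r /\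
              r <= th * ra + (1 - th) * rb.

(** Closed = lower semicontinuous on R^q: strict superlevel sets are open. *)
Definition closed_fun (q : nat) (f : (nat -> R) -> ER) : Prop :=
  forall y r, ERgtR (f y) r ->
    exists del, 0 < del /\
      forall y', (forall k, (k < q)%nat -> Rabs (y' k - y k) < del) ->
        ERgtR (f y') r.

Definition is_prox (q : nat) (f : (nat -> R) -> ER) (theta p : nat -> R) : Prop :=
  exists fp, f p = Fin fp /\
    forall dl r, f dl = Fin r ->
      fp + / 2 * sqnorm q (vsub p theta) <= r + / 2 * sqnorm q (vsub dl theta).

Definition upd (y : nat -> R) (l : nat) (s : R) : nat -> R :=
  fun k => if Nat.eqb k l then s else y k.

Definition contRq (q : nat) (F : (nat -> R) -> R) : Prop :=
  forall y eps, 0 < eps -> exists del, 0 < del /\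
    forall y', (forall k, (k < q)%nat -> Rabs (y' k - y k) < del) ->
      Rabs (F y' - F y) < eps.

Definition C2_with (q : nat) (f : (nat -> R) -> R)
    (g : (nat -> R) -> nat -> R) (hs : (nat -> R) -> nat -> nat -> R) : Prop :=
  (forall y k, (k < q)%nat -> derivable_pt_lim (fun s => f (upd y k s)) (y k) (g y k)) /\
  (forall y k l, (k < q)%nat -> (l < q)%nat ->
      derivable_pt_lim (fun s => g (upd y l s) k) (y l) (hs y k l)) /\
  (forall k l, (k < q)%nat -> (l < q)%nat -> contRq q (fun y => hs y k l)).

(** Strong convexity (in the gradient-monotonicity form of (A1)). *)
Definition strongly_monotone (q : nat) (g : (nat -> R) -> nat -> R) (c : R) : Prop :=
  forall a b, rsum q (fun k => (g a k - g b k) * (a k - b k))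
              >= c * sqnorm q (vsub a b).

Inductive reach (n : nat) (a : nat -> nat -> R) : nat -> nat -> Prop :=
  | reach_refl : forall i, reach n a i i
  | reach_step : forall i j k, (j < n)%nat -> (k < n)%nat ->
      reach n a i j -> 0 < a k j -> reach n a i k.

Definition strongly_connected (n : nat) (a : nat -> nat -> R) : Prop :=
  forall i j, (i < n)%nat -> (j < n)%nat -> reach n a i j.

Definition lap (n : nat) (a : nat -> nat -> R) (i j : nat) : R :=
  (if Nat.eqb i j then rsum n (fun l => a i l) else 0) - a i j.

(** bold L_{nq} = (H_{nq} L_{nq} + L_{nq}^T H_{nq}) / 2, entry ((i,k),(j,l)). *)
Definition boldL (n : nat) (a : nat -> nat -> R) (h : nat -> R)
    (i k j l : nat) : R :=
  if Nat.eqb k l then (h i * lap n a i j + lap n a j i * h j) / 2 else 0.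

Definition is_eig_nq (n q : nat) (M : nat -> nat -> nat -> nat -> R) (lam : R) : Prop :=
  exists v : nat -> nat -> R,
    (exists i k, (i < n)%nat /\ (k < q)%nat /\ v i k <> 0) /\
    forall i k, (i < n)%nat -> (k < q)%nat ->
      rsum n (fun j => rsum q (fun l => M i k j l * v j l)) = lam * v i k.

(** lam is the second smallest (distinct) eigenvalue. *)
Definition is_lambda2_nq (n q : nat) (M : nat -> nat -> nat -> nat -> R) (lam : R) : Prop :=
  is_eig_nq n q M lam /\
  (exists mu, is_eig_nq n q M mu /\ mu < lam) /\
  (forall mu nu, is_eig_nq n q M mu -> is_eig_nq n q M nu -> mu < lam -> nu < lam -> mu = nu).

Definition is_min_idx (n : nat) (h : nat -> R) (hs : R) : Prop :=
  (exists i, (i < n)%nat /\ hs = h i) /\ forall i, (i < n)%nat -> hs <= h i.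

Fixpoint ERsum_from1 (m : nat) (F : nat -> ER) : ER :=
  match m with
  | O => Fin 0
  | S p => ERadd (ERsum_from1 p F) (F (S p))
  end.

Definition local_cost (m : nat) (f0 : (nat -> R) -> R) (fj : nat -> (nat -> R) -> ER)
    (y : nat -> R) : ER :=
  ERadd (Fin (f0 y)) (ERsum_from1 m (fun j => fj j y)).

Fixpoint ERsum (n : nat) (F : nat -> ER) : ER :=
  match n with
  | O => Fin 0
  | S p => ERadd (ERsum p F) (F p)
  end.

Definition total_cost (n m : nat) (f0 : nat -> (nat -> R) -> R)
    (fj : nat -> nat -> (nat -> R) -> ER) (x : nat -> nat -> R) : ER :=
  ERsum n (fun i => local_cost m (f0 i) (fj i) (x i)).

Definition resource_constraint (n q : nat) (x d : nat -> nat -> R) : Prop :=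
  forall k, (k < q)%nat -> rsum n (fun i => x i k) = rsum n (fun i => d i k).

Definition is_solution (n q m : nat) (f0 : nat -> (nat -> R) -> R)
    (fj : nat -> nat -> (nat -> R) -> ER) (d x : nat -> nat -> R) : Prop :=
  resource_constraint n q x d /\
  forall y, resource_constraint n q y d ->
    ERle (total_cost n m f0 fj x) (total_cost n m f0 fj y).

Definition cv_infty_fun (f : R -> R) (l : R) : Prop :=
  forall eps, 0 < eps -> exists T, forall t, T <= t -> Rabs (f t - l) < eps.

Definition right_cont0 (f : R -> R) : Prop :=
  forall eps, 0 < eps -> exists del, 0 < del /\
    forall t, 0 <= t < del -> Rabs (f t - f 0) < eps.

Definition algorithmA_traj (n q m : nat) (a : nat -> nat -> R) (h : nat -> R)
    (d : nat -> nat -> R) (g0 : nat -> (nat -> R) -> nat -> R)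
    (fj : nat -> nat -> (nat -> R) -> ER) (gamma alpha : R)
    (x : R -> nat -> nat -> R) (z : R -> nat -> nat -> nat -> R)
    (v w : R -> nat -> nat -> R) : Prop :=
  (forall i k, (i < n)%nat -> (k < q)%nat ->
     right_cont0 (fun t => x t i k) /\ right_cont0 (fun t => v t i k) /\
     right_cont0 (fun t => w t i k) /\
     (forall j, (1 <= j <= m - 1)%nat -> right_cont0 (fun t => z t j i k))) /\
  (forall i k, (i < n)%nat -> (k < q)%nat -> w 0 i k = 0) /\
  (forall t i, 0 < t -> (i < n)%nat ->
     (exists p, is_prox q (fj i m)
          (fun k => x t i k - g0 i (x t i) k + v t i k
                    + gamma * rsum (m - 1) (fun j' => z t (S j') i k)) p /\
        forall k, (k < q)%nat ->
          derivable_pt_lim (fun s => x s i k) t (p k - x t i k)) /\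
     (forall j, (1 <= j <= m - 1)%nat ->
        exists p, is_prox q (fj i j) (fun k => x t i k - gamma * z t j i k) p /\
          forall k, (k < q)%nat ->
            derivable_pt_lim (fun s => z s j i k) t (p k - x t i k)) /\
     (forall k, (k < q)%nat ->
        derivable_pt_lim (fun s => v s i k) t
          (- / h i * (x t i k - d i k)
           - alpha * rsum n (fun j => lap n a i j * v t j k) - w t i k)) /\
     (forall k, (k < q)%nat ->
        derivable_pt_lim (fun s => w s i k) t
          (alpha * rsum n (fun j => lap n a i j * v t j k)))).

(* Main.v *)
Require Import Defs.
From Stdlib Require Import Reals Lra Lia Psatz Classical IndefiniteDescription.
From Coquelicot Require Import Coquelicot.
Open Scope R_scope.

(** Along a trajectory the proximal steps select subgradients [ss] of the nonsmooth terms, and the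
    sum of Fenchel gaps, Moreau envelopes and quadratic terms is a storage function whose
    derivative is bounded by minus the supply (a pairing of primal and dual deviations from a
    reference, nonnegative up to [eps] at a saddle point) minus a dissipation, for which the
    conditions on [c], [gamma], [beta], [eta], [alpha] leave a positive margin.
    No constraint qualification is assumed, so an exact dual optimum need not exist and there is no
    equilibrium to compare with. Two families of references replace it.

    With a fixed [eps]-optimal dual certificate the storage decreases at rate [eps - k * dissipation]
    and is bounded below, so the dissipation becomes arbitrarily small at some times. With a slow
    low-pass filter of the trajectory itself as reference, convexity of the Fenchel gaps along
    the filter makes the supply harmless, and a second storage is nonincreasing and dominates
    [|x - xs|^2]. It is small whenever the dissipation and the filter lags are small, which
    happens at some time, and then stays small forever. *)

(** A moving reference must satisfy the relations of the dynamics, because they are used as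
    equalities. The filtered trajectory does: relations linear in [x], [z], [v], [w] survive
    averaging, and those involving gradients and proximal subgradients survive as inequalities by
    convexity. This requires the filters to start exactly on these relations, so their initial
    values are solved for. The two arguments fit together because the decay constants of the first
    do not depend on the dual certificate: [eps] is fixed once the target smallness is known,
    although the certificate may blow up as [eps] tends to 0. The conditions linking [c], [gamma],
    [beta], [eta] condense to [(1 + gamma) * INR (m - 1) / 4 + Rg < c / 2]: the first summand is the
    price of the coupling between [x] and [z], the second that of the interplay of [v] and [w] on
    the graph. The lower bound on [alpha] makes the graph dissipation strict. The filter rate [tau]
    is a small perturbation parameter, whose effects are all paid from these strict margins. *)

Lemma rsum_ext n f g : (forall i, (i < n)%nat -> f i = g i) -> rsum n f = rsum n g.
Proof.
  induction n as [|n IH]; intros H; simpl; [reflexivity|].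
  rewrite IH, H; auto with arith.
Qed.

Lemma rsum_le n f g : (forall i, (i < n)%nat -> f i <= g i) -> rsum n f <= rsum n g.
Proof.
  induction n as [|n IH]; intros H; simpl; [lra|].
  assert (rsum n f <= rsum n g) by (apply IH; auto with arith).
  assert (f n <= g n) by auto with arith. lra.
Qed.

Lemma rsum_plus n f g : rsum n (fun i => f i + g i) = rsum n f + rsum n g.
Proof. induction n as [|n IH]; simpl; [ring|]. rewrite IH; ring. Qed.

Lemma rsum_scal n a f : rsum n (fun i => a * f i) = a * rsum n f.
Proof. induction n as [|n IH]; simpl; [ring|]. rewrite IH; ring. Qed.

Lemma rsum_const n a : rsum n (fun _ => a) = INR n * a.
Proof. induction n as [|n IH]; [simpl; ring|]. rewrite S_INR; simpl. rewrite IH; ring. Qed.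

Lemma rsum_nonneg n f : (forall i, (i < n)%nat -> 0 <= f i) -> 0 <= rsum n f.
Proof.
  intros H. apply Rle_trans with (rsum n (fun _ => 0)).
  - rewrite rsum_const; lra.
  - now apply rsum_le.
Qed.

Lemma rsum_minus n f g : rsum n (fun i => f i - g i) = rsum n f - rsum n g.
Proof. induction n as [|n IH]; simpl; [ring|]. rewrite IH; ring. Qed.

Lemma rsum_opp n f : rsum n (fun i => - f i) = - rsum n f.
Proof. induction n as [|n IH]; simpl; [ring|]. rewrite IH; ring. Qed.

Lemma rsum_swap n m f :
  rsum n (fun i => rsum m (fun j => f i j)) = rsum m (fun j => rsum n (fun i => f i j)).
Proof.
  induction n as [|n IH]; simpl.
  - rewrite rsum_const; ring.
  - rewrite IH, <- rsum_plus. reflexivity.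
Qed.

Lemma rsum_scalr n a f : rsum n (fun i => f i * a) = rsum n f * a.
Proof.
  rewrite Rmult_comm, <- rsum_scal. apply rsum_ext; intros; ring.
Qed.

Lemma rsum_term_le n f i :
  (forall j, (j < n)%nat -> 0 <= f j) -> (i < n)%nat -> f i <= rsum n f.
Proof.
  induction n as [|n IH]; intros H Hi; [lia|]. simpl.
  assert (0 <= f n) by (apply H; lia).
  destruct (Nat.eq_dec i n) as [->|Hne].
  - assert (0 <= rsum n f) by (apply rsum_nonneg; intros; apply H; lia). lra.
  - assert (f i <= rsum n f) by (apply IH; [intros; apply H; lia|lia]). lra.
Qed.

Lemma rsum_single n f i :
  (i < n)%nat -> (forall j, (j < n)%nat -> j <> i -> f j = 0) -> rsum n f = f i.
Proof.
  induction n as [|n IH]; intros Hi H; [lia|]. simpl.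
  destruct (Nat.eq_dec i n) as [->|Hne].
  - rewrite (rsum_ext n f (fun _ => 0)) by (intros; apply H; lia).
    rewrite rsum_const; ring.
  - rewrite IH, (H n); try lia; try ring. intros; apply H; lia.
Qed.

Lemma rsum_sq_le n f : (rsum n f) ^ 2 <= INR n * rsum n (fun i => f i ^ 2).
Proof.
  induction n as [|n IH]; [simpl; lra|].
  rewrite S_INR; cbn [rsum].
  assert (Hn := pos_INR n).
  assert (H0 : 0 <= rsum n (fun i => f i ^ 2)) by (apply rsum_nonneg; intros; nra).
  set (A := rsum n f) in *. set (B := rsum n (fun i => f i ^ 2)) in *. set (x := f n).
  destruct n as [|n'].
  - unfold A, B; simpl; nra.
  - assert (Hp : 0 < INR (S n')) by (apply lt_0_INR; lia).
    set (N := INR (S n')) in *.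
    assert (2 * (A * x) <= A ^ 2 / N + N * x ^ 2).
    { assert (0 <= (A / N - x) ^ 2 * N) by (apply Rmult_le_pos; [apply pow2_ge_0|lra]).
      replace ((A / N - x) ^ 2 * N) with (A ^ 2 / N - 2 * (A * x) + N * x ^ 2) in H by (field; lra).
      lra. }
    assert (A ^ 2 / N <= B).
    { apply Rmult_le_reg_r with N; [lra|].
      replace (A ^ 2 / N * N) with (A ^ 2) by (field; lra). lra. }
    nra.
Qed.

(** * Quadratic estimates in one coordinate of one agent *)

(** Here [a], [e] are the velocities of [x] and [z], [b], [f] their deviations from the reference,
    [xi] the deviation from the solution; [gd], [gt] belong to the gradient and [vd], [vt] to [v].
    The left side collects the local storage rate and the supply. On the right [gt] has cancelled,
    and [xi] survives only next to [vd + (1 - tau) * vt], where the graph terms take over. *)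
Lemma energy_identity M gam tau xi a b gd gt vd vt (e f : nat -> R) :
  xi * gd + (xi + a) * (a - gd + vd + gam * rsum M e)
    + rsum M (fun j => (xi + e j) * (a - gam * e j)) - (INR M + 1) * (xi * a)
  + (1 - tau) *
    ((b * (a - tau * b) + (xi - b) * (a - tau * b) + tau * b * b - tau * (b * (a - tau * b))
      + rsum M (fun j => a * f j + xi * (e j - tau * f j)
          - (1 + gam) * ((a - tau * b) * f j + b * (e j - tau * f j))
          + (gam - tau) * (f j * (e j - tau * f j))))
     + gt * a
     + (xi * gt + (xi + a) * (- gt - (a - tau * b) + vt + gam * rsum M f)
        + rsum M (fun j => (xi + e j) * (- gam * f j - (e j - tau * f j)))))
  = (vd + (1 - tau) * vt) * (xi + a) - a * gd + tau * a ^ 2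
    + (1 - tau) * (tau + tau ^ 2) * b ^ 2
    + rsum M (fun j => (1 + gam) * (e j * (a - (1 - tau) * b)) - (1 + gam - tau) * e j ^ 2
        + (1 - tau) * (2 * (1 + gam) * tau * (b * f j) - tau * (gam - tau) * f j ^ 2)).
Proof.
  induction M as [|M IH]; [simpl; ring|].
  rewrite S_INR. cbn [rsum].
  (* Passing from [M] to [S M] adds a polynomial to each side, so only the increments are compared
     and the sums over [j < M] drop out. *)
  match type of IH with ?l = ?r =>
    match goal with |- ?l' = ?r' =>
      assert (l' - l = r' - r); [| lra] end end.
  ring.
Qed.

(** At [tau = dl = 0] the maximum over [e] of [(1 + gam) * (e * s - e ^ 2)] is
    [(1 + gam) / 4 * s ^ 2], which fixes the leading constant; the loss for small [tau] and [dl] is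
    linear. The [f] terms carry a factor [tau], and [tau <= gam / 2] keeps enough of the negative
    square of [f] to absorb [b * f]. *)
Lemma local_ef gam tau dl a b e f :
  0 < gam <= 1 -> 0 <= tau -> 0 <= dl -> tau + dl <= 1 / 4 -> tau <= gam / 2 ->
  (1 + gam) * (e * (a - (1 - tau) * b)) - (1 + gam - tau) * e ^ 2
        + (1 - tau) * (2 * (1 + gam) * tau * (b * f) - tau * (gam - tau) * f ^ 2)
  <= - dl * e ^ 2 + (1 + gam) / 4 * (a - b) ^ 2
     + (8 * (tau + dl) + tau * (8 / gam)) * (a ^ 2 + b ^ 2).
Proof.
  intros Hg Ht Hdl Htd Htg.
  assert (He : (1 + gam) * (e * (a - (1 - tau) * b)) - (1 + gam - (tau + dl)) * e ^ 2
     <= (1 + gam) / 4 * (a - b) ^ 2 + 8 * (tau + dl) * (a ^ 2 + b ^ 2)).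
  { set (s := a - (1 - tau) * b). set (ka := tau + dl).
    assert (Hka : 0 <= tau <= ka) by (unfold ka; lra).
    assert (Hka' : ka <= 1 / 4) by exact Htd. clearbody ka.
    assert (H1 : (1 + gam) * (e * s) - (1 + gam - ka) * e ^ 2 <= (1 + gam + 4 * ka) / 4 * s ^ 2).
    (* Completing the square in [e] requires the product of the two coefficients to be at least
       [(1 + gam) ^ 2]; the summand [4 * ka] on the right achieves this. *)
    { assert (Hq : 0 <= (1 + gam - ka) * (1 + gam + 4 * ka) - (1 + gam) ^ 2).
      { replace ((1 + gam - ka) * (1 + gam + 4 * ka) - (1 + gam) ^ 2)
          with (ka * (3 + 3 * gam - 4 * ka)) by ring.
        apply Rmult_le_pos; lra. }
      assert (0 <= ((1 + gam) * s - 2 * (1 + gam - ka) * e) ^ 2) by apply pow2_ge_0.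
      assert (0 <= s ^ 2) by apply pow2_ge_0.
      assert (0 <= ((1 + gam - ka) * (1 + gam + 4 * ka) - (1 + gam) ^ 2) * s ^ 2)
        by (apply Rmult_le_pos; lra).
      apply Rmult_le_reg_l with (4 * (1 + gam - ka)); [lra|].
      lra. }
    assert (Hs : s = a - b + tau * b) by (unfold s; ring).
    assert (H2 : s ^ 2 <= (a - b) ^ 2 + tau * (2 * a ^ 2 + 4 * b ^ 2)).
    { rewrite Hs.
      assert (2 * ((a - b) * b) <= (a - b) ^ 2 + b ^ 2)
        by (generalize (pow2_ge_0 (a - 2 * b)); lra).
      assert ((a - b) ^ 2 <= 2 * a ^ 2 + 2 * b ^ 2)
        by (generalize (pow2_ge_0 (a + b)); lra).
      replace ((a - b + tau * b) ^ 2)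
        with ((a - b) ^ 2 + tau * (2 * ((a - b) * b) + tau * b ^ 2)) by ring.
      assert (tau * b ^ 2 <= b ^ 2).
      { assert (0 <= (1 - tau) * b ^ 2) by (apply Rmult_le_pos; [lra|apply pow2_ge_0]). lra. }
      apply Rplus_le_compat_l. apply Rmult_le_compat_l; lra. }
    assert (Ha2 := pow2_ge_0 a). assert (Hb2 := pow2_ge_0 b). assert (Hs2 := pow2_ge_0 s).
    assert (H3 : s ^ 2 <= 4 * (a ^ 2 + b ^ 2)).
    { assert (tau * (2 * a ^ 2 + 4 * b ^ 2) <= 1 / 4 * (2 * a ^ 2 + 4 * b ^ 2))
        by (apply Rmult_le_compat_r; lra).
      generalize (pow2_ge_0 (a + b)); lra. }
    assert ((1 + gam) / 4 * s ^ 2 <= (1 + gam) / 4 * ((a - b) ^ 2 + tau * (2 * a ^ 2 + 4 * b ^ 2)))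
      by (apply Rmult_le_compat_l; lra).
    assert (ka * s ^ 2 <= ka * (4 * (a ^ 2 + b ^ 2))) by (apply Rmult_le_compat_l; lra).
    assert ((1 + gam) / 4 * (tau * (2 * a ^ 2 + 4 * b ^ 2)) <= 1 / 2 * (tau * (2 * a ^ 2 + 4 * b ^ 2))).
    { apply Rmult_le_compat_r; [|lra]. apply Rmult_le_pos; lra. }
    assert (tau * (2 * a ^ 2 + 4 * b ^ 2) <= ka * (2 * a ^ 2 + 4 * b ^ 2))
      by (apply Rmult_le_compat_r; lra).
    assert (0 <= ka * a ^ 2) by (apply Rmult_le_pos; lra).
    assert (0 <= ka * b ^ 2) by (apply Rmult_le_pos; lra).
    lra. }
  assert (Hf : (1 - tau) * (2 * (1 + gam) * tau * (b * f) - tau * (gam - tau) * f ^ 2)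
     <= tau * (8 / gam) * b ^ 2).
  { assert (H1 : 2 * (1 + gam) * (b * f) - (gam - tau) * f ^ 2 <= 8 / gam * b ^ 2).
    { apply Rmult_le_reg_l with gam; [lra|].
      replace (gam * (8 / gam * b ^ 2)) with (8 * b ^ 2) by (field; lra).
      assert (Hf2 := pow2_ge_0 f). assert (Hb2 := pow2_ge_0 b).
      assert (0 <= gam * (gam / 2 - tau) * f ^ 2)
        by (apply Rmult_le_pos; [apply Rmult_le_pos; lra|lra]).
      assert (gam * (2 * (1 + gam) * (b * f)) - gam * (gam / 2 * f ^ 2) <= 8 * b ^ 2).
      { assert (Hsq := pow2_ge_0 (2 * (1 + gam) * b - gam * f)).
        assert (0 <= (4 - (1 + gam) ^ 2) * b ^ 2) by (apply Rmult_le_pos; [nra|lra]). lra. }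
      lra. }
    assert (0 <= 8 / gam * b ^ 2).
    { apply Rmult_le_pos; [|apply pow2_ge_0]. apply Rlt_le, Rdiv_lt_0_compat; lra. }
    set (X := 2 * (1 + gam) * (b * f) - (gam - tau) * f ^ 2) in *.
    replace ((1 - tau) * (2 * (1 + gam) * tau * (b * f) - tau * (gam - tau) * f ^ 2))
      with (tau * ((1 - tau) * X)) by (unfold X; ring).
    rewrite (Rmult_assoc tau (8 / gam)). apply Rmult_le_compat_l; [lra|].
    destruct (Rle_dec 0 X).
    - assert (0 <= tau * X) by (apply Rmult_le_pos; lra). lra.
    - assert (0 <= (1 - tau) * - X) by (apply Rmult_le_pos; lra). lra. }
  assert (0 <= tau * (8 / gam) * a ^ 2).
  { apply Rmult_le_pos; [|apply pow2_ge_0]. apply Rmult_le_pos; [lra|].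
    apply Rlt_le, Rdiv_lt_0_compat; lra. }
  lra.
Qed.

(* [k0] and [Rg] are the weights lost to the coupling with [e] and to the graph; the
   multiple [k0 - Rg] of [d/dt b^2] cancels the cross term [a * b]. *)
Lemma local_dissipation M gam tau dl c c0 Rg a b (e f : nat -> R) :
  0 < gam <= 1 -> 0 <= tau -> 0 <= dl -> tau + dl <= 1 / 4 -> tau <= gam / 2 ->
  0 <= Rg -> c0 <= c -> 0 <= c0 ->
  let k0 := (1 + gam) * INR M / 4 in
  (tau + dl) * (INR M * (8 + 8 / gam) + 8 + 8 * Rg + 4 * k0 + 2 * c0) <= c0 / 2 - k0 - Rg ->
  tau * a ^ 2 - c * a ^ 2 + (1 - tau) * (tau + tau ^ 2) * b ^ 2
    - (1 - tau) * (1 + tau) * (c0 / 2) * b ^ 2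
    + Rg * ((1 - tau) * b + a) ^ 2 + 2 * (k0 - Rg) * (b * (a - tau * b))
    + tau * ((1 - tau) * b + a) ^ 2
    + rsum M (fun j => (1 + gam) * (e j * (a - (1 - tau) * b)) - (1 + gam - tau) * e j ^ 2
        + (1 - tau) * (2 * (1 + gam) * tau * (b * f j) - tau * (gam - tau) * f j ^ 2))
  <= - dl * (a ^ 2 + b ^ 2 + rsum M (fun j => e j ^ 2)).
Proof.
  intros Hg Ht Hdl Htd Htg HR Hc0 Hc0' k0 Hmu.
  assert (HM := pos_INR M).
  assert (Hig : 0 <= 8 / gam) by (apply Rlt_le, Rdiv_lt_0_compat; lra).
  assert (Hk0 : 0 <= k0) by (unfold k0; apply Rmult_le_pos; [apply Rmult_le_pos; lra|lra]).
  assert (Hsum : rsum M (fun j => (1 + gam) * (e j * (a - (1 - tau) * b)) - (1 + gam - tau) * e j ^ 2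
        + (1 - tau) * (2 * (1 + gam) * tau * (b * f j) - tau * (gam - tau) * f j ^ 2))
     <= - dl * rsum M (fun j => e j ^ 2) + k0 * (a - b) ^ 2
        + INR M * ((8 * (tau + dl) + tau * (8 / gam)) * (a ^ 2 + b ^ 2))).
  { apply Rle_trans with (rsum M (fun j => - dl * e j ^ 2 +
       ((1 + gam) / 4 * (a - b) ^ 2 + (8 * (tau + dl) + tau * (8 / gam)) * (a ^ 2 + b ^ 2)))).
    - apply rsum_le; intros j _. generalize (local_ef gam tau dl a b (e j) (f j) Hg Ht Hdl Htd Htg). lra.
    - rewrite rsum_plus, rsum_scal, rsum_const. unfold k0. lra. }
  set (A := a ^ 2) in *. set (B := b ^ 2) in *.
  assert (HA : 0 <= A) by apply pow2_ge_0. assert (HB : 0 <= B) by apply pow2_ge_0.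
  assert (Hab : 2 * (a * b) <= A + B) by (generalize (pow2_ge_0 (a - b)); unfold A, B; lra).
  assert (Hab' : - (A + B) <= 2 * (a * b)) by (generalize (pow2_ge_0 (a + b)); unfold A, B; lra).
  set (SE := rsum M (fun j => e j ^ 2)) in *.
  assert (Hexp : tau * A - c * A + (1 - tau) * (tau + tau ^ 2) * B
    - (1 - tau) * (1 + tau) * (c0 / 2) * B
    + Rg * ((1 - tau) * b + a) ^ 2 + 2 * (k0 - Rg) * (b * (a - tau * b))
    + tau * ((1 - tau) * b + a) ^ 2 + k0 * (a - b) ^ 2
    <= (- c0 / 2 + k0 + Rg) * (A + B) + tau * (6 + 6 * Rg + 4 * k0 + c0) * (A + B)).
  { assert (E1 : ((1 - tau) * b + a) ^ 2 = (1 - tau) ^ 2 * B + A + 2 * (1 - tau) * (a * b))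
      by (unfold A, B; ring).
    assert (E2 : (a - b) ^ 2 = A + B - 2 * (a * b)) by (unfold A, B; ring).
    assert (E3 : b * (a - tau * b) = a * b - tau * B) by (unfold B; ring).
    rewrite E1, E2, E3. set (C := a * b) in *.
    assert (0 <= (c - c0 / 2) * A) by (apply Rmult_le_pos; lra).
    assert (H1 : (1 - tau) ^ 2 * B + A + 2 * (1 - tau) * C <= 2 * (A + B)).
    { assert (0 <= ((1 - tau) * b - a) ^ 2) by apply pow2_ge_0.
      assert ((1 - tau) ^ 2 * B <= 1 * B) by (apply Rmult_le_compat_r; [lra|nra]).
      replace (((1 - tau) * b - a) ^ 2) with ((1 - tau) ^ 2 * B + A - 2 * (1 - tau) * C) in H0
        by (unfold A, B, C; ring). lra. }
    assert (tau * ((1 - tau) ^ 2 * B + A + 2 * (1 - tau) * C) <= tau * (2 * (A + B)))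
      by (apply Rmult_le_compat_l; lra).
    assert (H2 : Rg * ((1 - tau) ^ 2 * B + A + 2 * (1 - tau) * C) - 2 * Rg * (C - tau * B)
      <= Rg * (A + B) + tau * (3 * Rg) * (A + B)).
    { replace (Rg * ((1 - tau) ^ 2 * B + A + 2 * (1 - tau) * C) - 2 * Rg * (C - tau * B))
        with (Rg * (A + B) + (tau * Rg) * (tau * B - 2 * C)) by ring.
      apply Rplus_le_compat_l. replace (tau * (3 * Rg) * (A + B)) with ((tau * Rg) * (3 * (A + B))) by ring.
      apply Rmult_le_compat_l; [apply Rmult_le_pos; lra|].
      assert (tau * B <= 1 * B) by (apply Rmult_le_compat_r; lra). lra. }
    assert (H3 : k0 * (A + B - 2 * C) + 2 * k0 * (C - tau * B) <= k0 * (A + B)).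
    { assert (0 <= k0 * (tau * B)) by (apply Rmult_le_pos; [lra|apply Rmult_le_pos; lra]). lra. }
    assert (H4 : (1 - tau) * (tau + tau ^ 2) * B <= tau * (2 * (A + B))).
    { replace ((1 - tau) * (tau + tau ^ 2) * B) with (tau * ((1 - tau ^ 2) * B)) by ring.
      apply Rmult_le_compat_l; [lra|].
      assert (0 <= tau ^ 2 * B) by (apply Rmult_le_pos; [apply pow2_ge_0|lra]). lra. }
    assert (H5 : - ((1 - tau) * (1 + tau) * (c0 / 2) * B) <= - (c0 / 2 * B) + tau * c0 * (A + B)).
    { replace ((1 - tau) * (1 + tau) * (c0 / 2) * B) with (c0 / 2 * B - tau * (tau * (c0 / 2 * B))) by ring.
      assert (0 <= c0 / 2 * B) by (apply Rmult_le_pos; lra).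
      assert (tau * (tau * (c0 / 2 * B)) <= tau * (1 * (c0 / 2 * B))).
      { apply Rmult_le_compat_l; [lra|]. apply Rmult_le_compat_r; lra. }
      assert (0 <= tau * (c0 * A)) by (apply Rmult_le_pos; [lra|apply Rmult_le_pos; lra]).
      assert (0 <= tau * (c0 * B)) by (apply Rmult_le_pos; [lra|apply Rmult_le_pos; lra]).
      lra. }
    assert (0 <= tau * A) by (apply Rmult_le_pos; lra).
    assert (0 <= tau * B) by (apply Rmult_le_pos; lra).
    assert (0 <= tau * (Rg * (A + B))) by (apply Rmult_le_pos; [lra|apply Rmult_le_pos; lra]).
    assert (0 <= tau * (k0 * (A + B))) by (apply Rmult_le_pos; [lra|apply Rmult_le_pos; lra]).
    lra. }
  set (K := INR M * (8 + 8 / gam) + 8 + 8 * Rg + 4 * k0 + 2 * c0) in *.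
  assert (HK : (tau + dl) * K * (A + B) <= (c0 / 2 - k0 - Rg) * (A + B))
    by (apply Rmult_le_compat_r; lra).
  assert (Ht2 : tau * (8 / gam) <= (tau + dl) * (8 / gam)) by (apply Rmult_le_compat_r; lra).
  assert (INR M * ((8 * (tau + dl) + tau * (8 / gam)) * (A + B))
    <= (tau + dl) * (INR M * (8 + 8 / gam)) * (A + B)).
  { replace ((tau + dl) * (INR M * (8 + 8 / gam)) * (A + B))
      with (INR M * ((8 * (tau + dl) + (tau + dl) * (8 / gam)) * (A + B))) by ring.
    apply Rmult_le_compat_l; [lra|]. apply Rmult_le_compat_r; lra. }
  assert (tau * (6 + 6 * Rg + 4 * k0 + c0) * (A + B) <= (tau + dl) * (6 + 6 * Rg + 4 * k0 + c0) * (A + B)).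
  { apply Rmult_le_compat_r; [lra|]. apply Rmult_le_compat_r; lra. }
  assert (0 <= (tau + dl) * ((2 * Rg + c0) * (A + B))).
  { apply Rmult_le_pos; [lra|]. apply Rmult_le_pos; lra. }
  assert (0 <= dl * (A + B)) by (apply Rmult_le_pos; lra).
  assert (0 <= tau * (A + B)) by (apply Rmult_le_pos; lra).
  assert (HKe : (tau + dl) * K * (A + B) = (tau + dl) * (INR M * (8 + 8 / gam)) * (A + B)
     + (tau + dl) * (6 + 6 * Rg + 4 * k0 + c0) * (A + B) + (tau + dl) * ((2 * Rg + c0) * (A + B))
     + 2 * (dl * (A + B)) + 2 * (tau * (A + B))) by (unfold K; ring).
  lra.
Qed.

(** With [de] the offset of the reference from the solution, [de + b] is [xi]. The filtered gaps
    contribute [c0 / (2 * tau) * de ^ 2], so for small [tau] all terms in [de] are affordable and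
    the coefficient of [b ^ 2] decides. After minimisation over each [f] the terms in [INR M]
    compensate there and at least [c / 2] remains at [tau = 0]; of this [c / 8] is kept and the rest
    pays for cross terms and errors in [tau]. *)
Lemma storage_lower M gam tau c c0 Rg th a b de (e f : nat -> R) :
  0 < gam <= 1 -> 0 < tau <= 1 / 4 -> tau <= gam / 2 -> 0 < c0 <= c -> INR M <= c -> 0 < th ->
  0 <= c0 / 2 - (1 + gam) * INR M / 4 - Rg ->
  let K := c + 3 * INR M + 2 in
  tau * (1 + c0 / 2 + INR M + / th) <= c / 8 ->
  tau * (c / 8 + 2 * K ^ 2 / c + 1 / 2 + INR M / gam + / th) <= 3 * c0 / 8 ->
  c / 8 * (b ^ 2 + de ^ 2)
  <= c / 2 * (de + b) ^ 2
     + (/ 2 * (de + b + a) ^ 2 + rsum M (fun j => / 2 * (de + b + e j) ^ 2))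
     - (INR M + 1) / 2 * (de + b) ^ 2
     + (1 - tau) * (/ 2 * b ^ 2 + de * b - tau / 2 * b ^ 2
         + rsum M (fun j => (de + b) * f j - (1 + gam) * (b * f j) + (gam - tau) / 2 * f j ^ 2)
         + c0 / 2 * b ^ 2 + c0 / (2 * tau) * de ^ 2)
     + ((1 + gam) * INR M / 4 - Rg) * b ^ 2
     - (de ^ 2 + tau ^ 2 * b ^ 2) / th.
Proof.
  intros Hg Ht Htg Hc0 HMc Hth Hmu K Ht1 Ht2.
  assert (HM := pos_INR M). set (m := INR M) in *.
  assert (Hse : 0 <= rsum M (fun j => / 2 * (de + b + e j) ^ 2)).
  { apply rsum_nonneg; intros. apply Rmult_le_pos; [lra|apply pow2_ge_0]. }
  assert (Ha : 0 <= (de + b + a) ^ 2) by apply pow2_ge_0.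
  set (g' := gam - tau). assert (Hg' : gam / 2 <= g') by (unfold g'; lra).
  assert (Hf : - m * ((de - gam * b) ^ 2 / (2 * g'))
     <= rsum M (fun j => (de + b) * f j - (1 + gam) * (b * f j) + g' / 2 * f j ^ 2)).
  { apply Rle_trans with (rsum M (fun _ => - ((de - gam * b) ^ 2 / (2 * g')))).
    - rewrite rsum_const. unfold m. right; ring.
    - apply rsum_le. intros j _.
      assert (0 <= g' / 2 * (f j + (de - gam * b) / g') ^ 2)
        by (apply Rmult_le_pos; [lra|apply pow2_ge_0]).
      replace (g' / 2 * (f j + (de - gam * b) / g') ^ 2)
        with (g' / 2 * f j ^ 2 + (de - gam * b) * f j + (de - gam * b) ^ 2 / (2 * g')) in H by (field; lra).
      lra. }
  set (B := b ^ 2) in *. set (E := de ^ 2) in *.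
  assert (HB : 0 <= B) by apply pow2_ge_0. assert (HE : 0 <= E) by apply pow2_ge_0.
  assert (Hig : / g' <= 2 / gam).
  { unfold Rdiv. rewrite <- (Rinv_inv 2), <- Rinv_mult. apply Rinv_le_contravar; [|lra].
    apply Rmult_lt_0_compat; lra. }
  assert (Hig0 : 0 < / g') by (apply Rinv_0_lt_compat; lra).
  assert (Hith : 0 < / th) by (apply Rinv_0_lt_compat; lra).
  set (s := rsum M (fun j => (de + b) * f j - (1 + gam) * (b * f j) + g' / 2 * f j ^ 2)) in *.
  assert (Hf' : - (m / 2 * (/ g' * E)) + m * gam * (/ g' * (de * b)) - m / 2 * (gam ^ 2 * / g' * B) <= s).
  { eapply Rle_trans; [|exact Hf]. right. unfold E, B. field. lra. }
  assert (Hgg : (1 - tau) * (gam ^ 2 * / g') <= gam + 2 * tau).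
  { apply Rmult_le_reg_r with g'; [lra|].
    replace ((1 - tau) * (gam ^ 2 * / g') * g') with ((1 - tau) * gam ^ 2) by (field; lra).
    unfold g'.
    assert (0 <= tau * (gam - 2 * tau)) by (apply Rmult_le_pos; lra).
    assert (0 <= tau * gam ^ 2) by (apply Rmult_le_pos; [lra|apply pow2_ge_0]). lra. }
  assert (Hgb : (1 - tau) * (gam * / g') <= 2).
  { assert (gam * / g' <= 2).
    { apply Rle_trans with (gam * (2 / gam)); [apply Rmult_le_compat_l; lra|right; field; lra]. }
    assert (0 <= tau * (gam * / g')) by (apply Rmult_le_pos; [lra|apply Rmult_le_pos; lra]). lra. }
  assert (Hgb0 : 0 <= (1 - tau) * (gam * / g')).
  { apply Rmult_le_pos; [lra|]. apply Rmult_le_pos; lra. }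
  set (G1 := (1 - tau) * (gam * / g')) in *. set (G2 := (1 - tau) * (gam ^ 2 * / g')) in *.
  set (X := de * b).
  assert (HX : - (K * Rabs X) <= (c - (m + 1)) * X + (1 - tau) * X + m * G1 * X).
  { assert (Hm1 : 0 <= m * G1 <= 2 * m).
    { split; [apply Rmult_le_pos; lra|]. replace (2 * m) with (m * 2) by ring. apply Rmult_le_compat_l; lra. }
    replace ((c - (m + 1)) * X + (1 - tau) * X + m * G1 * X) with ((c - m - tau + m * G1) * X) by ring.
    assert (HKb : Rabs (c - m - tau + m * G1) <= K) by (apply Rabs_le; unfold K; lra).
    apply Rle_trans with (- Rabs ((c - m - tau + m * G1) * X)); [|generalize (Rle_abs (- ((c - m - tau + m * G1) * X))); rewrite Rabs_Ropp; lra].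
    rewrite Rabs_mult. apply Ropp_le_contravar. apply Rmult_le_compat_r; [apply Rabs_pos|exact HKb]. }
  assert (HKX : K * Rabs X <= c / 8 * B + 2 * K ^ 2 / c * E).
  { unfold X. rewrite Rabs_mult.
    assert (HB' : B = Rabs b ^ 2) by (symmetry; apply pow2_abs).
    assert (HE' : E = Rabs de ^ 2) by (symmetry; apply pow2_abs).
    rewrite HB', HE'. set (bb := Rabs b). set (dd := Rabs de).
    assert (0 <= c / 8 * (bb - 4 * K / c * dd) ^ 2) by (apply Rmult_le_pos; [lra|apply pow2_ge_0]).
    replace (c / 8 * (bb - 4 * K / c * dd) ^ 2) with (c / 8 * bb ^ 2 - K * (dd * bb) + 2 * K ^ 2 / c * dd ^ 2) in H by (field; lra).
    lra. }
  assert (HE2 : (c / 8 + 2 * K ^ 2 / c) * E <= (c / 2 - (m + 1) / 2) * E + (1 - tau) * (c0 / (2 * tau) * E)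
     - (1 - tau) * (m / 2 * (/ g' * E)) - / th * E).
  { replace ((c / 2 - (m + 1) / 2) * E + (1 - tau) * (c0 / (2 * tau) * E)
     - (1 - tau) * (m / 2 * (/ g' * E)) - / th * E)
     with ((c / 2 - (m + 1) / 2 + (1 - tau) * (c0 / (2 * tau)) - (1 - tau) * (m / 2 * / g') - / th) * E) by ring.
    apply Rmult_le_compat_r; [lra|].
    assert (H1 : c / 8 + 2 * K ^ 2 / c + 1 / 2 + m / gam + / th <= 3 * c0 / 8 * / tau).
    { apply Rmult_le_reg_l with tau; [lra|]. replace (tau * (3 * c0 / 8 * / tau)) with (3 * c0 / 8) by (field; lra). lra. }
    assert (H2 : 3 * c0 / 8 * / tau <= (1 - tau) * (c0 / (2 * tau))).
    { replace ((1 - tau) * (c0 / (2 * tau))) with ((1 - tau) * c0 / 2 * / tau) by (field; lra).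
      apply Rmult_le_compat_r; [apply Rlt_le, Rinv_0_lt_compat; lra|].
      assert (0 <= (1 / 4 - tau) * c0) by (apply Rmult_le_pos; lra). lra. }
    assert (H3 : (1 - tau) * (m / 2 * / g') <= m / gam).
    { assert (m / 2 * / g' <= m / 2 * (2 / gam)) by (apply Rmult_le_compat_l; lra).
      replace (m / 2 * (2 / gam)) with (m / gam) in H by (field; lra).
      assert (0 <= tau * (m / 2 * / g')) by (apply Rmult_le_pos; [lra|apply Rmult_le_pos; lra]). lra. }
    lra. }
  assert (HB2 : (c / 8 + c / 8) * B <= (c / 2 - (m + 1) / 2) * B
     + (1 - tau) * (/ 2 * B - tau / 2 * B + c0 / 2 * B) - m / 2 * (G2 * B)
     + ((1 + gam) * m / 4 - Rg) * B - / th * (tau ^ 2 * B)).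
  { replace ((c / 2 - (m + 1) / 2) * B
     + (1 - tau) * (/ 2 * B - tau / 2 * B + c0 / 2 * B) - m / 2 * (G2 * B)
     + ((1 + gam) * m / 4 - Rg) * B - / th * (tau ^ 2 * B))
     with ((c / 2 - (m + 1) / 2 + (1 - tau) * (/ 2 - tau / 2 + c0 / 2) - m / 2 * G2
     + ((1 + gam) * m / 4 - Rg) - / th * tau ^ 2) * B) by ring.
    apply Rmult_le_compat_r; [lra|].
    assert (H1 : m / 2 * G2 <= m / 2 * (gam + 2 * tau)) by (apply Rmult_le_compat_l; lra).
    assert (H2 : tau * (tau * / th) <= tau * (1 * / th)).
    { apply Rmult_le_compat_l; [lra|]. apply Rmult_le_compat_r; lra. }
    assert (H3 : 0 <= tau * tau) by (apply Rmult_le_pos; lra).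
    lra. }
  assert (Hfin : (1 - tau) * (- (m / 2 * (/ g' * E)) + m * gam * (/ g' * (de * b)) - m / 2 * (gam ^ 2 * / g' * B))
     <= (1 - tau) * s) by (apply Rmult_le_compat_l; lra).
  assert (Hfe : (1 - tau) * (- (m / 2 * (/ g' * E)) + m * gam * (/ g' * (de * b)) - m / 2 * (gam ^ 2 * / g' * B))
     = - ((1 - tau) * (m / 2 * (/ g' * E))) + m * G1 * X - m / 2 * (G2 * B)) by (unfold G1, G2, X; ring).
  assert (Hsq : (de + b) ^ 2 = E + 2 * X + B) by (unfold E, X, B; ring).
  assert (Hth2 : (E + tau ^ 2 * B) / th = / th * E + / th * (tau ^ 2 * B)) by (unfold Rdiv; ring).
  rewrite Hsq, Hth2. fold X.
  lra.
Qed.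

(** * Positive semidefinite matrices and weighted Laplacians *)

Definition mulv (n : nat) (A : nat -> nat -> R) (x : nat -> R) (i : nat) : R :=
  rsum n (fun j => A i j * x j).

Definition qform (n : nat) (A : nat -> nat -> R) (x : nat -> R) : R :=
  rsum n (fun i => x i * mulv n A x i).

Definition schur (n : nat) (A : nat -> nat -> R) (i j : nat) : R :=
  A i j - A i n * A n j / A n n.

Lemma mulv_schur n A x i :
  A n n <> 0 -> mulv n (schur n A) x i = mulv n A x i - A i n * (mulv n A x n / A n n).
Proof.
  intros Ha. unfold mulv.
  rewrite (rsum_ext n (fun j => schur n A i j * x j)
             (fun j => A i j * x j - A i n / A n n * (A n j * x j)))
    by (intros; unfold schur; field; auto).
  rewrite rsum_minus, rsum_scal. field; auto.
Qed.

Lemma mulv_eq n A x y i : (forall j, (j < n)%nat -> x j = y j) -> mulv n A x i = mulv n A y i.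
Proof. intros H; apply rsum_ext; intros; rewrite H; auto. Qed.

Lemma qform_eq n A x y : (forall j, (j < n)%nat -> x j = y j) -> qform n A x = qform n A y.
Proof.
  intros H; apply rsum_ext; intros i Hi. rewrite (mulv_eq n A x y i H), H; auto.
Qed.

Lemma qform_succ n A x :
  qform (S n) A x = qform n A x + x n * rsum n (fun i => x i * A i n)
     + x n * (mulv n A x n + A n n * x n).
Proof.
  unfold qform at 1; cbn [rsum].
  rewrite (rsum_ext n _ (fun i => x i * mulv n A x i + x n * (x i * A i n)))
    by (intros; unfold mulv; cbn [rsum]; ring).
  rewrite rsum_plus, rsum_scal. unfold qform, mulv; cbn [rsum]. ring.
Qed.

Lemma qform_schur n A x :
  A n n <> 0 ->
  qform n (schur n A) x
  = qform n A x - rsum n (fun i => x i * A i n) * (mulv n A x n / A n n).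
Proof.
  intros Ha. unfold qform.
  rewrite (rsum_ext n _ (fun i => x i * mulv n A x i - (x i * A i n) * (mulv n A x n / A n n))).
  - rewrite rsum_minus, rsum_scalr. reflexivity.
  - intros i _. rewrite mulv_schur by auto. ring.
Qed.

Definition ext (n : nat) (x : nat -> R) (s : R) (i : nat) : R := if Nat.eqb i n then s else x i.

Lemma ext_last n x s : ext n x s n = s.
Proof. unfold ext. now rewrite Nat.eqb_refl. Qed.

Lemma ext_lt n x s i : (i < n)%nat -> ext n x s i = x i.
Proof. intros H. unfold ext. destruct (Nat.eqb_spec i n); [lia|auto]. Qed.

Lemma rsum_ext_last n x s (F : nat -> R -> R) :
  rsum (S n) (fun i => F i (ext n x s i)) = rsum n (fun i => F i (x i)) + F n s.
Proof.
  cbn [rsum]. rewrite ext_last. f_equal. apply rsum_ext; intros; rewrite ext_lt; auto.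
Qed.

Lemma rsum_sq_ext n x s :
  rsum (S n) (fun i => ext n x s i ^ 2) = rsum n (fun i => x i ^ 2) + s ^ 2.
Proof. apply (rsum_ext_last n x s (fun _ y => y ^ 2)). Qed.

Lemma mulv_ext n A x s i : mulv (S n) A (ext n x s) i = mulv n A x i + A i n * s.
Proof. apply (rsum_ext_last n x s (fun j y => A i j * y)). Qed.

(** Elimination from the last variable: the lower bound gives a pivot [A n n >= 1] and passes to the
    Schur complement. Positivity is expressed through the quadratic form since the matrix solved
    later contains the directed, nonsymmetric Laplacian. *)
Lemma posdef_solve n : forall A, (forall x, rsum n (fun i => x i ^ 2) <= qform n A x) ->
  forall b, exists x, forall i, (i < n)%nat -> mulv n A x i = b i.
Proof.
  induction n as [|n IH]; intros A HA b; [exists (fun _ => 0); intros; lia|].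
  assert (Ha : 1 <= A n n).
  { assert (H := HA (ext n (fun _ => 0) 1)). rewrite qform_succ in H.
    rewrite rsum_sq_ext in H.
    rewrite ext_last in H.
    rewrite (qform_eq n A _ (fun _ => 0)) in H by (intros; apply ext_lt; auto).
    rewrite (mulv_eq n A _ (fun _ => 0)) in H by (intros; apply ext_lt; auto).
    rewrite (rsum_ext n (fun i => ext n (fun _ => 0) 1 i * A i n) (fun _ => 0)) in H
      by (intros; rewrite ext_lt; auto; ring).
    unfold qform, mulv in H.
    rewrite (rsum_ext n (fun j => A n j * 0) (fun _ => 0)) in H by (intros; ring).
    rewrite (rsum_ext n (fun i => 0 * rsum n (fun j : nat => A i j * 0)) (fun _ => 0)) in H
      by (intros; ring).
    rewrite (rsum_ext n (fun _ => 0 ^ 2) (fun _ => 0)) in H by (intros; ring).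
    rewrite !rsum_const in H. lra. }
  assert (Ha0 : A n n <> 0) by lra.
  destruct (IH (schur n A)) with (b := fun i => b i - A i n * (b n / A n n)) as [x Hx].
  (* This value of the last variable annihilates the last row, so the form of [A] at the extended
     vector equals the form of the Schur complement at [x]. *)
  { intros x. set (s := - (mulv n A x n / A n n)). assert (H := HA (ext n x s)).
    rewrite qform_succ in H.
    rewrite rsum_sq_ext, ext_last in H.
    rewrite (qform_eq n A (ext n x s) x) in H by (intros; apply ext_lt; auto).
    rewrite (mulv_eq n A (ext n x s) x) in H by (intros; apply ext_lt; auto).
    rewrite (rsum_ext n (fun i => ext n x s i * A i n) (fun i => x i * A i n)) in H
      by (intros; rewrite ext_lt; auto).
    rewrite qform_schur by auto.
    assert (E : mulv n A x n + A n n * s = 0) by (unfold s; field; auto).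
    rewrite E in H. replace (mulv n A x n / A n n) with (- s) by (unfold s; ring).
    assert (0 <= s ^ 2) by apply pow2_ge_0. lra. }
  exists (ext n x ((b n - mulv n A x n) / A n n)). intros i Hi. rewrite mulv_ext.
  destruct (Nat.eq_dec i n) as [->|Hne].
  - field; auto.
  - assert (H := Hx i ltac:(lia)). rewrite mulv_schur in H by auto.
    replace (mulv n A x i) with (b i - A i n * (b n / A n n) + A i n * (mulv n A x n / A n n)) by lra.
    field; auto.
Qed.

Lemma mulv_sq_le n A x i :
  (mulv n A x i) ^ 2 <= INR n * rsum n (fun j => A i j ^ 2) * rsum n (fun j => x j ^ 2).
Proof.
  eapply Rle_trans; [apply rsum_sq_le|]. rewrite Rmult_assoc.
  apply Rmult_le_compat_l; [apply pos_INR|].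
  rewrite <- rsum_scal. apply rsum_le. intros j Hj. rewrite Rpow_mult_distr.
  apply Rmult_le_compat_r; [apply pow2_ge_0|].
  apply (rsum_term_le n (fun j => A i j ^ 2)); auto. intros; apply pow2_ge_0.
Qed.

(* Square completion in the last variable: the dichotomy is inherited from the Schur complement. *)
Lemma psd_dichotomy n : forall A,
  (forall i j, (i < n)%nat -> (j < n)%nat -> A i j = A j i) ->
  (forall x, 0 <= qform n A x) ->
  (exists x, (exists i, (i < n)%nat /\ x i <> 0) /\ forall i, (i < n)%nat -> mulv n A x i = 0) \/
  (exists e, 0 < e /\ forall x, e * rsum n (fun i => x i ^ 2) <= qform n A x).
Proof.
  induction n as [|n IH]; intros A Hsym Hpsd.
  { right. exists 1. split; [lra|]. intros; simpl. unfold qform; simpl; lra. }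
  assert (Hcol : forall x, rsum n (fun i => x i * A i n) = mulv n A x n).
  { intros x. apply rsum_ext; intros. rewrite (Hsym n i) by lia. ring. }
  assert (Ha : 0 <= A n n).
  { assert (H := Hpsd (ext n (fun _ => 0) 1)). rewrite qform_succ, Hcol, ext_last in H.
    rewrite (qform_eq n A _ (fun _ => 0)) in H by (intros; apply ext_lt; auto).
    rewrite (mulv_eq n A _ (fun _ => 0)) in H by (intros; apply ext_lt; auto).
    unfold qform, mulv in H.
    rewrite (rsum_ext n (fun j => A n j * 0) (fun _ => 0)) in H by (intros; ring).
    rewrite (rsum_ext n (fun i => 0 * rsum n (fun j : nat => A i j * 0)) (fun _ => 0)) in H
      by (intros; ring).
    rewrite !rsum_const in H. lra. }
  destruct (Req_dec (A n n) 0) as [H0|H0].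
  - left. exists (ext n (fun _ => 0) 1). split; [exists n; rewrite ext_last; split; [lia|lra]|].
    assert (Hz : forall i, mulv n A (fun _ => 0) i = 0).
    { intros i. unfold mulv. rewrite (rsum_ext n _ (fun _ => 0)) by (intros; ring).
      rewrite rsum_const; ring. }
    intros i Hi. rewrite mulv_ext, Hz.
    destruct (Nat.eq_dec i n) as [->|Hne]; [rewrite H0; ring|].
    (* With zero last diagonal entry, the form at [t] times the [i]-th unit vector plus the last
       unit vector is [A i i * t ^ 2 + 2 * t * A i n]; this [t] makes it negative unless
       [A i n = 0]. *)
    set (t := - (A i n) / (Rabs (A i i) + 1)).
    set (u := fun j => if Nat.eqb j i then t else 0).
    assert (Hu : forall F, rsum n (fun j => F j * u j) = F i * t).
    { intros F. rewrite (rsum_single n _ i); [|lia|].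
      - unfold u. now rewrite Nat.eqb_refl.
      - intros j _ Hj. unfold u. destruct (Nat.eqb_spec j i); [contradiction|ring]. }
    assert (H := Hpsd (ext n u 1)). rewrite qform_succ, Hcol, ext_last, H0 in H.
    rewrite (qform_eq n A _ u) in H by (intros; apply ext_lt; auto).
    rewrite (mulv_eq n A _ u) in H by (intros; apply ext_lt; auto).
    assert (E1 : mulv n A u n = A i n * t) by (unfold mulv; rewrite Hu, (Hsym n i) by lia; ring).
    assert (E2 : qform n A u = A i i * t ^ 2).
    { unfold qform. rewrite (rsum_ext n _ (fun j => mulv n A u j * u j)) by (intros; ring).
      rewrite Hu. unfold mulv; rewrite Hu. ring. }
    rewrite E1, E2 in H.
    assert (Hp : 0 < Rabs (A i i) + 1) by (generalize (Rabs_pos (A i i)); lra).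
    assert (HA : A i i <= Rabs (A i i)) by apply Rle_abs.
    set (w := Rabs (A i i) + 1) in *.
    assert (Ht : A i n = - (t * w)) by (unfold t; field; lra).
    rewrite Ht in H.
    assert (t ^ 2 * w <= 0).
    { assert (A i i * t ^ 2 <= w * t ^ 2) by (apply Rmult_le_compat_r; [apply pow2_ge_0|unfold w; lra]).
      lra. }
    assert (t = 0).
    { assert (t ^ 2 <= 0) by (apply Rmult_le_reg_r with w; lra).
      assert (0 <= t ^ 2) by apply pow2_ge_0. nra. }
    rewrite Ht, H2. ring.
  - assert (Hap : 0 < A n n) by lra.
    assert (Hq : forall x, qform (S n) A x = qform n (schur n A) x + A n n * (x n + mulv n A x n / A n n) ^ 2).
    { intros x. rewrite qform_succ, qform_schur, Hcol by auto. field; auto. }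
    destruct (IH (schur n A)) as [[x [[i [Hi Hxi]] Hx]]|[e [He Hco]]].
    + intros i j Hi Hj. unfold schur. rewrite (Hsym i j), (Hsym i n), (Hsym n j) by lia. field; auto.
    + intros x. assert (H := Hpsd (ext n x (- (mulv n A x n / A n n)))). rewrite Hq in H.
      rewrite ext_last in H.
      rewrite (qform_eq n _ (ext n x _) x) in H by (intros; apply ext_lt; auto).
      rewrite (mulv_eq n A (ext n x _) x) in H by (intros; apply ext_lt; auto).
      replace (- (mulv n A x n / A n n) + mulv n A x n / A n n) with 0 in H by ring. lra.
    + left. exists (ext n x (- (mulv n A x n / A n n))). split.
      * exists i. rewrite ext_lt by auto. split; [lia|auto].
      * intros j Hj. rewrite mulv_ext. destruct (Nat.eq_dec j n) as [->|Hne]; [field; auto|].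
        assert (H := Hx j ltac:(lia)). rewrite mulv_schur in H by auto. lra.
    + right.
      set (C := 2 * (INR n * rsum n (fun j => A n j ^ 2)) / (A n n) ^ 2).
      assert (HC : 0 <= C).
      { unfold C. apply Rmult_le_pos.
        - apply Rmult_le_pos; [lra|]. apply Rmult_le_pos; [apply pos_INR|].
          apply rsum_nonneg; intros; apply pow2_ge_0.
        - apply Rlt_le, Rinv_0_lt_compat, pow_lt; auto. }
      exists (Rmin (e / (1 + C)) (A n n / 2)). split.
      { apply Rmin_glb_lt; [apply Rdiv_lt_0_compat; lra|lra]. }
      intros x. rewrite Hq. cbn [rsum].
      set (X := rsum n (fun i => x i ^ 2)). set (l := mulv n A x n / A n n).
      assert (HX : 0 <= X) by (apply rsum_nonneg; intros; apply pow2_ge_0).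
      assert (Hl : 2 * l ^ 2 <= C * X).
      { assert (H := mulv_sq_le n A x n). fold X in H.
        unfold l, C. unfold Rdiv. rewrite Rpow_mult_distr, pow_inv.
        assert (0 < / (A n n) ^ 2) by (apply Rinv_0_lt_compat, pow_lt; auto).
        assert (mulv n A x n ^ 2 * / (A n n) ^ 2 <= INR n * rsum n (fun j => A n j ^ 2) * X * / (A n n) ^ 2)
          by (apply Rmult_le_compat_r; lra).
        lra. }
      assert (Hs : x n ^ 2 <= 2 * (x n + l) ^ 2 + C * X).
      { assert (x n ^ 2 <= 2 * (x n + l) ^ 2 + 2 * l ^ 2)
          by (generalize (pow2_ge_0 (x n + 2 * l)); lra). lra. }
      set (m := Rmin (e / (1 + C)) (A n n / 2)).
      assert (Hm1 : m <= e / (1 + C)) by apply Rmin_l.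
      assert (Hm2 : m <= A n n / 2) by apply Rmin_r.
      assert (Hm0 : 0 < m) by (apply Rmin_glb_lt; [apply Rdiv_lt_0_compat; lra|lra]).
      assert (m * (X + x n ^ 2) <= m * ((1 + C) * X) + m * (2 * (x n + l) ^ 2)).
      { rewrite <- Rmult_plus_distr_l. apply Rmult_le_compat_l; lra. }
      assert (m * ((1 + C) * X) <= e * X).
      { apply Rle_trans with (e / (1 + C) * ((1 + C) * X)).
        - apply Rmult_le_compat_r; [apply Rmult_le_pos; lra|lra].
        - right. field. lra. }
      assert (m * (2 * (x n + l) ^ 2) <= A n n / 2 * (2 * (x n + l) ^ 2)).
      { apply Rmult_le_compat_r; [|lra]. apply Rmult_le_pos; [lra|apply pow2_ge_0]. }
      assert (H4 := Hco x). fold X in H4. lra.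
Qed.

Lemma rsum_center n x :
  (0 < n)%nat -> rsum n (fun i => x i - rsum n x / INR n) = 0.
Proof.
  intros Hn. rewrite rsum_minus, rsum_const. field. apply not_0_INR; lia.
Qed.

Section SpectralGap.
Variables (n : nat) (B : nat -> nat -> R).
Hypothesis Hn : (0 < n)%nat.
Hypothesis Bsym : forall i j, (i < n)%nat -> (j < n)%nat -> B i j = B j i.
Hypothesis Bker : forall i, (i < n)%nat -> rsum n (B i) = 0.
Hypothesis Bpsd : forall x, 0 <= qform n B x.
Hypothesis Bnull : forall x, qform n B x = 0 ->
  forall i j, (i < n)%nat -> (j < n)%nat -> x i = x j.

Lemma mulv_shift x s i : (i < n)%nat -> mulv n B (fun j => x j + s) i = mulv n B x i.
Proof.
  intros Hi. unfold mulv.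
  rewrite (rsum_ext n _ (fun j => B i j * x j + B i j * s)) by (intros; ring).
  rewrite rsum_plus, rsum_scalr. rewrite Bker by auto. ring.
Qed.

Lemma sum_mulv x : rsum n (mulv n B x) = 0.
Proof.
  unfold mulv. rewrite rsum_swap.
  rewrite (rsum_ext n _ (fun _ => 0)); [rewrite rsum_const; ring|].
  intros j Hj. rewrite rsum_scalr.
  rewrite (rsum_ext n _ (B j)) by (intros; apply Bsym; auto). rewrite Bker by auto. ring.
Qed.

Lemma qform_shift x s : qform n B (fun j => x j + s) = qform n B x.
Proof.
  unfold qform. rewrite (rsum_ext n _ (fun i => x i * mulv n B x i + s * mulv n B x i)).
  - rewrite rsum_plus, rsum_scal, sum_mulv. ring.
  - intros. rewrite mulv_shift by auto. ring.
Qed.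

(** The best constant [m0] on zero-sum vectors exists as a supremum. If it were below [lam], the
    shifted matrix [C] would be positive semidefinite. A kernel vector of [C] is an eigenvector for
    [m0], which forces [m0 = 0] and then contradicts [Bnull]; coercivity of [C] would allow a
    constant larger than [m0]. The dichotomy thus replaces the spectral theorem. *)
Lemma spectral_gap lam :
  0 < lam ->
  (forall nu x, (exists i, (i < n)%nat /\ x i <> 0) ->
     (forall i, (i < n)%nat -> mulv n B x i = nu * x i) -> nu < lam -> nu = 0) ->
  forall x, rsum n x = 0 -> lam * rsum n (fun i => x i ^ 2) <= qform n B x.
Proof.
  intros Hlam Heig x0 Hx0. apply Rnot_lt_le. intros Hlt.
  set (E := fun mu => forall x, rsum n x = 0 -> mu * rsum n (fun i => x i ^ 2) <= qform n B x).
  assert (Hsq : forall x, 0 <= rsum n (fun i => x i ^ 2))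
    by (intros; apply rsum_nonneg; intros; apply pow2_ge_0).
  set (X0 := rsum n (fun i => x0 i ^ 2)) in *.
  assert (HX0 : 0 < X0).
  { destruct (Rle_lt_or_eq_dec _ _ (Hsq x0)) as [H|H]; [exact H|].
    exfalso. fold X0 in H. rewrite <- H in Hlt. generalize (Bpsd x0); lra. }
  assert (Hub : forall mu, E mu -> mu <= qform n B x0 / X0).
  { intros mu Hmu. apply Rmult_le_reg_r with X0; [auto|].
    unfold Rdiv. rewrite Rmult_assoc, Rinv_l by lra. rewrite Rmult_1_r. apply Hmu; auto. }
  destruct (completeness E) as [m0 [Hm1 Hm2]].
  { exists (qform n B x0 / X0). intros mu Hmu. auto. }
  { exists 0. intros x _. generalize (Bpsd x); lra. }
  assert (Hm0 : 0 <= m0) by (apply Hm1; intros x _; generalize (Bpsd x); lra).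
  assert (Hm0l : m0 < lam).
  { apply Rle_lt_trans with (qform n B x0 / X0); [apply Hm2; intros mu Hmu; auto|].
    apply Rmult_lt_reg_r with X0; [auto|].
    unfold Rdiv. rewrite Rmult_assoc, Rinv_l by lra. lra. }
  assert (HE : E m0).
  { intros x Hx. destruct (Rle_lt_or_eq_dec _ _ (Hsq x)) as [H|H].
    - apply Rmult_le_reg_r with (/ rsum n (fun i => x i ^ 2)); [now apply Rinv_0_lt_compat|].
      rewrite Rmult_assoc, Rinv_r by lra. rewrite Rmult_1_r. apply Hm2. intros mu Hmu.
      apply Rmult_le_reg_r with (rsum n (fun i => x i ^ 2)); [auto|].
      rewrite Rmult_assoc, Rinv_l by lra. rewrite Rmult_1_r. now apply Hmu.
    - rewrite <- H. generalize (Bpsd x); lra. }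
  assert (HnR : 1 <= INR n) by (change 1 with (INR 1); apply le_INR; lia).
  (* The multiple [t] of the all-ones matrix must outweigh [- m0] on constant vectors, that is
     [t * INR n > m0]; [m0 + 1] suffices as [INR n >= 1]. *)
  set (t := m0 + 1).
  set (C := fun i j => B i j - (if Nat.eqb i j then m0 else 0) + t).
  assert (HCm : forall x i, (i < n)%nat -> mulv n C x i = mulv n B x i - m0 * x i + t * rsum n x).
  { intros x i Hi. unfold mulv, C.
    rewrite (rsum_ext n _ (fun j => (B i j * x j - (if Nat.eqb i j then m0 else 0) * x j) + t * x j))
      by (intros; ring).
    rewrite rsum_plus, rsum_minus, rsum_scal. do 2 f_equal.
    rewrite (rsum_single n _ i); auto.
    - now rewrite Nat.eqb_refl.
    - intros j _ Hj. destruct (Nat.eqb_spec i j); [congruence|ring]. }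
  assert (HCq : forall x, qform n C x
     = qform n B x - m0 * rsum n (fun i => x i ^ 2) + t * (rsum n x) ^ 2).
  { intros x. unfold qform at 1.
    rewrite (rsum_ext n _ (fun i => (x i * mulv n B x i - m0 * x i ^ 2) + (t * rsum n x) * x i))
      by (intros; rewrite HCm by auto; ring).
    rewrite rsum_plus, rsum_minus, !rsum_scal. unfold qform. ring. }
  destruct (psd_dichotomy n C) as [[x [Hnz Hx]]|[e [He Hco]]].
  - intros i j Hi Hj. unfold C. rewrite (Bsym i j) by auto. rewrite (Nat.eqb_sym j i). reflexivity.
  - intros x. rewrite HCq.
    set (s := rsum n x / INR n). set (y := fun i => x i + - s).
    assert (Hy : rsum n y = 0) by (unfold y; apply (rsum_center n x Hn)).
    assert (Hs : rsum n x = s * INR n) by (unfold s; field; lra).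
    assert (H1 := HE y Hy). unfold y in H1 at 2. rewrite qform_shift in H1.
    assert (H2 : rsum n (fun i => y i ^ 2) = rsum n (fun i => x i ^ 2) - INR n * s ^ 2).
    { unfold y. rewrite (rsum_ext n _ (fun i => x i ^ 2 + (- (2 * s) * x i + s ^ 2))) by (intros; ring).
      rewrite !rsum_plus, rsum_scal, rsum_const, Hs. ring. }
    rewrite H2 in H1. rewrite Hs.
    assert (0 <= INR n * s ^ 2 * (t * INR n - m0)).
    { apply Rmult_le_pos; [apply Rmult_le_pos; [lra|apply pow2_ge_0]|]. unfold t. nra. }
    lra.
  - assert (Hs0 : rsum n x = 0).
    { assert (H : rsum n (mulv n C x) = 0)
        by (rewrite (rsum_ext n _ (fun _ => 0)) by auto; rewrite rsum_const; ring).
      rewrite (rsum_ext n _ (fun i => mulv n B x i - m0 * x i + t * rsum n x)) in H by auto.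
      rewrite rsum_plus, rsum_minus, rsum_scal, rsum_const, sum_mulv in H.
      assert (H' : rsum n x * (t * INR n - m0) = 0) by lra.
      apply Rmult_integral in H'. destruct H' as [H'|H']; [auto|]. exfalso. unfold t in H'. nra. }
    assert (Hev : forall i, (i < n)%nat -> mulv n B x i = m0 * x i).
    { intros i Hi. assert (H := Hx i Hi). rewrite HCm, Hs0 in H by auto. lra. }
    assert (Hm00 : m0 = 0) by (apply (Heig m0 x); auto).
    assert (Hq0 : qform n B x = 0).
    { unfold qform. rewrite (rsum_ext n _ (fun _ => 0)); [rewrite rsum_const; ring|].
      intros i Hi. rewrite Hev, Hm00 by auto. ring. }
    destruct Hnz as [i [Hi Hxi]]. apply Hxi.
    assert (H : rsum n x = INR n * x i).
    { rewrite <- rsum_const. apply rsum_ext; intros; now apply Bnull. }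
    rewrite Hs0 in H. symmetry in H. apply Rmult_integral in H. destruct H; [lra|auto].
  - assert (HEe : E (m0 + e)).
    { intros x Hx. assert (H := Hco x). rewrite HCq, Hx in H. lra. }
    generalize (Hm1 _ HEe). lra.
Qed.
End SpectralGap.

(** * The Laplacian of a strongly connected digraph, weighted by its left eigenvector *)

Section Graph.
Variables (n q : nat) (a : nat -> nat -> R) (h : nat -> R).
Hypothesis Ha_nonneg : forall i j, (i < n)%nat -> (j < n)%nat -> 0 <= a i j.
Hypothesis HA3 : strongly_connected n a.
Hypothesis Hh_pos : forall i, (i < n)%nat -> 0 < h i.
Hypothesis Hh_left : forall j, (j < n)%nat -> rsum n (fun i => h i * lap n a i j) = 0.
Hypothesis Hh_sum : rsum n h = 1.

Notation Lap := (mulv n (lap n a)).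

Lemma lap_mulv x i : (i < n)%nat -> Lap x i = rsum n (fun j => a i j * (x i - x j)).
Proof.
  intros Hi. unfold mulv, lap.
  rewrite (rsum_ext n _ (fun j => (if Nat.eqb i j then rsum n (fun l => a i l) else 0) * x j - a i j * x j))
    by (intros; ring).
  rewrite rsum_minus, (rsum_single n (fun j => (if Nat.eqb i j then _ else 0) * x j) i); auto.
  - rewrite Nat.eqb_refl, <- rsum_scalr, <- rsum_minus. apply rsum_ext; intros; ring.
  - intros j _ Hj. destruct (Nat.eqb_spec i j); [congruence|ring].
Qed.

Lemma lap_const s i : (i < n)%nat -> Lap (fun _ => s) i = 0.
Proof.
  intros Hi. rewrite lap_mulv by auto.
  rewrite (rsum_ext n _ (fun _ => 0)) by (intros; ring). rewrite rsum_const; ring.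
Qed.

Lemma lap_left x : rsum n (fun i => h i * Lap x i) = 0.
Proof.
  unfold mulv.
  rewrite (rsum_ext n _ (fun i => rsum n (fun j => h i * lap n a i j * x j))).
  - rewrite rsum_swap. rewrite (rsum_ext n _ (fun _ => 0)); [rewrite rsum_const; ring|].
    intros j Hj. rewrite rsum_scalr, Hh_left by auto. ring.
  - intros i _. rewrite <- rsum_scal. apply rsum_ext; intros; ring.
Qed.

Definition lapform (x : nat -> R) : R := rsum n (fun i => h i * (x i * Lap x i)).

Lemma left_balance j : (j < n)%nat -> rsum n (fun i => h i * a i j) = h j * rsum n (fun l => a j l).
Proof.
  intros Hj. assert (H := Hh_left j Hj). unfold lap in H.
  rewrite (rsum_ext n _ (fun i => h i * (if Nat.eqb i j then rsum n (fun l => a i l) else 0) - h i * a i j)) in H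
    by (intros; ring).
  rewrite rsum_minus, (rsum_single n (fun i => h i * (if Nat.eqb i j then rsum n (fun l => a i l) else 0)) j) in H; auto.
  - rewrite Nat.eqb_refl in H. lra.
  - intros i _ Hi. destruct (Nat.eqb_spec i j); [congruence|ring].
Qed.

(** By [left_balance] the weights [h i * a i j] have equal row and column sums, and for such a
    balanced digraph the form of the directed Laplacian is a Dirichlet energy. *)
Lemma lapform_sq x :
  lapform x = / 2 * rsum n (fun i => rsum n (fun j => h i * a i j * (x i - x j) ^ 2)).
Proof.
  set (S1 := rsum n (fun i => h i * x i ^ 2 * rsum n (fun j => a i j))).
  set (S2 := rsum n (fun i => rsum n (fun j => h i * a i j * (x i * x j)))).
  assert (E1 : lapform x = S1 - S2).
  { unfold lapform, S1, S2. rewrite <- rsum_minus. apply rsum_ext; intros i Hi.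
    rewrite lap_mulv by auto.
    rewrite (rsum_ext n (fun j => a i j * (x i - x j)) (fun j => a i j * x i - a i j * x j)) by (intros; ring).
    rewrite rsum_minus, (rsum_scalr n (x i) (fun j => a i j)).
    rewrite (rsum_ext n (fun j => h i * a i j * (x i * x j)) (fun j => (h i * x i) * (a i j * x j))) by (intros; ring).
    rewrite (rsum_scal n (h i * x i) (fun j => a i j * x j)). ring. }
  assert (E2 : rsum n (fun i => rsum n (fun j => h i * a i j * x j ^ 2)) = S1).
  { rewrite rsum_swap. apply rsum_ext; intros j Hj. rewrite rsum_scalr, left_balance by auto. ring. }
  assert (E3 : rsum n (fun i => rsum n (fun j => h i * a i j * x i ^ 2)) = S1).
  { apply rsum_ext; intros i _. rewrite (rsum_scalr n (x i ^ 2)), (rsum_scal n (h i) (fun j => a i j)). ring. }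
  rewrite (rsum_ext n (fun i => rsum n (fun j => h i * a i j * (x i - x j) ^ 2))
     (fun i => rsum n (fun j => h i * a i j * x i ^ 2) + rsum n (fun j => h i * a i j * x j ^ 2)
        - 2 * rsum n (fun j => h i * a i j * (x i * x j)))).
  - rewrite rsum_minus, rsum_plus, rsum_scal, E2, E3, E1. unfold S2. field.
  - intros i _. rewrite <- rsum_scal, <- rsum_plus, <- rsum_minus. apply rsum_ext; intros; ring.
Qed.

Lemma lapform_nonneg x : 0 <= lapform x.
Proof.
  rewrite lapform_sq. apply Rmult_le_pos; [lra|].
  apply rsum_nonneg; intros i Hi. apply rsum_nonneg; intros j Hj.
  apply Rmult_le_pos; [|apply pow2_ge_0]. apply Rmult_le_pos; [apply Rlt_le|]; auto.
Qed.

Lemma lapform_null x : lapform x = 0 -> forall i j, (i < n)%nat -> (j < n)%nat -> x i = x j.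
Proof.
  intros H. rewrite lapform_sq in H.
  assert (Hpos : forall i j, (i < n)%nat -> (j < n)%nat -> 0 <= h i * a i j * (x i - x j) ^ 2).
  { intros i j Hi Hj. apply Rmult_le_pos; [|apply pow2_ge_0].
    apply Rmult_le_pos; [apply Rlt_le|]; auto. }
  assert (Hedge : forall i j, (i < n)%nat -> (j < n)%nat -> 0 < a i j -> x i = x j).
  { intros i j Hi Hj Hij.
    assert (H1 : h i * a i j * (x i - x j) ^ 2 <= 0).
    { apply Rle_trans with (rsum n (fun j => h i * a i j * (x i - x j) ^ 2)).
      - apply (rsum_term_le n (fun j => h i * a i j * (x i - x j) ^ 2)); auto.
      - apply Rle_trans with (rsum n (fun i => rsum n (fun j => h i * a i j * (x i - x j) ^ 2))); [|lra].
        apply (rsum_term_le n (fun i => rsum n (fun j => h i * a i j * (x i - x j) ^ 2))); auto.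
        intros i' Hi'. apply rsum_nonneg; auto. }
    assert (Hha : 0 < h i * a i j) by (apply Rmult_lt_0_compat; auto).
    assert ((x i - x j) ^ 2 <= 0) by (apply Rmult_le_reg_l with (h i * a i j); lra).
    assert (H3 := pow2_ge_0 (x i - x j)). nra. }
  intros i j Hi Hj.
  assert (Hr := HA3 i j Hi Hj). clear Hj.
  induction Hr as [i|i j k Hj Hk Hr IH Hkj]; [reflexivity|].
  rewrite IH by auto. symmetry. now apply Hedge.
Qed.

Definition symL (i j : nat) : R := (h i * lap n a i j + lap n a j i * h j) / 2.

Lemma qform_symL x : qform n symL x = lapform x.
Proof.
  unfold qform, lapform, mulv, symL.
  rewrite (rsum_ext n _ (fun i => / 2 * rsum n (fun j => x i * (h i * lap n a i j * x j))
     + / 2 * rsum n (fun j => x i * (lap n a j i * h j * x j)))).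
  2: { intros i _. rewrite <- !rsum_scal, <- rsum_plus. apply rsum_ext; intros; field. }
  rewrite rsum_plus, !rsum_scal.
  rewrite (rsum_swap n n (fun i j => x i * (lap n a j i * h j * x j))).
  rewrite (rsum_ext n (fun j => rsum n (fun i => x i * (lap n a j i * h j * x j)))
     (fun i => rsum n (fun j => x i * (h i * lap n a i j * x j)))).
  - rewrite (rsum_ext n (fun i => h i * (x i * _)) (fun i => rsum n (fun j => x i * (h i * lap n a i j * x j)))).
    + field.
    + intros i _. rewrite <- !rsum_scal. apply rsum_ext; intros; ring.
  - intros j _. apply rsum_ext; intros; ring.
Qed.

(** The matrix is [symL] tensored with the identity of size [q], so its eigenvalue problem decouples
    into coordinates. *)
Lemma boldL_mulv v i k :
  (k < q)%nat ->
  rsum n (fun j => rsum q (fun l => boldL n a h i k j l * v j l)) = mulv n symL (fun j => v j k) i.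
Proof.
  intros Hk. unfold mulv. apply rsum_ext; intros j _.
  rewrite (rsum_single q _ k); auto.
  - unfold boldL. now rewrite Nat.eqb_refl.
  - intros l _ Hl. unfold boldL. destruct (Nat.eqb_spec k l); [congruence|ring].
Qed.

(** Eigenvalues are nonnegative because the form is a Dirichlet energy, and constant vectors give
    the eigenvalue 0. The definition of [lam] provides an eigenvalue below it, hence [lam > 0], and
    allows only one, hence it is 0; this is the hypothesis of [spectral_gap]. *)
Lemma lambda2_gap lam :
  is_lambda2_nq n q (boldL n a h) lam ->
  (0 < n)%nat /\ 0 < lam /\
  forall x, lam * rsum n (fun i => (x i - rsum n x / INR n) ^ 2) <= lapform x.
Proof.
  intros [[v0 [[i0 [k0 [Hi0 [Hk0 _]]]] _]] [[mu [Hmu Hmul]] Huniq]].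
  assert (Hn : (0 < n)%nat) by lia.
  assert (Hrow : forall i, (i < n)%nat -> rsum n (symL i) = 0).
  { intros i Hi. unfold symL.
    rewrite (rsum_ext n _ (fun j => h i / 2 * (lap n a i j * 1) + / 2 * (h j * lap n a j i)))
      by (intros; field).
    rewrite rsum_plus, !rsum_scal, Hh_left by auto.
    assert (H := lap_const 1 i Hi). unfold mulv in H. rewrite H. ring. }
  assert (Hsym : forall i j, (i < n)%nat -> (j < n)%nat -> symL i j = symL j i)
    by (intros; unfold symL; field).
  assert (Hnn : forall nu, is_eig_nq n q (boldL n a h) nu -> 0 <= nu).
  { intros nu [v [[i [k [Hi [Hk Hv]]]] He]].
    set (y := fun j => v j k).
    assert (H : qform n symL y = nu * rsum n (fun i => y i ^ 2)).
    { unfold qform. rewrite <- rsum_scal. apply rsum_ext; intros j Hj.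
      assert (H := He j k Hj Hk). rewrite boldL_mulv in H by auto. fold y in H. rewrite H.
      unfold y. ring. }
    rewrite qform_symL in H. assert (H1 := lapform_nonneg y). rewrite H in H1.
    assert (H2 : 0 < rsum n (fun i => y i ^ 2)).
    { apply Rlt_le_trans with (y i ^ 2).
      - assert (0 <= y i ^ 2) by apply pow2_ge_0. unfold y in *. nra.
      - apply (rsum_term_le n (fun i => y i ^ 2)); auto. intros; apply pow2_ge_0. }
    apply Rmult_le_reg_r with (rsum n (fun i => y i ^ 2)); lra. }
  assert (Heig : forall nu x, (exists i, (i < n)%nat /\ x i <> 0) ->
     (forall i, (i < n)%nat -> mulv n symL x i = nu * x i) -> is_eig_nq n q (boldL n a h) nu).
  (* The eigenvector is placed in coordinate 0 of every agent, a coordinate that exists because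
     [k0 < q]. *)
  { intros nu x [i [Hi Hx]] He. exists (fun j l => if Nat.eqb l 0 then x j else 0). split.
    - exists i, 0%nat. simpl. repeat split; auto; lia.
    - intros j k Hj Hk. rewrite boldL_mulv by auto.
      destruct (Nat.eqb_spec k 0); [now apply He|].
      unfold mulv. rewrite (rsum_ext n _ (fun _ => 0)) by (intros; ring). rewrite rsum_const; ring. }
  assert (Hlam : 0 < lam) by (generalize (Hnn mu Hmu); lra).
  split; [exact Hn|]. split; [exact Hlam|].
  assert (H0 : is_eig_nq n q (boldL n a h) 0).
  { apply (Heig 0 (fun _ => 1)); [exists 0%nat; split; [lia|lra]|].
    intros i Hi. unfold mulv. rewrite (rsum_ext n _ (symL i)) by (intros; ring).
    rewrite Hrow by auto. ring. }
  intros x.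
  assert (Hgap := spectral_gap n symL Hn Hsym Hrow
    (fun x => eq_ind_r (fun r => 0 <= r) (lapform_nonneg x) (qform_symL x))
    (fun x H => lapform_null x (eq_trans (eq_sym (qform_symL x)) H)) lam Hlam).
  assert (Hg := fun H => Hgap H (fun i => x i + - (rsum n x / INR n)) (rsum_center n x Hn)).
  rewrite qform_shift in Hg by auto. rewrite qform_symL in Hg. apply Hg.
  intros nu y Hy He Hlt. apply (Huniq nu 0); auto. now apply (Heig nu y).
Qed.

Lemma h_le_1 i : (i < n)%nat -> h i <= 1.
Proof.
  intros Hi. rewrite <- Hh_sum. apply (rsum_term_le n h); auto.
  intros; apply Rlt_le; auto.
Qed.

(** The form pairs the centred vector with [h i * Lap x i], so Young's inequality and [h i <= 1]
    turn the gap of the form into a lower bound for the Laplacian itself. With [hmean_dev] this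
    yields the constant [C1] used for the filtered references. *)
Lemma gap_lap lam :
  (0 < n)%nat -> 0 < lam ->
  (forall x, lam * rsum n (fun i => (x i - rsum n x / INR n) ^ 2) <= lapform x) ->
  forall x, lam ^ 2 * rsum n (fun i => (x i - rsum n x / INR n) ^ 2) <= rsum n (fun i => Lap x i ^ 2).
Proof.
  intros Hn Hlam Hgap x. assert (H := Hgap x).
  set (s := rsum n x / INR n) in *. set (X := rsum n (fun i => (x i - s) ^ 2)) in *.
  assert (H1 : lapform x = rsum n (fun i => (x i - s) * (h i * Lap x i))).
  { rewrite (rsum_ext n (fun i => (x i - s) * (h i * Lap x i))
       (fun i => h i * (x i * Lap x i) - s * (h i * Lap x i))) by (intros; ring).
    rewrite rsum_minus, rsum_scal, lap_left. unfold lapform. ring. }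
  assert (H2 : lam * lapform x <= rsum n (fun i => / 2 * (lam ^ 2 * (x i - s) ^ 2) + / 2 * Lap x i ^ 2)).
  { rewrite H1, <- rsum_scal. apply rsum_le; intros i Hi.
    assert (0 < h i) by auto. assert (h i <= 1) by now apply h_le_1.
    set (l := Lap x i). assert (0 <= l ^ 2) by apply pow2_ge_0.
    assert (h i ^ 2 <= 1) by nra.
    assert (h i ^ 2 * l ^ 2 <= 1 * l ^ 2) by (apply Rmult_le_compat_r; lra).
    generalize (pow2_ge_0 (lam * (x i - s) - h i * l)). lra. }
  rewrite rsum_plus, !rsum_scal in H2. fold X in H2.
  assert (lam * (lam * X) <= lam * lapform x) by (apply Rmult_le_compat_l; lra).
  lra.
Qed.

Lemma hmean_dev x :
  (0 < n)%nat ->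
  rsum n (fun i => (x i - rsum n (fun l => h l * x l)) ^ 2)
  <= 2 * (1 + INR n) * rsum n (fun i => (x i - rsum n x / INR n) ^ 2).
Proof.
  intros Hn. set (s := rsum n x / INR n). set (X := rsum n (fun i => (x i - s) ^ 2)).
  set (m := rsum n (fun l => h l * (x l - s))).
  assert (Hm : rsum n (fun l => h l * x l) = m + s).
  { unfold m. rewrite (rsum_ext n (fun l => h l * (x l - s)) (fun l => h l * x l - h l * s)) by (intros; ring).
    rewrite rsum_minus, rsum_scalr, Hh_sum. ring. }
  assert (Hm3 : m ^ 2 <= X).
  { unfold m, X.
    assert (Hj : (rsum n (fun l => h l * (x l - s))) ^ 2 <= rsum n (fun l => h l * (x l - s) ^ 2)).
    { fold m. assert (0 <= rsum n (fun l => h l * (x l - s - m) ^ 2)).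
      { apply rsum_nonneg; intros i Hi. apply Rmult_le_pos; [apply Rlt_le; auto|apply pow2_ge_0]. }
      rewrite (rsum_ext n _ (fun l => h l * (x l - s) ^ 2 + (- (2 * m) * (h l * (x l - s)) + h l * m ^ 2)))
        in H by (intros; ring).
      rewrite !rsum_plus, rsum_scal, rsum_scalr, Hh_sum in H. fold m in H. lra. }
    eapply Rle_trans; [exact Hj|]. apply rsum_le; intros i Hi.
    assert (h i <= 1) by now apply h_le_1. assert (0 <= (x i - s) ^ 2) by apply pow2_ge_0. nra. }
  rewrite Hm.
  apply Rle_trans with (rsum n (fun i => 2 * (x i - s) ^ 2 + 2 * m ^ 2)).
  - apply rsum_le; intros i _. generalize (pow2_ge_0 (x i - s + m)). lra.
  - rewrite rsum_plus, rsum_scal, rsum_const. fold X.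
    assert (INR n * m ^ 2 <= INR n * X) by (apply Rmult_le_compat_l; [apply pos_INR|lra]).
    lra.
Qed.

(** The weight [r] of [h i * om i ^ 2] is split: [/ (2 * (1 + 2 * eta))] absorbs [om i * It i],
    which produces the coefficient of [It i ^ 2], and [q1] absorbs the product of [N] and [om]. As
    [om] has zero [h]-mean, this product sees only the deviation of [N] from its mean, which the
    Laplacian controls. *)
Lemma graph_dissipation lam alpha eta hstar :
  (0 < n)%nat -> 0 < lam ->
  (forall x, lam * rsum n (fun i => (x i - rsum n x / INR n) ^ 2) <= lapform x) ->
  0 < eta -> alpha > (eta + 1) ^ 2 / (eta * lam) ->
  0 < hstar -> (forall i, (i < n)%nat -> hstar <= h i) ->
  exists p r kap, 0 < p /\ 0 < r /\ p + r = 1 /\ 0 < kap /\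
  forall N om It, rsum n (fun i => h i * om i) = 0 ->
    rsum n (fun i => - (alpha * p) * (h i * (N i * Lap N i)) - h i * (N i * om i)
                     - r * (h i * om i ^ 2) - r * (om i * It i))
    <= - kap * rsum n (fun i => (N i - rsum n N / INR n) ^ 2 + om i ^ 2)
       + (1 + 2 * eta) / (8 * (1 + eta) ^ 2 * hstar) * rsum n (fun i => It i ^ 2).
Proof.
  intros Hn Hlam Hgap Heta Halpha Hhs Hmin.
  set (p := (1 + 2 * eta) / (2 * (1 + eta))). set (r := / (2 * (1 + eta))).
  set (pA0 := (1 + 2 * eta) * (1 + eta) / (2 * eta)).
  set (q1 := eta / (2 * (1 + 2 * eta) * (1 + eta))).
  set (R0 := (1 + 2 * eta) / (8 * (1 + eta) ^ 2 * hstar)).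
  assert (Hp : 0 < p) by (unfold p; apply Rdiv_lt_0_compat; lra).
  assert (Hr : 0 < r) by (unfold r; apply Rinv_0_lt_compat; lra).
  assert (HpA0 : 0 < pA0) by (unfold pA0; apply Rdiv_lt_0_compat; [apply Rmult_lt_0_compat|]; lra).
  assert (Hq1 : 0 < q1).
  { unfold q1; apply Rdiv_lt_0_compat; [lra|]. apply Rmult_lt_0_compat; lra. }
  assert (HR0 : 0 < R0).
  { unfold R0; apply Rdiv_lt_0_compat; [lra|]. apply Rmult_lt_0_compat; [|auto].
    apply Rmult_lt_0_compat; [lra|apply pow_lt; lra]. }
  assert (Hpq : 4 * pA0 * q1 = 1) by (unfold pA0, q1; field; lra).
  (* The bound on [alpha] says exactly that [alpha * p * lam > pA0], and [4 * pA0 * q1 = 1] is the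
     discriminant condition for the cross term. The surplus [s] makes [k1], and then [kap],
     positive. *)
  set (s := alpha * p * lam - pA0).
  assert (Hs : 0 < s).
  { assert (alpha * (p * lam) > (eta + 1) ^ 2 / (eta * lam) * (p * lam)).
    { apply Rmult_gt_compat_r; [apply Rmult_lt_0_compat; lra|lra]. }
    assert ((eta + 1) ^ 2 / (eta * lam) * (p * lam) = pA0) by (unfold p, pA0; field; lra).
    unfold s. lra. }
  set (k1 := q1 - / (4 * (pA0 + s / 2))).
  assert (Hk1 : 0 < k1).
  { assert (q1 = / (4 * pA0)) by (unfold pA0, q1; field; lra).
    unfold k1. rewrite H. apply Rlt_0_minus. apply Rinv_lt_contravar; [|lra].
    apply Rmult_lt_0_compat; lra. }
  set (kap := Rmin (s / 2) (k1 * hstar ^ 2)).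
  assert (Hkap : 0 < kap).
  { apply Rmin_glb_lt; [lra|]. apply Rmult_lt_0_compat; [auto|apply pow_lt; auto]. }
  assert (Hkap1 : kap <= s / 2) by apply Rmin_l.
  assert (Hkap2 : kap <= k1 * hstar ^ 2) by apply Rmin_r.
  exists p, r, kap. split; [exact Hp|]. split; [exact Hr|]. split; [unfold p, r; field; lra|].
  split; [exact Hkap|].
  intros N om It Hom. set (m := rsum n N / INR n).
  assert (Hloc : forall i, (i < n)%nat ->
     - (alpha * p * lam) * (N i - m) ^ 2 - h i * ((N i - m) * om i) - r * (h i * om i ^ 2) - r * (om i * It i)
     <= - kap * ((N i - m) ^ 2 + om i ^ 2) + R0 * It i ^ 2).
  { intros i Hi. assert (Hhi := Hmin i Hi). assert (Hhi1 := h_le_1 i Hi).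
    set (y := N i - m). set (o := om i). set (I := It i). set (hi := h i) in *.
    assert (Hy := pow2_ge_0 y). assert (Ho := pow2_ge_0 o). assert (HI := pow2_ge_0 I).
    assert (E1 : r * (hi * o ^ 2) = / (2 * (1 + 2 * eta)) * (hi * o ^ 2) + q1 * (hi * o ^ 2))
      by (unfold r, q1; field; lra).
    assert (H1 : 0 <= / (2 * (1 + 2 * eta)) * (hi * o ^ 2) + r * (o * I) + R0 * I ^ 2).
    { assert (/ (2 * (1 + 2 * eta)) * (hstar * o ^ 2) <= / (2 * (1 + 2 * eta)) * (hi * o ^ 2)).
      { apply Rmult_le_compat_l; [apply Rlt_le, Rinv_0_lt_compat; lra|].
        apply Rmult_le_compat_r; lra. }
      assert (E : / (2 * (1 + 2 * eta)) * (hstar * o ^ 2) + r * (o * I) + R0 * I ^ 2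
        = / (2 * (1 + 2 * eta) * hstar) * (hstar * o + (1 + 2 * eta) / (2 * (1 + eta)) * I) ^ 2).
      { unfold r, R0. field. lra. }
      assert (0 <= / (2 * (1 + 2 * eta) * hstar) * (hstar * o + (1 + 2 * eta) / (2 * (1 + eta)) * I) ^ 2).
      { apply Rmult_le_pos; [|apply pow2_ge_0]. apply Rlt_le, Rinv_0_lt_compat.
        apply Rmult_lt_0_compat; lra. }
      lra. }
    assert (H2 : (hi * o) ^ 2 <= hi * o ^ 2).
    { assert (hi * (hi * o ^ 2) <= 1 * (hi * o ^ 2)).
      { apply Rmult_le_compat_r; [apply Rmult_le_pos; lra|lra]. }
      replace ((hi * o) ^ 2) with (hi * (hi * o ^ 2)) by ring. lra. }
    assert (H3 : hstar ^ 2 * o ^ 2 <= (hi * o) ^ 2).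
    { rewrite Rpow_mult_distr. apply Rmult_le_compat_r; [auto|]. apply pow_incr; lra. }
    set (u := hi * o) in *. assert (Hu := pow2_ge_0 u).
    assert (E2 : hi * (y * o) = y * u) by (unfold u; ring). rewrite E2.
    assert (H4 : q1 * u ^ 2 <= q1 * (hi * o ^ 2)) by (apply Rmult_le_compat_l; lra).
    assert (H5 : 0 <= (pA0 + s / 2) * y ^ 2 + y * u + / (4 * (pA0 + s / 2)) * u ^ 2).
    { replace ((pA0 + s / 2) * y ^ 2 + y * u + / (4 * (pA0 + s / 2)) * u ^ 2)
        with (/ (pA0 + s / 2) * ((pA0 + s / 2) * y + u / 2) ^ 2) by (field; lra).
      apply Rmult_le_pos; [apply Rlt_le, Rinv_0_lt_compat; lra|apply pow2_ge_0]. }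
    assert (H6 : kap * y ^ 2 <= s / 2 * y ^ 2) by (apply Rmult_le_compat_r; lra).
    assert (H7 : kap * o ^ 2 <= k1 * u ^ 2).
    { apply Rle_trans with (k1 * hstar ^ 2 * o ^ 2); [apply Rmult_le_compat_r; lra|].
      rewrite Rmult_assoc. apply Rmult_le_compat_l; lra. }
    assert (E3 : k1 * u ^ 2 = q1 * u ^ 2 - / (4 * (pA0 + s / 2)) * u ^ 2) by (unfold k1; ring).
    assert (E4 : alpha * p * lam = pA0 + s) by (unfold s; ring). rewrite E4.
    lra. }
  apply Rle_trans with (rsum n (fun i => - (alpha * p * lam) * (N i - m) ^ 2 - h i * ((N i - m) * om i)
     - r * (h i * om i ^ 2) - r * (om i * It i))).
  - rewrite !rsum_minus, !rsum_scal.
    assert (E : rsum n (fun i => h i * ((N i - m) * om i)) = rsum n (fun i => h i * (N i * om i))).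
    { rewrite (rsum_ext n _ (fun i => h i * (N i * om i) - m * (h i * om i))) by (intros; ring).
      rewrite rsum_minus, rsum_scal, Hom. ring. }
    rewrite E. assert (H := Hgap N). fold m in H.
    assert (Halp : 0 < alpha).
    { assert (0 < (eta + 1) ^ 2 / (eta * lam)); [|lra].
      apply Rdiv_lt_0_compat; [apply pow_lt; lra|apply Rmult_lt_0_compat; lra]. }
    assert (alpha * p * (lam * rsum n (fun i => (N i - m) ^ 2)) <= alpha * p * lapform N).
    { apply Rmult_le_compat_l; [apply Rmult_le_pos; lra|auto]. }
    unfold lapform in H0. lra.
  - eapply Rle_trans; [apply rsum_le; exact Hloc|].
    rewrite rsum_plus, !rsum_scal. lra.
Qed.
End Graph.

(** * Derivatives and convex functions *)

Local Notation D := derivable_pt_lim.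

Lemma dl_eq f t a b : D f t a -> a = b -> D f t b.
Proof. intros H <-. exact H. Qed.

Lemma dl_ext f g t l : (forall s, f s = g s) -> D f t l -> D g t l.
Proof.
  intros H Hf eps He. destruct (Hf eps He) as [del Hd]. exists del. intros s H1 H2.
  rewrite <- !H. auto.
Qed.

Lemma dl_const a t : D (fun _ => a) t 0.
Proof. apply derivable_pt_lim_const. Qed.

Lemma dl_plus f g t a b : D f t a -> D g t b -> D (fun s => f s + g s) t (a + b).
Proof. apply derivable_pt_lim_plus. Qed.

Lemma dl_minus f g t a b : D f t a -> D g t b -> D (fun s => f s - g s) t (a - b).
Proof. apply derivable_pt_lim_minus. Qed.

Lemma dl_mult f g t a b : D f t a -> D g t b -> D (fun s => f s * g s) t (a * g t + f t * b).
Proof. apply derivable_pt_lim_mult. Qed.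

Lemma dl_scal c f t a : D f t a -> D (fun s => c * f s) t (c * a).
Proof. apply derivable_pt_lim_scal. Qed.

Lemma dl_opp f t a : D f t a -> D (fun s => - f s) t (- a).
Proof. apply derivable_pt_lim_opp. Qed.

Lemma dl_sq f t a : D f t a -> D (fun s => f s ^ 2) t (2 * (f t * a)).
Proof.
  intros H. apply dl_ext with (fun s => f s * f s); [intros; ring|].
  eapply dl_eq; [apply dl_mult; exact H|ring].
Qed.

Lemma dl_rsum n (f : R -> nat -> R) t l :
  (forall i, (i < n)%nat -> D (fun s => f s i) t (l i)) ->
  D (fun s => rsum n (f s)) t (rsum n l).
Proof.
  induction n as [|n IH]; intros H; simpl; [apply dl_const|].
  apply (dl_plus (fun s => rsum n (f s)) (fun s => f s n)); auto with arith.
Qed.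

Lemma dl_cont f t l : D f t l -> continuity_pt f t.
Proof. intros H. apply derivable_continuous_pt. exists l. exact H. Qed.

Lemma growth_bound f K t0 :
  (forall t, t0 <= t -> exists l, D f t l /\ l <= K) ->
  forall t1 t2, t0 <= t1 <= t2 -> f t2 <= f t1 + K * (t2 - t1).
Proof.
  intros H t1 t2 [H0 H12].
  destruct (Rle_lt_or_eq_dec _ _ H12) as [Hlt| ->]; [|lra].
  destruct (functional_choice (fun t l => t0 <= t -> D f t l /\ l <= K)) as [f' Hf'].
  { intros t. destruct (Rle_dec t0 t) as [Ht|Ht].
    - destruct (H t Ht) as [l Hl]. exists l; auto.
    - exists 0. intros; lra. }
  destruct (MVT_cor2 f f' t1 t2 Hlt) as [c [Hc1 Hc2]].
  { intros c Hc. apply Hf'; lra. }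
  assert (f' c <= K) by (apply Hf'; lra). nra.
Qed.

(** Multiplication by [exp (tau * t)] makes the function nondecreasing. It serves as comparison
    principle: an inequality between the inputs of filters passes to their outputs if it holds at
    the start. *)
Lemma filter_nonneg f tau t0 :
  (forall t, t0 <= t -> exists l, D f t l /\ - tau * f t <= l) -> 0 <= f t0 ->
  forall t, t0 <= t -> 0 <= f t.
Proof.
  intros H H0 t Ht.
  assert (Hd : - (exp (tau * t) * f t) <= - (exp (tau * t0) * f t0) + 0 * (t - t0)).
  { apply (growth_bound (fun s => - (exp (tau * s) * f s)) 0 t0); [|lra].
    intros s Hs. destruct (H s Hs) as [l [Hl1 Hl2]].
    exists (- (exp (tau * s) * tau * f s + exp (tau * s) * l)). split.
    - apply dl_opp. apply (dl_mult (fun s => exp (tau * s))); [|exact Hl1].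
      apply (derivable_pt_lim_comp (fun s => tau * s) exp); [|apply derivable_pt_lim_exp].
      eapply dl_eq; [apply dl_scal, derivable_pt_lim_id|ring].
    - assert (0 < exp (tau * s)) by apply exp_pos.
      assert (0 <= exp (tau * s) * (l + tau * f s)) by (apply Rmult_le_pos; lra). lra. }
  assert (0 < exp (tau * t)) by apply exp_pos. assert (0 < exp (tau * t0)) by apply exp_pos.
  assert (0 <= exp (tau * t0) * f t0) by (apply Rmult_le_pos; lra).
  apply Rmult_le_reg_l with (exp (tau * t)); lra.
Qed.

(** Variation of constants solves the filter equation. *)
Lemma filter_exists f tau a t0 :
  (forall t, continuity_pt f t) ->
  exists F, F t0 = a /\ forall t, D F t (tau * (f t - F t)).
Proof.
  intros Hf. set (g := fun s => tau * exp (tau * (s - t0)) * f s).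
  assert (Hlin : forall s, D (fun s => tau * (s - t0)) s tau).
  { intros s. eapply dl_eq; [apply dl_scal, dl_minus; [apply derivable_pt_lim_id|apply dl_const]|ring]. }
  assert (Hexp : forall s, D (fun s => exp (tau * (s - t0))) s (exp (tau * (s - t0)) * tau)).
  { intros s. apply (derivable_pt_lim_comp (fun s => tau * (s - t0)) exp); [apply Hlin|].
    apply derivable_pt_lim_exp. }
  assert (Hg : forall s, continuous g s).
  { intros s. apply continuity_pt_filterlim. unfold g.
    apply continuity_pt_mult; [|apply Hf]. apply continuity_pt_mult.
    - apply continuity_pt_const. intros x y; reflexivity.
    - eapply dl_cont, Hexp. }
  assert (HI : forall t, D (fun t => RInt g t0 t) t (g t)).
  { intros t. apply is_derive_Reals. apply is_derive_RInt with t0; [|apply Hg].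
    exists (mkposreal 1 Rlt_0_1). intros s _. apply (@RInt_correct R_CompleteNormedModule).
    apply (@ex_RInt_continuous R_CompleteNormedModule). auto. }
  exists (fun t => exp (- (tau * (t - t0))) * (a + RInt g t0 t)). split.
  - rewrite RInt_point. replace (- (tau * (t0 - t0))) with 0 by ring. rewrite exp_0.
    unfold zero; simpl. ring.
  - intros t. eapply dl_eq.
    + apply dl_mult.
      * apply (derivable_pt_lim_comp (fun s => - (tau * (s - t0))) exp);
          [apply dl_opp, Hlin|apply derivable_pt_lim_exp].
      * apply dl_plus; [apply dl_const|apply HI].
    + cbv beta. unfold g.
      replace (exp (- (tau * (t - t0))) * (0 + tau * exp (tau * (t - t0)) * f t))
        with (tau * f t * (exp (- (tau * (t - t0))) * exp (tau * (t - t0)))) by ring.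
      rewrite <- exp_plus. replace (- (tau * (t - t0)) + tau * (t - t0)) with 0 by ring.
      rewrite exp_0. ring.
Qed.

Definition lim0 (f : R -> R) (l : R) : Prop :=
  forall eps, 0 < eps -> exists del, 0 < del /\
    forall s, s <> 0 -> Rabs s < del -> Rabs (f s - l) < eps.

Lemma lim0_limit f l : lim0 f l <-> limit1_in f (fun s => s <> 0) l 0.
Proof.
  split; intros H eps He; destruct (H eps He) as [del [Hd Hs]]; exists del; split; auto.
  - intros s [Hs0 Hs1]. apply Hs; auto. simpl in Hs1. unfold Rdist in Hs1.
    now rewrite Rminus_0_r in Hs1.
  - intros s Hs0 Hs1. apply Hs. split; auto. simpl. unfold Rdist. now rewrite Rminus_0_r.
Qed.

Lemma lim0_mult f g a b : lim0 f a -> lim0 g b -> lim0 (fun s => f s * g s) (a * b).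
Proof. rewrite !lim0_limit. apply limit_mul. Qed.

Lemma lim0_plus f g a b : lim0 f a -> lim0 g b -> lim0 (fun s => f s + g s) (a + b).
Proof. rewrite !lim0_limit. apply limit_plus. Qed.

Lemma lim0_const a : lim0 (fun _ => a) a.
Proof. intros eps He. exists 1. split; [lra|]. intros. rewrite Rminus_diag, Rabs_R0; auto. Qed.

Lemma lim0_rsum n (f : R -> nat -> R) l :
  (forall i, (i < n)%nat -> lim0 (fun s => f s i) (l i)) ->
  lim0 (fun s => rsum n (f s)) (rsum n l).
Proof.
  induction n as [|n IH]; intros H; simpl; [apply lim0_const|].
  apply (lim0_plus (fun s => rsum n (f s)) (fun s => f s n)); auto with arith.
Qed.

Lemma lim0_diff f t l : D f t l <-> lim0 (fun s => (f (t + s) - f t) / s) l.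
Proof.
  split; intros H eps He; destruct (H eps He) as [del Hd].
  - exists del. split; [apply cond_pos|]. intros; apply Hd; auto.
  - destruct Hd as [Hd1 Hd2]. exists (mkposreal del Hd1). intros; apply Hd2; auto.
Qed.

Lemma lim0_cont f t : continuity_pt f t -> lim0 (fun s => f (t + s)) (f t).
Proof.
  intros H eps He. destruct (H eps He) as [del [Hd Hs]]. exists del. split; [exact Hd|].
  intros s Hs0 Hs1. apply Hs. split.
  - split; [exact I|lra].
  - simpl. unfold Rdist. now replace (t + s - t) with s by ring.
Qed.

Lemma lim0_nonneg f l : lim0 f l -> (exists d, 0 < d /\ forall s, 0 < s < d -> 0 <= f s) -> 0 <= l.
Proof.
  intros H [d [Hd Hf]]. apply Rnot_lt_le. intros Hl.
  destruct (H (- l)) as [del [Hdel Hs]]; [lra|].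
  set (s := Rmin d del / 2).
  assert (Rmin d del <= d) by apply Rmin_l. assert (Rmin d del <= del) by apply Rmin_r.
  assert (0 < Rmin d del) by (apply Rmin_glb_lt; auto).
  assert (Hs1 : 0 < s < d) by (unfold s; lra).
  assert (H3 := Hf s Hs1). assert (H4 := Hs s ltac:(lra)).
  rewrite (Rabs_right s) in H4 by lra. unfold s in H4 at 1.
  assert (H5 : Rabs (f s - l) < - l) by (apply H4; lra).
  apply Rabs_def2 in H5. lra.
Qed.

Lemma cont_of_lim0 f t : lim0 (fun s => f (t + s)) (f t) -> continuity_pt f t.
Proof.
  intros H eps He. destruct (H eps He) as [del [Hd Hs]]. exists del. split; [exact Hd|].
  intros s [[_ Hs0] Hs1]. simpl in *. unfold Rdist in *.
  replace (f s) with (f (t + (s - t))) by (f_equal; ring). apply Hs; [lra|auto].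
Qed.

(* If the increments of [H] are squeezed between [A t . dB] and [A t' . dB], as for a convex
   function with (sub)gradient [A] along the curve [B], then [H' = A . B']. *)
Lemma dl_squeeze q (H : R -> R) (A B : R -> nat -> R) (Bd : nat -> R) t d :
  0 < d ->
  (forall t', Rabs (t' - t) < d ->
     rsum q (fun k => A t k * (B t' k - B t k)) <= H t' - H t
     <= rsum q (fun k => A t' k * (B t' k - B t k))) ->
  (forall k, (k < q)%nat -> D (fun s => B s k) t (Bd k)) ->
  (forall k, (k < q)%nat -> continuity_pt (fun s => A s k) t) ->
  D H t (rsum q (fun k => A t k * Bd k)).
Proof.
  intros Hd Hsq HB HA. apply lim0_diff.
  assert (L1 : lim0 (fun s => rsum q (fun k => A t k * ((B (t + s) k - B t k) / s)))
                 (rsum q (fun k => A t k * Bd k))).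
  { apply (lim0_rsum q (fun s k => A t k * ((B (t + s) k - B t k) / s))).
    intros k Hk. apply lim0_mult; [apply lim0_const|]. exact (proj1 (lim0_diff (fun s => B s k) t _) (HB k Hk)). }
  assert (L2 : lim0 (fun s => rsum q (fun k => A (t + s) k * ((B (t + s) k - B t k) / s)))
                 (rsum q (fun k => A t k * Bd k))).
  { apply (lim0_rsum q (fun s k => A (t + s) k * ((B (t + s) k - B t k) / s))).
    intros k Hk. apply lim0_mult; [exact (lim0_cont (fun s => A s k) t (HA k Hk))|]. exact (proj1 (lim0_diff (fun s => B s k) t _) (HB k Hk)). }
  intros eps He. destruct (L1 eps He) as [d1 [Hd1 H1]]. destruct (L2 eps He) as [d2 [Hd2 H2]].
  exists (Rmin d (Rmin d1 d2)). split; [repeat apply Rmin_glb_lt; auto|].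
  intros s Hs0 Hs.
  assert (Hs' : Rabs s < d /\ Rabs s < d1 /\ Rabs s < d2).
  { generalize (Rmin_l d (Rmin d1 d2)) (Rmin_r d (Rmin d1 d2)) (Rmin_l d1 d2) (Rmin_r d1 d2). lra. }
  destruct Hs' as [Hsd [Hsd1 Hsd2]].
  assert (Hq := Hsq (t + s) ltac:(now replace (t + s - t) with s by ring)).
  assert (K1 := H1 s Hs0 Hsd1). assert (K2 := H2 s Hs0 Hsd2).
  rewrite (rsum_ext q _ (fun k => A t k * (B (t + s) k - B t k) * / s)) in K1
    by (intros; unfold Rdiv; ring).
  rewrite (rsum_ext q _ (fun k => A (t + s) k * (B (t + s) k - B t k) * / s)) in K2
    by (intros; unfold Rdiv; ring).
  rewrite rsum_scalr in K1, K2.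
  apply Rabs_def2 in K1. apply Rabs_def2 in K2. apply Rabs_def1; unfold Rdiv.
  - destruct (Rtotal_order s 0) as [Hn|[Hz|Hp]]; [|lra|].
    + assert (/ s < 0) by now apply Rinv_lt_0_compat.
      assert ((H (t + s) - H t) * / s <= rsum q (fun k => A t k * (B (t + s) k - B t k)) * / s) by nra. lra.
    + assert (0 < / s) by now apply Rinv_0_lt_compat.
      assert ((H (t + s) - H t) * / s <= rsum q (fun k => A (t + s) k * (B (t + s) k - B t k)) * / s) by nra. lra.
  - destruct (Rtotal_order s 0) as [Hn|[Hz|Hp]]; [|lra|].
    + assert (/ s < 0) by now apply Rinv_lt_0_compat.
      assert ((H (t + s) - H t) * / s >= rsum q (fun k => A (t + s) k * (B (t + s) k - B t k)) * / s) by nra. lra.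
    + assert (0 < / s) by now apply Rinv_0_lt_compat.
      assert ((H (t + s) - H t) * / s >= rsum q (fun k => A t k * (B (t + s) k - B t k)) * / s) by nra. lra.
Qed.

Lemma mvt_any f f' a b :
  (forall c, D f c (f' c)) -> exists c, Rabs (c - a) <= Rabs (b - a) /\ f b - f a = f' c * (b - a).
Proof.
  intros H. destruct (Rtotal_order a b) as [Hab|[->|Hab]].
  - destruct (MVT_cor2 f f' a b Hab) as [c [Hc1 Hc2]]; [auto|]. exists c. split; [|exact Hc1].
    rewrite !Rabs_right; lra.
  - exists b. split; [lra|ring].
  - destruct (MVT_cor2 f f' b a Hab) as [c [Hc1 Hc2]]; [auto|]. exists c. split; [|lra].
    rewrite !Rabs_left; lra.
Qed.

(** * Chain rule and strong convexity from continuous partial derivatives *)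

Section Partials.
Variables (q : nat) (F : (nat -> R) -> R) (P : (nat -> R) -> nat -> R).
Hypothesis Floc : local q F.
Hypothesis FP : forall y k, (k < q)%nat -> D (fun s => F (upd y k s)) (y k) (P y k).

Lemma partial_line y k s : (k < q)%nat -> D (fun s => F (upd y k s)) s (P (upd y k s) k).
Proof.
  intros Hk. assert (H := FP (upd y k s) k Hk). unfold upd in H at 3. rewrite Nat.eqb_refl in H.
  apply dl_ext with (2 := H). intros s'. apply Floc. intros l _. unfold upd.
  destruct (Nat.eqb l k); auto.
Qed.

(** The coordinates are changed one at a time with a one-dimensional mean value theorem at each
    change, so every partial derivative is taken at its own point [c j] of the box spanned by [y]
    and [y']. *)
Lemma partial_mvt y y' :
  exists c : nat -> nat -> R,
    (forall j k, Rabs (c j k - y k) <= Rabs (y' k - y k)) /\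
    F y' - F y = rsum q (fun j => P (c j) j * (y' j - y j)).
Proof.
  set (mix := fun j k => if Nat.ltb k j then y' k else y k).
  destruct (functional_choice (fun j c => (forall k, Rabs (c k - y k) <= Rabs (y' k - y k)) /\
     ((j < q)%nat -> F (mix (S j)) - F (mix j) = P c j * (y' j - y j)))) as [c Hc].
  { intros j. destruct (Compare_dec.lt_dec j q) as [Hj|Hj].
    - destruct (mvt_any (fun s => F (upd (mix j) j s)) (fun s => P (upd (mix j) j s) j) (y j) (y' j))
        as [s [Hs1 Hs2]]; [intros; now apply partial_line|].
      exists (upd (mix j) j s). split.
      + intros k. unfold upd, mix. destruct (Nat.eqb_spec k j) as [->|]; [exact Hs1|].
        destruct (Nat.ltb k j); [lra|]. rewrite Rminus_diag, Rabs_R0. apply Rabs_pos.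
      + intros _. rewrite <- Hs2. f_equal; apply Floc; intros k Hk; unfold upd, mix.
        * destruct (Nat.eqb_spec k j) as [->|]; [now rewrite (proj2 (Nat.ltb_lt j (S j))) by lia|].
          destruct (Nat.ltb_spec k j); destruct (Nat.ltb_spec k (S j)); auto; lia.
        * destruct (Nat.eqb_spec k j) as [->|]; [now rewrite Nat.ltb_irrefl|auto].
    - exists y. split; [|intros; lia]. intros k. rewrite Rminus_diag, Rabs_R0. apply Rabs_pos. }
  exists c. split; [intros; apply Hc|].
  assert (Htel : forall j, (j <= q)%nat -> F (mix j) - F (mix 0%nat) = rsum j (fun j => P (c j) j * (y' j - y j))).
  { induction j as [|j IH]; intros Hj; simpl; [ring|].
    rewrite <- IH by lia. rewrite <- (proj2 (Hc j)) by lia. ring. }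
  rewrite <- Htel by lia. f_equal; apply Floc; intros k Hk; unfold mix.
  now rewrite (proj2 (Nat.ltb_lt k q)) by lia.
Qed.

Hypothesis Pcont : forall k, (k < q)%nat -> contRq q (fun y => P y k).

(** The intermediate points of the mean value formula tend to [x t], and continuity of the partial
    derivatives identifies the limit of the quotient. *)
Lemma partial_chain (x : R -> nat -> R) (xd : nat -> R) t :
  (forall k, (k < q)%nat -> D (fun s => x s k) t (xd k)) ->
  D (fun s => F (x s)) t (rsum q (fun k => P (x t) k * xd k)).
Proof.
  intros Hx. apply lim0_diff.
  destruct (functional_choice (fun s (c : nat -> nat -> R) =>
      (forall j k, Rabs (c j k - x t k) <= Rabs (x (t + s) k - x t k)) /\
      F (x (t + s)) - F (x t) = rsum q (fun j => P (c j) j * (x (t + s) j - x t j)))) as [c Hc].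
  { intros s. apply partial_mvt. }
  assert (L : lim0 (fun s => rsum q (fun k => P (c s k) k * ((x (t + s) k - x t k) / s)))
      (rsum q (fun k => P (x t) k * xd k))).
  { apply (lim0_rsum q (fun s k => P (c s k) k * ((x (t + s) k - x t k) / s))).
    intros k Hk. apply lim0_mult; [|exact (proj1 (lim0_diff (fun s => x s k) t _) (Hx k Hk))].
    intros eps He. destruct (Pcont k Hk (x t) eps He) as [del [Hd HP]].
    assert (Hnear : forall m, (m <= q)%nat -> exists d, 0 < d /\ forall s, s <> 0 -> Rabs s < d ->
       forall l, (l < m)%nat -> Rabs (x (t + s) l - x t l) < del).
    { induction m as [|m IH]; intros Hm; [exists 1; split; [lra|intros; lia]|].
      destruct IH as [d1 [Hd1 H1]]; [lia|].
      destruct (lim0_cont _ _ (dl_cont _ _ _ (Hx m ltac:(lia))) del Hd) as [d2 [Hd2 H2]].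
      exists (Rmin d1 d2). split; [now apply Rmin_glb_lt|]. intros s Hs0 Hs l Hl.
      generalize (Rmin_l d1 d2) (Rmin_r d1 d2). intros.
      destruct (Nat.eq_dec l m) as [->|]; [apply H2; auto; lra|apply H1; auto; lra || lia]. }
    destruct (Hnear q (le_n q)) as [d [Hd0 Hn]].
    exists d. split; [exact Hd0|]. intros s Hs0 Hs. apply HP. intros l Hl.
    eapply Rle_lt_trans; [apply (proj1 (Hc s))|]. now apply Hn. }
  intros eps He. destruct (L eps He) as [del [Hd Hs]]. exists del. split; [exact Hd|].
  intros s Hs0 Hs1. rewrite (proj2 (Hc s)).
  unfold Rdiv at 1. rewrite <- rsum_scalr.
  rewrite (rsum_ext q _ (fun k => P (c s k) k * ((x (t + s) k - x t k) / s))) by (intros; unfold Rdiv; ring).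
  auto.
Qed.

(** Near [y] each partial derivative is bounded by its value at [y] plus 1, so the mean value
    formula gives a Lipschitz estimate at [y]. *)
Lemma partial_cont : contRq q F.
Proof.
  intros y eps He.
  assert (Hb : forall m, (m <= q)%nat -> exists d, 0 < d /\ forall z, (forall k, (k < q)%nat -> Rabs (z k - y k) < d) ->
     forall l, (l < m)%nat -> Rabs (P z l) <= Rabs (P y l) + 1).
  { induction m as [|m IH]; intros Hm; [exists 1; split; [lra|intros; lia]|].
    destruct IH as [d1 [Hd1 H1]]; [lia|].
    destruct (Pcont m ltac:(lia) y 1 ltac:(lra)) as [d2 [Hd2 H2]].
    exists (Rmin d1 d2). split; [now apply Rmin_glb_lt|]. intros z Hz l Hl.
    generalize (Rmin_l d1 d2) (Rmin_r d1 d2). intros.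
    destruct (Nat.eq_dec l m) as [->|].
    - assert (K : Rabs (P z m - P y m) < 1) by (apply H2; intros k Hk; generalize (Hz k Hk); lra).
      generalize (Rabs_triang_inv (P z m) (P y m)). lra.
    - apply H1; [intros k Hk; generalize (Hz k Hk); lra|lia]. }
  destruct (Hb q (le_n q)) as [d [Hd Hbd]].
  set (S := rsum q (fun l => Rabs (P y l) + 1)).
  assert (HS : 0 <= S) by (apply rsum_nonneg; intros; generalize (Rabs_pos (P y i)); lra).
  exists (Rmin d (eps / (S + 1))). split; [apply Rmin_glb_lt; [auto|apply Rdiv_lt_0_compat; lra]|].
  intros y' Hy'. destruct (partial_mvt y y') as [c [Hc1 Hc2]]. rewrite Hc2.
  set (e := eps / (S + 1)). assert (He0 : 0 < e) by (apply Rdiv_lt_0_compat; lra).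
  assert (Hsmall : forall k, (k < q)%nat -> Rabs (y' k - y k) < d /\ Rabs (y' k - y k) < e).
  { intros k Hk. generalize (Hy' k Hk) (Rmin_l d e) (Rmin_r d e). unfold e. lra. }
  assert (Hup : forall f, Rabs (rsum q f) <= rsum q (fun k => Rabs (f k))).
  { intros f. clear. induction q as [|m IH]; simpl; [rewrite Rabs_R0; lra|].
    generalize (Rabs_triang (rsum m f) (f m)). lra. }
  eapply Rle_lt_trans; [apply Hup|].
  apply Rle_lt_trans with (rsum q (fun k => (Rabs (P y k) + 1) * e)).
  - apply rsum_le. intros k Hk. rewrite Rabs_mult. apply Rmult_le_compat; try apply Rabs_pos.
    + apply (Hbd (c k)); auto. intros l Hl. eapply Rle_lt_trans; [apply Hc1|]. now apply Hsmall.
    + apply Rlt_le. now apply Hsmall.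
  - rewrite rsum_scalr. fold S. unfold e. apply Rmult_lt_reg_r with (S + 1); [lra|].
    replace (S * (eps / (S + 1)) * (S + 1)) with (S * eps) by (field; lra). lra.
Qed.
End Partials.

Section Smooth.
Variables (q : nat) (f : (nat -> R) -> R) (g : (nat -> R) -> nat -> R)
  (hs : (nat -> R) -> nat -> nat -> R) (c : R).
Hypothesis floc : local q f.
Hypothesis fC2 : C2_with q f g hs.
Hypothesis fmono : strongly_monotone q g c.

(** Locality passes from [f] to its gradient by uniqueness of derivatives. *)
Lemma grad_local k : (k < q)%nat -> local q (fun y => g y k).
Proof.
  intros Hk y y' H. destruct fC2 as [H1 _].
  apply (uniqueness_limite (fun s => f (upd y k s)) (y k)); [auto|].
  rewrite (H k Hk). eapply dl_ext; [|apply (H1 y' k Hk)].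
  intros s. apply floc. intros l Hl. unfold upd. destruct (Nat.eqb l k); auto.
  symmetry; auto.
Qed.

Lemma grad_cont k : (k < q)%nat -> contRq q (fun y => g y k).
Proof.
  intros Hk. destruct fC2 as [_ [H2 H3]].
  apply (partial_cont q (fun y => g y k) (fun y l => hs y k l)).
  - now apply grad_local.
  - intros y l Hl. apply H2; auto.
  - intros l Hl. apply H3; auto.
Qed.

Lemma grad_chain k (x : R -> nat -> R) (xd : nat -> R) t :
  (k < q)%nat -> (forall l, (l < q)%nat -> D (fun s => x s l) t (xd l)) ->
  D (fun s => g (x s) k) t (rsum q (fun l => hs (x t) k l * xd l)).
Proof.
  intros Hk Hx. destruct fC2 as [_ [H2 H3]].
  apply (partial_chain q (fun y => g y k) (fun y l => hs y k l)); auto.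
  now apply grad_local.
Qed.

(** By monotonicity the slope of [f] along the segment exceeds the initial slope [G] by at least
    [c * s * Q]; integration gives the quadratic term. *)
Lemma strong_convexity x y :
  f x + rsum q (fun k => g x k * (y k - x k)) + c / 2 * rsum q (fun k => (y k - x k) ^ 2) <= f y.
Proof.
  destruct fC2 as [H1 _].
  set (l := fun s k => x k + s * (y k - x k)).
  set (Q := rsum q (fun k => (y k - x k) ^ 2)). set (G := rsum q (fun k => g x k * (y k - x k))).
  assert (Hl : forall s, D (fun s => f (l s)) s (rsum q (fun k => g (l s) k * (y k - x k)))).
  { intros s. apply (partial_chain q f g floc H1 grad_cont l (fun k => y k - x k)).
    intros k Hk. unfold l. eapply dl_eq.
    - apply dl_plus; [apply dl_const|]. apply dl_mult; [apply derivable_pt_lim_id|apply dl_const].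
    - unfold id; ring. }
  assert (Hgr : - (f (l 1) - G * 1 - c / 2 * (Q * 1 ^ 2)) <= - (f (l 0) - G * 0 - c / 2 * (Q * 0 ^ 2)) + 0 * (1 - 0)).
  { apply (growth_bound (fun s => - (f (l s) - G * s - c / 2 * (Q * s ^ 2))) 0 0); [|lra].
    intros s Hs. eexists. split.
    - apply dl_opp, dl_minus; [apply dl_minus; [apply Hl|]|].
      + apply dl_scal, derivable_pt_lim_id.
      + apply dl_scal, dl_scal, dl_sq, derivable_pt_lim_id.
    - unfold id.
      assert (Hm : s * (c * s * Q) <= s * (rsum q (fun k => g (l s) k * (y k - x k)) - G)).
      { assert (H := fmono (l s) x). unfold sqnorm, vsub in H.
        rewrite (rsum_ext q (fun k => (g (l s) k - g x k) * (l s k - x k))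
           (fun k => s * (g (l s) k * (y k - x k) - g x k * (y k - x k)))) in H
          by (intros; unfold l; ring).
        rewrite (rsum_ext q (fun k => (l s k - x k) * (l s k - x k)) (fun k => s ^ 2 * (y k - x k) ^ 2)) in H
          by (intros; unfold l; ring).
        rewrite !rsum_scal, rsum_minus in H. fold Q G in H. lra. }
      (* Monotonicity yields the inequality multiplied by [s]; at [s = 0] it is replaced by equality
         of the slopes. *)
      destruct (Rle_lt_or_eq_dec _ _ Hs) as [Hs'|<-].
      + apply Rmult_le_reg_l in Hm; [lra|auto].
      + assert (E : rsum q (fun k => g (l 0) k * (y k - x k)) = G).
        { apply rsum_ext. intros k Hk. f_equal. apply (grad_local k Hk). intros j _. unfold l; ring. }
        rewrite E. lra. }
  assert (E0 : f (l 0) = f x) by (apply floc; intros; unfold l; ring).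
  assert (E1 : f (l 1) = f y) by (apply floc; intros; unfold l; ring).
  rewrite E0, E1 in Hgr. lra.
Qed.
End Smooth.

(** * Subgradients from proximal points, and sums with values in [ER] *)

Lemma limit_slope_nonneg A B : (forall th, 0 < th < 1 -> 0 <= A + th * B) -> 0 <= A.
Proof.
  intros H. apply Rnot_lt_le. intros HA.
  destruct (Rle_lt_dec B 0) as [HB|HB].
  - generalize (H (1 / 2) ltac:(lra)). lra.
  - set (th := Rmin (1 / 2) (- A / (2 * B))).
    assert (0 < - A / (2 * B)) by (apply Rdiv_lt_0_compat; lra).
    assert (0 < th) by (apply Rmin_glb_lt; lra).
    assert (th <= 1 / 2) by apply Rmin_l.
    assert (th <= - A / (2 * B)) by apply Rmin_r.
    assert (th * B <= - A / (2 * B) * B) by (apply Rmult_le_compat_r; lra).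
    replace (- A / (2 * B) * B) with (- A / 2) in H4 by (field; lra).
    generalize (H th ltac:(lra)). lra.
Qed.

Definition erval (e : ER) : R := match e with Fin r => r | PInf => 0 end.

Definition finite (e : ER) : Prop := exists r, e = Fin r.

Lemma finite_val e : finite e -> e = Fin (erval e).
Proof. intros [r ->]. reflexivity. Qed.

Lemma not_pinf e : e <> PInf -> finite e.
Proof. destruct e; [intros; now exists r|congruence]. Qed.

(** Fermat's rule for the proximal problem: the minimizer is compared with the points
    [l * z + (1 - l) * p] and [l] tends to 0. *)
Lemma prox_subgradient q f th p :
  convex_fun f -> is_prox q f th p ->
  finite (f p) /\
  forall z, finite (f z) ->
    erval (f p) + rsum q (fun k => (th k - p k) * (z k - p k)) <= erval (f z).
Proof.
  intros Hc [fp [Hfp Hmin]]. rewrite Hfp. split; [now exists fp|]. intros z [r Hr].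
  rewrite Hr. simpl.
  set (A := rsum q (fun k => (th k - p k) * (z k - p k))).
  set (Q := rsum q (fun k => (z k - p k) ^ 2)).
  assert (H : 0 <= r - fp - A); [|lra].
  apply limit_slope_nonneg with (Q / 2). intros l Hl.
  destruct (Hc z p l r fp Hl Hr Hfp) as [rl [Hrl Hle]].
  assert (H := Hmin _ _ Hrl). unfold sqnorm, vsub in H.
  rewrite (rsum_ext q (fun k => (l * z k + (1 - l) * p k - th k) * (l * z k + (1 - l) * p k - th k))
    (fun k => (p k - th k) * (p k - th k) - 2 * l * ((th k - p k) * (z k - p k)) + l ^ 2 * (z k - p k) ^ 2))
    in H by (intros; ring).
  rewrite rsum_plus, rsum_minus, !rsum_scal in H. fold A Q in H.
  apply Rmult_le_reg_l with l; [lra|]. nra.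
Qed.

Lemma ERsum_from1_fin m (F : nat -> ER) :
  (forall j, (j < m)%nat -> finite (F (S j))) ->
  ERsum_from1 m F = Fin (rsum m (fun j => erval (F (S j)))).
Proof.
  induction m as [|m IH]; intros H; simpl; [reflexivity|].
  rewrite IH by auto with arith. rewrite (finite_val (F (S m))) at 1 by auto with arith. reflexivity.
Qed.

Lemma ERsum_from1_finite m (F : nat -> ER) :
  ERsum_from1 m F <> PInf -> forall j, (j < m)%nat -> finite (F (S j)).
Proof.
  induction m as [|m IH]; simpl; intros H j Hj; [lia|].
  destruct (ERsum_from1 m F) eqn:E1; destruct (F (S m)) eqn:E2; simpl in H; try congruence.
  destruct (Nat.eq_dec j m) as [->|]; [rewrite E2; now exists r0|apply IH; [congruence|lia]].
Qed.

Lemma ERsum_fin n (F : nat -> ER) (v : nat -> R) :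
  (forall i, (i < n)%nat -> F i = Fin (v i)) -> ERsum n F = Fin (rsum n v).
Proof.
  induction n as [|n IH]; intros H; simpl; [reflexivity|].
  rewrite IH, H by auto with arith. reflexivity.
Qed.

Lemma ERsum_finite n (F : nat -> ER) :
  ERsum n F <> PInf -> forall i, (i < n)%nat -> F i <> PInf.
Proof.
  induction n as [|n IH]; simpl; intros H i Hi; [lia|].
  destruct (ERsum n F) eqn:E1; destruct (F n) eqn:E2; simpl in H; try congruence.
  destruct (Nat.eq_dec i n) as [->|]; [congruence|apply IH; [congruence|lia]].
Qed.

Lemma eventually_forall n (P : nat -> nat -> Prop) :
  (forall i, (i < n)%nat -> eventually (P i)) ->
  eventually (fun p => forall i, (i < n)%nat -> P i p).
Proof.
  induction n as [|n IH]; intros H.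
  - exists 0%nat. intros; lia.
  - destruct IH as [N1 H1]; [auto with arith|]. destruct (H n) as [N2 H2]; [auto|].
    exists (Nat.max N1 N2). intros p Hp i Hi.
    destruct (Nat.eq_dec i n) as [->|]; [apply H2; lia|apply H1; lia].
Qed.

Lemma is_lim_seq_rsum n (u : nat -> nat -> R) (l : nat -> R) :
  (forall i, (i < n)%nat -> is_lim_seq (fun p => u p i) (l i)) ->
  is_lim_seq (fun p => rsum n (u p)) (rsum n l).
Proof.
  induction n as [|n IH]; intros H; simpl; [apply is_lim_seq_const|].
  apply (is_lim_seq_plus' (fun p => rsum n (u p)) (fun p => u p n)); auto with arith.
Qed.

Lemma is_lim_seq_near (u : nat -> R) (l : R) :
  is_lim_seq u l -> forall eps, 0 < eps -> eventually (fun p => Rabs (u p - l) < eps).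
Proof. intros H eps He. apply is_lim_seq_spec in H. exact (H (mkposreal eps He)). Qed.

(** * Approximate strong duality *)

Section Duality.
Variables (n q m : nat) (f0 : nat -> (nat -> R) -> R) (g0 : nat -> (nat -> R) -> nat -> R)
  (fj : nat -> nat -> (nat -> R) -> ER) (c : R) (d : nat -> nat -> R).
Hypothesis Hc : 1 <= c.
Hypothesis f0_cont : forall i, (i < n)%nat -> contRq q (f0 i).
Hypothesis f0_sc : forall i x y, (i < n)%nat ->
  f0 i x + rsum q (fun k => g0 i x k * (y k - x k)) + c / 2 * rsum q (fun k => (y k - x k) ^ 2) <= f0 i y.
Hypothesis f0_loc : forall i, (i < n)%nat -> local q (f0 i).
Hypothesis fj_ok : forall i j, (i < n)%nat -> (1 <= j <= m)%nat ->
  local q (fj i j) /\ convex_fun (fj i j) /\ closed_fun q (fj i j).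
Hypothesis fj_minorant : forall i j, (i < n)%nat -> (j < m)%nat ->
  exists (s : nat -> R) b, forall y, finite (fj i (S j) y) ->
    b + rsum q (fun k => s k * y k) <= erval (fj i (S j) y).
Hypothesis feasible : exists y, resource_constraint n q y d /\ total_cost n m f0 fj y <> PInf.

(* The consensus form of the problem: [u 0] is the decision vector and [u j] its copy seen by the
   [j]-th nonsmooth terms, so that the copies and the resource constraint are linear constraints. *)
Notation point := (nat -> nat -> nat -> R).

Definition dom (u : point) : Prop :=
  forall i j, (i < n)%nat -> (j < m)%nat -> finite (fj i (S j) (u (S j) i)).

Definition cost (u : point) : R :=
  rsum n (fun i => f0 i (u 0%nat i) + rsum m (fun j => erval (fj i (S j) (u (S j) i)))).

(** The squared violation of the two linear constraints. The parameter [e] is [d] for the problem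
    itself, while [e = 0] gives the homogeneous form applied to differences of points. *)
Definition penalty (e : nat -> nat -> R) (u : point) : R :=
  rsum n (fun i => rsum q (fun k => rsum m (fun j => (u (S j) i k - u 0%nat i k) ^ 2)))
  + rsum q (fun k => rsum n (fun i => u 0%nat i k - e i k) ^ 2).

Definition sqdist (u v : point) : R :=
  rsum n (fun i => rsum q (fun k => (u 0%nat i k - v 0%nat i k) ^ 2
     + rsum m (fun j => (u (S j) i k - v (S j) i k) ^ 2))).

Definition pcost (K : R) (u : point) : R := cost u + K / 2 * penalty d u.

Definition comb (th : R) (u v : point) : point :=
  fun j i k => th * u j i k + (1 - th) * v j i k.

Definition diffp (u v : point) : point := fun j i k => u j i k - v j i k.

Definition sqx (u v : point) : R :=
  rsum n (fun i => rsum q (fun k => (u 0%nat i k - v 0%nat i k) ^ 2)).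

Notation zero2 := (fun _ _ : nat => 0).

Lemma penalty_nonneg e u : 0 <= penalty e u.
Proof.
  apply Rplus_le_le_0_compat.
  - apply rsum_nonneg; intros; apply rsum_nonneg; intros; apply rsum_nonneg; intros; apply pow2_ge_0.
  - apply rsum_nonneg; intros; apply pow2_ge_0.
Qed.

Lemma penalty_comb th u v :
  penalty d (comb th u v)
  = th * penalty d u + (1 - th) * penalty d v - th * (1 - th) * penalty zero2 (diffp u v).
Proof.
  unfold penalty.
  match goal with |- ?A1 + ?B1 = th * (?A2 + ?B2) + (1 - th) * (?A3 + ?B3) - th * (1 - th) * (?A4 + ?B4) =>
    assert (EA : A1 = th * A2 + (1 - th) * A3 - th * (1 - th) * A4);
    [| assert (EB : B1 = th * B2 + (1 - th) * B3 - th * (1 - th) * B4); [|rewrite EA, EB; ring]] end.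
  - rewrite <- !rsum_scal, <- rsum_plus, <- rsum_minus. apply rsum_ext; intros i _.
    rewrite <- !rsum_scal, <- rsum_plus, <- rsum_minus. apply rsum_ext; intros k _.
    rewrite <- !rsum_scal, <- rsum_plus, <- rsum_minus. apply rsum_ext; intros j _.
    unfold comb, diffp; ring.
  - rewrite <- !rsum_scal, <- rsum_plus, <- rsum_minus. apply rsum_ext; intros k _.
    rewrite (rsum_ext n (fun i => comb th u v 0%nat i k - d i k)
      (fun i => th * (u 0%nat i k - d i k) + (1 - th) * (v 0%nat i k - d i k))) by (intros; unfold comb; ring).
    rewrite (rsum_ext n (fun i => diffp u v 0%nat i k - 0)
      (fun i => (u 0%nat i k - d i k) - (v 0%nat i k - d i k))) by (intros; unfold diffp; ring).
    rewrite rsum_plus, (rsum_minus n (fun i => u 0%nat i k - d i k)), !rsum_scal. ring.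
Qed.

Lemma f0_comb i x y th : (i < n)%nat -> 0 < th < 1 ->
  f0 i (fun k => th * x k + (1 - th) * y k)
  <= th * f0 i x + (1 - th) * f0 i y - th * (1 - th) * (c / 2 * rsum q (fun k => (x k - y k) ^ 2)).
Proof.
  intros Hi Hth. set (w := fun k => th * x k + (1 - th) * y k).
  set (G := rsum q (fun k => g0 i w k * (x k - y k))). set (Q := rsum q (fun k => (x k - y k) ^ 2)).
  assert (H1 := f0_sc i w x Hi). assert (H2 := f0_sc i w y Hi).
  rewrite (rsum_ext q (fun k => g0 i w k * (x k - w k)) (fun k => (1 - th) * (g0 i w k * (x k - y k)))) in H1
    by (intros; unfold w; ring).
  rewrite (rsum_ext q (fun k => (x k - w k) ^ 2) (fun k => (1 - th) ^ 2 * (x k - y k) ^ 2)) in H1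
    by (intros; unfold w; ring).
  rewrite (rsum_ext q (fun k => g0 i w k * (y k - w k)) (fun k => - th * (g0 i w k * (x k - y k)))) in H2
    by (intros; unfold w; ring).
  rewrite (rsum_ext q (fun k => (y k - w k) ^ 2) (fun k => th ^ 2 * (x k - y k) ^ 2)) in H2
    by (intros; unfold w; ring).
  rewrite !rsum_scal in H1, H2. fold G Q in H1, H2.
  assert (H3 := Rmult_le_compat_l th _ _ ltac:(lra) H1).
  assert (H4 := Rmult_le_compat_l (1 - th) _ _ ltac:(lra) H2).
  lra.
Qed.

Lemma cost_comb th u v : 0 < th < 1 -> dom u -> dom v ->
  dom (comb th u v) /\
  cost (comb th u v) <= th * cost u + (1 - th) * cost v - th * (1 - th) * (c / 2 * sqx u v).
Proof.
  intros Hth Hu Hv.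
  assert (Hf : forall i j, (i < n)%nat -> (j < m)%nat ->
    finite (fj i (S j) (comb th u v (S j) i)) /\
    erval (fj i (S j) (comb th u v (S j) i))
    <= th * erval (fj i (S j) (u (S j) i)) + (1 - th) * erval (fj i (S j) (v (S j) i))).
  { intros i j Hi Hj. destruct (fj_ok i (S j) Hi ltac:(lia)) as [_ [Hcv _]].
    destruct (Hcv (u (S j) i) (v (S j) i) th _ _ Hth (finite_val _ (Hu i j Hi Hj)) (finite_val _ (Hv i j Hi Hj)))
      as [r [Hr Hle]].
    unfold comb. rewrite Hr. split; [now exists r|exact Hle]. }
  split; [intros i j Hi Hj; now apply Hf|].
  unfold cost, sqx. rewrite <- (rsum_scal n (c / 2)), <- !rsum_scal, <- rsum_plus, <- rsum_minus.
  apply rsum_le. intros i Hi. assert (H0 := f0_comb i (u 0%nat i) (v 0%nat i) th Hi Hth).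
  assert (H1 : rsum m (fun j => erval (fj i (S j) (comb th u v (S j) i)))
    <= th * rsum m (fun j => erval (fj i (S j) (u (S j) i)))
       + (1 - th) * rsum m (fun j => erval (fj i (S j) (v (S j) i)))).
  { rewrite <- !rsum_scal, <- rsum_plus. apply rsum_le. intros j Hj. now apply Hf. }
  unfold comb at 1. lra.
Qed.

Definition modulus : R := / (2 * (2 * INR m + 1)).

Lemma modulus_pos : 0 < modulus.
Proof. apply Rinv_0_lt_compat. generalize (pos_INR m); lra. Qed.

(** Strong convexity controls the decision vector only; a copy is controlled through its distance to
    it, which the consensus part of the penalty measures. The factor [2 * INR m + 1] in [modulus]
    comes from [(x + y) ^ 2 <= 2 * x ^ 2 + 2 * y ^ 2] used for each of the [m] copies. *)
Lemma coercive_gap K u v : 1 <= K ->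
  modulus * sqdist u v <= c / 2 * sqx u v + K / 2 * penalty zero2 (diffp u v).
Proof.
  intros HK.
  assert (H : sqdist u v <= (2 * INR m + 1) * (sqx u v
     + rsum n (fun i => rsum q (fun k => rsum m (fun j => (diffp u v (S j) i k - diffp u v 0%nat i k) ^ 2))))).
  { unfold sqdist, sqx. rewrite <- rsum_plus, <- rsum_scal. apply rsum_le; intros i _.
    rewrite <- rsum_plus, <- rsum_scal. apply rsum_le; intros k _.
    set (x := u 0%nat i k - v 0%nat i k).
    set (Z := rsum m (fun j => (diffp u v (S j) i k - diffp u v 0%nat i k) ^ 2)).
    assert (0 <= Z) by (apply rsum_nonneg; intros; apply pow2_ge_0).
    assert (rsum m (fun j => (u (S j) i k - v (S j) i k) ^ 2) <= 2 * Z + INR m * (2 * x ^ 2)).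
    { unfold Z. rewrite <- rsum_const, <- rsum_scal, <- rsum_plus. apply rsum_le. intros j _.
      unfold diffp. fold x. generalize (pow2_ge_0 (u (S j) i k - v (S j) i k - 2 * x)). lra. }
    destruct (Nat.eq_dec m 0) as [E|E].
    - unfold Z in *. rewrite E in *. simpl in *. lra.
    - assert (1 <= INR m) by (change 1 with (INR 1); apply le_INR; lia).
      assert (2 * Z <= (2 * INR m) * Z) by (apply Rmult_le_compat_r; lra). lra. }
  assert (Hx : 0 <= sqx u v)
    by (apply rsum_nonneg; intros; apply rsum_nonneg; intros; apply pow2_ge_0).
  set (Z := rsum n (fun i => rsum q (fun k => rsum m (fun j => (diffp u v (S j) i k - diffp u v 0%nat i k) ^ 2)))) in *.
  assert (HZ : 0 <= Z).
  { apply rsum_nonneg; intros; apply rsum_nonneg; intros; apply rsum_nonneg; intros; apply pow2_ge_0. }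
  assert (HP : Z <= penalty zero2 (diffp u v)).
  { unfold penalty. fold Z.
    assert (0 <= rsum q (fun k => rsum n (fun i => diffp u v 0%nat i k - 0) ^ 2))
      by (apply rsum_nonneg; intros; apply pow2_ge_0). lra. }
  assert (Hm := modulus_pos).
  apply Rle_trans with (modulus * ((2 * INR m + 1) * (sqx u v + Z))).
  - apply Rmult_le_compat_l; lra.
  - replace (modulus * ((2 * INR m + 1) * (sqx u v + Z))) with (/ 2 * (sqx u v + Z))
      by (unfold modulus; field; generalize (pos_INR m); lra).
    assert (/ 2 * sqx u v <= c / 2 * sqx u v) by (apply Rmult_le_compat_r; lra).
    assert (/ 2 * Z <= K / 2 * Z) by (apply Rmult_le_compat_r; lra).
    assert (K / 2 * Z <= K / 2 * penalty zero2 (diffp u v)) by (apply Rmult_le_compat_l; lra).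
    lra.
Qed.

Lemma pcost_comb K th u v : 0 < th < 1 -> dom u -> dom v ->
  dom (comb th u v) /\
  pcost K (comb th u v) <= th * pcost K u + (1 - th) * pcost K v
     - th * (1 - th) * (c / 2 * sqx u v + K / 2 * penalty zero2 (diffp u v)).
Proof.
  intros Hth Hu Hv. destruct (cost_comb th u v Hth Hu Hv) as [H1 H2]. split; [exact H1|].
  unfold pcost. rewrite penalty_comb. lra.
Qed.

Definition converges (u : nat -> point) (l : point) : Prop :=
  forall j i k, (j <= m)%nat -> (i < n)%nat -> (k < q)%nat -> is_lim_seq (fun p => u p j i k) (l j i k).

Lemma cauchy_converges (u : nat -> point) :
  (forall eps, 0 < eps -> exists N, forall p r, (N <= p)%nat -> (N <= r)%nat -> sqdist (u p) (u r) < eps) ->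
  exists l, converges u l.
Proof.
  intros H.
  assert (Hl : forall j i k, exists l : R, (j <= m)%nat -> (i < n)%nat -> (k < q)%nat ->
     is_lim_seq (fun p => u p j i k) l).
  { intros j i k.
    destruct (Compare_dec.le_dec j m) as [Hj|]; [|exists 0; intros; lia].
    destruct (Compare_dec.lt_dec i n) as [Hi|]; [|exists 0; intros; lia].
    destruct (Compare_dec.lt_dec k q) as [Hk|]; [|exists 0; intros; lia].
    destruct (Rcomplete.R_complete (fun p => u p j i k)) as [l Hl].
    - intros eps He. destruct (H (eps ^ 2) ltac:(apply pow_lt; lra)) as [N HN].
      exists N. intros p r Hp Hr. assert (Hs := HN p r Hp Hr). unfold Rdist.
      rewrite <- (Rabs_right eps) by lra. apply Rsqr_lt_abs_0. unfold Rsqr.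
      replace (eps * eps) with (eps ^ 2) by ring.
      replace ((u p j i k - u r j i k) * (u p j i k - u r j i k))
        with ((u p j i k - u r j i k) ^ 2) by ring.
      eapply Rle_lt_trans; [|exact Hs]. unfold sqdist.
      set (F := fun i' k' => (u p 0%nat i' k' - u r 0%nat i' k') ^ 2
         + rsum m (fun j => (u p (S j) i' k' - u r (S j) i' k') ^ 2)).
      assert (HF : forall i' k', 0 <= F i' k').
      { intros i' k'. apply Rplus_le_le_0_compat; [apply pow2_ge_0|].
        apply rsum_nonneg; intros; apply pow2_ge_0. }
      apply Rle_trans with (F i k).
      + unfold F. destruct j as [|j].
        * assert (0 <= rsum m (fun j => (u p (S j) i k - u r (S j) i k) ^ 2))
            by (apply rsum_nonneg; intros; apply pow2_ge_0). lra.
        * assert ((u p (S j) i k - u r (S j) i k) ^ 2 <= rsum m (fun j => (u p (S j) i k - u r (S j) i k) ^ 2)).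
          { apply (rsum_term_le m (fun j => (u p (S j) i k - u r (S j) i k) ^ 2)); [|lia].
            intros; apply pow2_ge_0. }
          assert (0 <= (u p 0%nat i k - u r 0%nat i k) ^ 2) by apply pow2_ge_0. lra.
      + apply Rle_trans with (rsum q (F i)).
        * apply (rsum_term_le q (F i)); auto.
        * apply (rsum_term_le n (fun i => rsum q (F i))); auto. intros; apply rsum_nonneg; auto.
    - exists l. intros _ _ _. now apply is_lim_seq_Reals. }
  destruct (functional_choice (fun j (l : nat -> nat -> R) => forall i k, (j <= m)%nat -> (i < n)%nat ->
     (k < q)%nat -> is_lim_seq (fun p => u p j i k) (l i k))) as [l Hl'].
  { intros j. destruct (functional_choice (fun i (l : nat -> R) => forall k, (j <= m)%nat -> (i < n)%nat ->
     (k < q)%nat -> is_lim_seq (fun p => u p j i k) (l k))) as [l Hl'].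
    - intros i. apply (functional_choice (fun k (l : R) => (j <= m)%nat -> (i < n)%nat ->
         (k < q)%nat -> is_lim_seq (fun p => u p j i k) l)). intros k. apply Hl.
    - exists l. intros; now apply Hl'. }
  exists l. intros j i k Hj Hi Hk. now apply Hl'.
Qed.

(** Values in [ER] are approached by reals [r] strictly below them, for which closedness gives a
    bound valid along the tail of the sequence. Raising one entry of [r] without bound shows that no
    term is infinite at the limit; taking [r] within [e] of the values then gives the inequality. *)
Lemma cost_lsc (u : nat -> point) l (L : nat -> R) (L0 : R) :
  converges u l -> (forall p, dom (u p)) -> (forall p, cost (u p) <= L p) -> is_lim_seq L L0 ->
  dom l /\ cost l <= L0.
Proof.
  intros Hcv Hdom Hle HL.
  assert (Hnear : forall i j del, (i < n)%nat -> (j <= m)%nat -> 0 < del ->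
     eventually (fun p => forall k, (k < q)%nat -> Rabs (u p j i k - l j i k) < del)).
  { intros i j del Hi Hj Hd. apply eventually_forall. intros k Hk. apply is_lim_seq_near; auto. }
  assert (Hkey : forall r : nat -> nat -> R,
    (forall i j, (i < n)%nat -> (j < m)%nat -> ERgtR (fj i (S j) (l (S j) i)) (r i j)) ->
    rsum n (fun i => f0 i (l 0%nat i) + rsum m (r i)) <= L0).
  { intros r Hr.
    assert (Hev : eventually (fun p => forall i, (i < n)%nat -> forall j, (j < m)%nat ->
       ERgtR (fj i (S j) (u p (S j) i)) (r i j))).
    { apply eventually_forall. intros i Hi. apply eventually_forall. intros j Hj.
      destruct (fj_ok i (S j) Hi ltac:(lia)) as [_ [_ Hcl]].
      destruct (Hcl _ _ (Hr i j Hi Hj)) as [del [Hd Hdel]].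
      destruct (Hnear i (S j) del Hi ltac:(lia) Hd) as [N HN]. exists N. intros p Hp. apply Hdel.
      now apply HN. }
    assert (Hlim : is_lim_seq (fun p => rsum n (fun i => f0 i (u p 0%nat i) + rsum m (r i)))
       (rsum n (fun i => f0 i (l 0%nat i) + rsum m (r i)))).
    { apply (is_lim_seq_rsum n (fun p i => f0 i (u p 0%nat i) + rsum m (r i))).
      intros i Hi. apply is_lim_seq_plus'; [|apply is_lim_seq_const].
      apply is_lim_seq_spec. intros eps.
      destruct (f0_cont i Hi (l 0%nat i) eps (cond_pos eps)) as [del [Hd Hdel]].
      destruct (Hnear i 0%nat del Hi ltac:(lia) Hd) as [N HN]. exists N. intros p Hp. apply Hdel.
      now apply HN. }
    change (Rbar_le (rsum n (fun i => f0 i (l 0%nat i) + rsum m (r i))) L0).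
    refine (is_lim_seq_le_loc _ _ _ _ _ Hlim HL).
    destruct Hev as [N HN]. exists N. intros p Hp.
    eapply Rle_trans; [|apply Hle]. apply rsum_le. intros i Hi. apply Rplus_le_compat_l.
    apply rsum_le. intros j Hj. assert (H1 := HN p Hp i Hi j Hj).
    rewrite (finite_val _ (Hdom p i j Hi Hj)) in H1. simpl in H1. lra. }
  assert (Hd : dom l).
  { intros i0 j0 Hi0 Hj0. apply not_pinf. intros Hinf.
    set (r := fun B i j => if andb (Nat.eqb i i0) (Nat.eqb j j0) then B else
       erval (fj i (S j) (l (S j) i)) - 1).
    assert (Hr : forall B, rsum n (fun i => f0 i (l 0%nat i) + rsum m (r B i)) <= L0).
    { intros B. apply Hkey. intros i j Hi Hj. unfold r.
      destruct (Nat.eqb_spec i i0) as [->|]; simpl.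
      - destruct (Nat.eqb_spec j j0) as [->|]; [now rewrite Hinf|].
        destruct (fj i0 (S j) (l (S j) i0)); simpl; [lra|exact I].
      - destruct (fj i (S j) (l (S j) i)); simpl; [lra|exact I]. }
    assert (Hlin : forall B, rsum n (fun i => f0 i (l 0%nat i) + rsum m (r B i))
       = rsum n (fun i => f0 i (l 0%nat i) + rsum m (r 0 i)) + B).
    { intros B.
      assert (E1 : rsum n (fun i => rsum m (fun j => r B i j - r 0 i j)) = B).
      { rewrite (rsum_single n _ i0); auto.
        - rewrite (rsum_single m _ j0); auto.
          + unfold r. rewrite !Nat.eqb_refl. simpl. ring.
          + intros j _ Hj. unfold r. rewrite Nat.eqb_refl.
            destruct (Nat.eqb_spec j j0); [contradiction|simpl; ring].
        - intros i _ Hi. rewrite (rsum_ext m _ (fun _ => 0)); [rewrite rsum_const; ring|].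
          intros j _. unfold r. destruct (Nat.eqb_spec i i0); [contradiction|simpl; ring]. }
      apply eq_trans with (rsum n (fun i => f0 i (l 0%nat i) + rsum m (r 0 i))
        + rsum n (fun i => rsum m (fun j => r B i j - r 0 i j))); [|rewrite E1; reflexivity].
      rewrite <- rsum_plus. apply rsum_ext. intros i _.
      rewrite rsum_minus. ring. }
    assert (H1 := Hr (L0 - rsum n (fun i => f0 i (l 0%nat i) + rsum m (r 0 i)) + 1)).
    rewrite Hlin in H1. lra. }
  split; [exact Hd|].
  apply Rnot_lt_le. intros Hlt.
  set (N := rsum n (fun _ => rsum m (fun _ => 1))).
  assert (HN : 0 <= N) by (apply rsum_nonneg; intros; apply rsum_nonneg; intros; lra).
  set (e := (cost l - L0) / (2 * (N + 1))).
  assert (He : 0 < e) by (apply Rdiv_lt_0_compat; lra).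
  assert (H1 := Hkey (fun i j => erval (fj i (S j) (l (S j) i)) - e)).
  assert (H2 : rsum n (fun i => f0 i (l 0%nat i) + rsum m (fun j => erval (fj i (S j) (l (S j) i)) - e))
     = cost l - e * N).
  { unfold cost, N. rewrite <- rsum_scal, <- rsum_minus. apply rsum_ext. intros i _.
    rewrite <- rsum_scal, rsum_minus. rewrite (rsum_ext m (fun _ => e * 1) (fun _ => e)) by (intros; ring). ring. }
  cbv beta in H1. rewrite H2 in H1.
  assert (H3 : e * N <= (cost l - L0) / 2).
  { unfold e. apply Rmult_le_reg_r with (2 * (N + 1)); [lra|].
    replace ((cost l - L0) / (2 * (N + 1)) * N * (2 * (N + 1))) with ((cost l - L0) * N) by (field; lra).
    nra. }
  assert (cost l - e * N <= L0); [|lra].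
  apply H1. intros i j Hi Hj. rewrite (finite_val _ (Hd i j Hi Hj)). simpl. lra.
Qed.

Lemma penalty_lim (u : nat -> point) l e :
  converges u l -> is_lim_seq (fun p => penalty e (u p)) (penalty e l).
Proof.
  intros H. unfold penalty. apply is_lim_seq_plus'.
  - apply (is_lim_seq_rsum n (fun p i => rsum q (fun k => rsum m (fun j => (u p (S j) i k - u p 0%nat i k) ^ 2)))).
    intros i Hi. apply (is_lim_seq_rsum q (fun p k => rsum m (fun j => (u p (S j) i k - u p 0%nat i k) ^ 2))).
    intros k Hk. apply (is_lim_seq_rsum m (fun p j => (u p (S j) i k - u p 0%nat i k) ^ 2)).
    intros j Hj. simpl.
    assert (is_lim_seq (fun p => u p (S j) i k - u p 0%nat i k) (l (S j) i k - l 0%nat i k))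
      by (apply is_lim_seq_minus'; apply H; auto; lia).
    apply is_lim_seq_mult'; [assumption|]. apply is_lim_seq_mult'; [assumption|apply is_lim_seq_const].
  - apply (is_lim_seq_rsum q (fun p k => rsum n (fun i => u p 0%nat i k - e i k) ^ 2)).
    intros k Hk. simpl.
    assert (is_lim_seq (fun p => rsum n (fun i => u p 0%nat i k - e i k)) (rsum n (fun i => l 0%nat i k - e i k))).
    { apply (is_lim_seq_rsum n (fun p i => u p 0%nat i k - e i k)). intros i Hi.
      apply is_lim_seq_minus'; [apply H; auto; lia|apply is_lim_seq_const]. }
    apply is_lim_seq_mult'; [assumption|]. apply is_lim_seq_mult'; [assumption|apply is_lim_seq_const].
Qed.

(** The affine minorants leave linear terms in the copies. Each splits into a term in the decision
    vector, dominated by strong convexity, and a term in the difference, dominated by the penalty as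
    soon as [K >= 1]. *)
Lemma pcost_bounded_below : exists B, forall K u, 1 <= K -> dom u -> B <= pcost K u.
Proof.
  assert (Hch : exists s : nat -> nat -> nat -> R, exists b : nat -> nat -> R,
    forall i j, (i < n)%nat -> (j < m)%nat -> forall y, finite (fj i (S j) y) ->
    b i j + rsum q (fun k => s i j k * y k) <= erval (fj i (S j) y)).
  { destruct (functional_choice (fun (ij : nat * nat) (sb : (nat -> R) * R) =>
      (fst ij < n)%nat -> (snd ij < m)%nat -> forall y, finite (fj (fst ij) (S (snd ij)) y) ->
       snd sb + rsum q (fun k => fst sb k * y k) <= erval (fj (fst ij) (S (snd ij)) y))) as [F HF].
    - intros [i j]; simpl.
      destruct (Compare_dec.lt_dec i n) as [Hi|]; [|exists (fun _ => 0, 0); intros; lia].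
      destruct (Compare_dec.lt_dec j m) as [Hj|]; [|exists (fun _ => 0, 0); intros; lia].
      destruct (fj_minorant i j Hi Hj) as [s [b H]]. exists (s, b). auto.
    - exists (fun i j => fst (F (i, j))), (fun i j => snd (F (i, j))).
      intros i j Hi Hj. exact (HF (i, j) Hi Hj). }
  destruct Hch as [s [b Hsb]].
  set (z := fun _ : nat => 0).
  exists (rsum n (fun i => f0 i z + rsum m (b i)
     + rsum q (fun k => - / 2 * (g0 i z k + rsum m (fun j => s i j k)) ^ 2 - / 2 * rsum m (fun j => s i j k ^ 2)))).
  intros K u HK Hu. unfold pcost.
  set (Z := rsum n (fun i => rsum q (fun k => rsum m (fun j => (u (S j) i k - u 0%nat i k) ^ 2)))).
  assert (HZ : / 2 * Z <= K / 2 * penalty d u).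
  { assert (Z <= penalty d u).
    { unfold penalty. fold Z. assert (0 <= rsum q (fun k => rsum n (fun i => u 0%nat i k - d i k) ^ 2))
        by (apply rsum_nonneg; intros; apply pow2_ge_0). lra. }
    assert (0 <= penalty d u) by apply penalty_nonneg.
    assert (/ 2 * penalty d u <= K / 2 * penalty d u) by (apply Rmult_le_compat_r; lra). lra. }
  apply Rle_trans with (cost u + / 2 * Z); [|lra].
  unfold cost, Z. rewrite <- rsum_scal, <- rsum_plus. apply rsum_le. intros i Hi.
  assert (H0 := f0_sc i z (u 0%nat i) Hi).
  assert (H1 : rsum m (fun j => b i j + rsum q (fun k => s i j k * u (S j) i k))
     <= rsum m (fun j => erval (fj i (S j) (u (S j) i)))).
  { apply rsum_le. intros j Hj. apply Hsb; auto. }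
  rewrite rsum_plus, rsum_swap in H1.
  assert (H2 : rsum q (fun k => - / 2 * (g0 i z k + rsum m (fun j => s i j k)) ^ 2 - / 2 * rsum m (fun j => s i j k ^ 2))
    <= rsum q (fun k => g0 i z k * (u 0%nat i k - z k)) + c / 2 * rsum q (fun k => (u 0%nat i k - z k) ^ 2)
       + rsum q (fun k => rsum m (fun j => s i j k * u (S j) i k))
       + / 2 * rsum q (fun k => rsum m (fun j => (u (S j) i k - u 0%nat i k) ^ 2))).
  { rewrite <- !rsum_scal, <- !rsum_plus. apply rsum_le. intros k _.
    set (x := u 0%nat i k). set (G := g0 i z k).
    change (z k) with 0.
    assert (H3 : rsum m (fun j => s i j k * x - / 2 * s i j k ^ 2)
      <= rsum m (fun j => s i j k * u (S j) i k + / 2 * (u (S j) i k - x) ^ 2)).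
    { apply rsum_le. intros j _. generalize (pow2_ge_0 (s i j k + (u (S j) i k - x))). lra. }
    rewrite rsum_minus, rsum_plus, rsum_scalr, !rsum_scal in H3.
    set (Sg := rsum m (fun j => s i j k)) in *.
    assert (/ 2 * x ^ 2 <= c / 2 * x ^ 2) by (apply Rmult_le_compat_r; [apply pow2_ge_0|lra]).
    assert (H5 := pow2_ge_0 (G + Sg + x)).
    replace ((x - 0) ^ 2) with (x ^ 2) by ring. lra. }
  lra.
Qed.

Lemma feasible_point : exists y, resource_constraint n q y d /\ dom (fun _ => y).
Proof.
  destruct feasible as [y [Hy Hf]]. exists y. split; [exact Hy|].
  intros i j Hi Hj. unfold total_cost in Hf.
  assert (H := ERsum_finite n _ Hf i Hi). unfold local_cost in H.
  apply (ERsum_from1_finite m (fun j => fj i j (y i))); [|exact Hj].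
  intros E. apply H. rewrite E. reflexivity.
Qed.

(** A minimizing sequence is Cauchy, because the convexity gap at the midpoint of two points is
    bounded by their excess over the infimum; completeness then takes the place of compactness. *)
Lemma minimizer_exists K : 1 <= K -> exists u, dom u /\ forall v, dom v -> pcost K u <= pcost K v.
Proof.
  intros HK. destruct pcost_bounded_below as [B HB]. destruct feasible_point as [y [_ Hy]].
  set (E := fun r => exists u, dom u /\ r = - pcost K u).
  destruct (completeness E) as [s [Hs1 Hs2]].
  { exists (- B). intros r [u [Hu ->]]. generalize (HB K u HK Hu). lra. }
  { exists (- pcost K (fun _ => y)). now exists (fun _ => y). }
  assert (Hinf : forall u, dom u -> - s <= pcost K u).
  { intros u Hu. assert (- pcost K u <= s) by (apply Hs1; now exists u). lra. }
  assert (Happ : forall p : nat, exists u, dom u /\ pcost K u <= - s + / (INR p + 1)).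
  { intros p. assert (Hp : 0 < / (INR p + 1)) by (apply Rinv_0_lt_compat; generalize (pos_INR p); lra).
    apply NNPP. intros Hn.
    assert (s <= s - / (INR p + 1)); [|lra].
    apply Hs2. intros r [u [Hu ->]]. apply Rnot_lt_le. intros Hlt. apply Hn. exists u. split; auto. lra. }
  apply functional_choice in Happ. destruct Happ as [u Hu].
  assert (Hlim0 : is_lim_seq (fun p => / (INR p + 1)) 0).
  { apply is_lim_seq_ext with (fun p => / INR (S p)); [intros; now rewrite S_INR|].
    apply (is_lim_seq_incr_1 (fun p => / INR p)).
    replace (Finite 0) with (Rbar_inv p_infty) by reflexivity.
    apply is_lim_seq_inv; [apply is_lim_seq_INR|discriminate]. }
  destruct (cauchy_converges u) as [l Hl].
  { intros eps He.
    assert (Hmo := modulus_pos).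
    destruct (is_lim_seq_near _ _ Hlim0 (eps * modulus / 4) ltac:(apply Rdiv_lt_0_compat; [apply Rmult_lt_0_compat|]; lra))
      as [N HN].
    exists N. intros p r Hp Hr.
    destruct (Hu p) as [Hdp Hcp]. destruct (Hu r) as [Hdr Hcr].
    destruct (pcost_comb K (1 / 2) (u p) (u r) ltac:(lra) Hdp Hdr) as [Hd Hm].
    assert (H1 := Hinf _ Hd). assert (H2 := coercive_gap K (u p) (u r) HK).
    assert (H3 := HN p Hp). assert (H4 := HN r Hr).
    rewrite Rminus_0_r in H3, H4.
    apply Rabs_def2 in H3. apply Rabs_def2 in H4.
    apply Rmult_lt_reg_l with modulus; [auto|]. lra. }
  destruct (cost_lsc u l (fun p => - s + / (INR p + 1) - K / 2 * penalty d (u p)) (- s + 0 - K / 2 * penalty d l))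
    as [Hd Hcl]; auto.
  { intros p. apply Hu. }
  { intros p. destruct (Hu p) as [_ H]. unfold pcost in H. lra. }
  { apply is_lim_seq_minus'.
    - apply is_lim_seq_plus'; [apply is_lim_seq_const|exact Hlim0].
    - apply is_lim_seq_mult'; [apply is_lim_seq_const|]. now apply penalty_lim. }
  exists l. split; [exact Hd|]. intros v Hv. generalize (Hinf v Hv). unfold pcost at 2. lra.
Qed.

(** Minimality along the segment towards [v], divided by the step [th], loses only [th * Q]. The
    penalty part of [Q] is kept without estimate: it is what makes the certificate in
    [strong_duality] affine. *)
Lemma minimizer_growth K u v :
  dom u -> (forall w, dom w -> pcost K u <= pcost K w) -> dom v ->
  pcost K u + (c / 2 * sqx v u + K / 2 * penalty zero2 (diffp v u)) <= pcost K v.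
Proof.
  intros Hu Hmin Hv.
  set (Q := c / 2 * sqx v u + K / 2 * penalty zero2 (diffp v u)).
  assert (0 <= pcost K v - pcost K u - Q); [|lra].
  apply limit_slope_nonneg with Q. intros th Hth.
  destruct (pcost_comb K th v u Hth Hv Hu) as [Hd Hm]. fold Q in Hm.
  assert (H := Hmin _ Hd). apply Rmult_le_reg_l with th; [lra|]. lra.
Qed.

Lemma cost_diag y : dom (fun _ => y) -> total_cost n m f0 fj y = Fin (cost (fun _ => y)).
Proof.
  intros Hy. unfold total_cost, cost. apply ERsum_fin. intros i Hi. unfold local_cost.
  rewrite ERsum_from1_fin by (intros j Hj; now apply Hy). reflexivity.
Qed.

Lemma penalty_feasible y : resource_constraint n q y d -> penalty d (fun _ => y) = 0.
Proof.
  intros Hy. unfold penalty.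
  rewrite (rsum_ext q (fun k => rsum n (fun i => y i k - d i k) ^ 2) (fun _ => 0)).
  - rewrite (rsum_ext n (fun i => rsum q (fun k => rsum m (fun j => (y i k - y i k) ^ 2))) (fun _ => 0)).
    + rewrite !rsum_const. ring.
    + intros i _. rewrite (rsum_ext q _ (fun _ => 0)); [rewrite rsum_const; ring|]. intros k _.
      rewrite (rsum_ext m _ (fun _ => 0)); [rewrite rsum_const; ring|]. intros; ring.
  - intros k Hk. rewrite rsum_minus, (Hy k Hk). ring.
Qed.

Lemma penalty_zero u : penalty d u = 0 ->
  resource_constraint n q (u 0%nat) d /\
  forall i j k, (i < n)%nat -> (j < m)%nat -> (k < q)%nat -> u (S j) i k = u 0%nat i k.
Proof.
  intros H. unfold penalty in H.
  assert (H1 : 0 <= rsum n (fun i => rsum q (fun k => rsum m (fun j => (u (S j) i k - u 0%nat i k) ^ 2)))).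
  { apply rsum_nonneg; intros; apply rsum_nonneg; intros; apply rsum_nonneg; intros; apply pow2_ge_0. }
  assert (H2 : 0 <= rsum q (fun k => rsum n (fun i => u 0%nat i k - d i k) ^ 2))
    by (apply rsum_nonneg; intros; apply pow2_ge_0).
  assert (Hsq : forall x, x ^ 2 <= 0 -> x = 0) by (intros; nra).
  split.
  - intros k Hk.
    assert (H3 : rsum n (fun i => u 0%nat i k - d i k) ^ 2 <= 0).
    { eapply Rle_trans; [apply (rsum_term_le q (fun k => rsum n (fun i => u 0%nat i k - d i k) ^ 2))|]; auto.
      - intros; apply pow2_ge_0.
      - lra. }
    apply Hsq in H3. rewrite rsum_minus in H3. lra.
  - intros i j k Hi Hj Hk.
    assert (H3 : (u (S j) i k - u 0%nat i k) ^ 2 <= 0); [|apply Hsq in H3; lra].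
    apply Rle_trans with (rsum m (fun j => (u (S j) i k - u 0%nat i k) ^ 2)).
    + apply (rsum_term_le m (fun j => (u (S j) i k - u 0%nat i k) ^ 2)); auto. intros; apply pow2_ge_0.
    + apply Rle_trans with (rsum q (fun k => rsum m (fun j => (u (S j) i k - u 0%nat i k) ^ 2))).
      * apply (rsum_term_le q (fun k => rsum m (fun j => (u (S j) i k - u 0%nat i k) ^ 2))); auto.
        intros; apply rsum_nonneg; intros; apply pow2_ge_0.
      * eapply Rle_trans; [apply (rsum_term_le n (fun i => rsum q (fun k => rsum m (fun j => (u (S j) i k - u 0%nat i k) ^ 2))))|]; auto.
        -- intros; apply rsum_nonneg; intros; apply rsum_nonneg; intros; apply pow2_ge_0.
        -- lra.
Qed.

(* Dual attainment may fail, so the multipliers only certify the optimal value up to [eps];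
   they are read off the minimizer of the quadratic penalty problem for a large weight [K]. *)
Theorem strong_duality :
  exists xs, is_solution n q m f0 fj d xs /\ dom (fun _ => xs) /\
  forall eps, 0 < eps -> exists (sh : nat -> nat -> nat -> R) (vh : nat -> R),
  forall u, dom u ->
    cost (fun _ => xs) - eps
      + rsum n (fun i => rsum q (fun k => vh k * (u 0%nat i k - xs i k)
          + rsum m (fun j => sh j i k * (u (S j) i k - u 0%nat i k)))) <= cost u.
Proof.
  assert (Hch : forall p : nat, exists u, dom u /\ forall v, dom v -> pcost (INR p + 1) u <= pcost (INR p + 1) v).
  { intros p. apply minimizer_exists. generalize (pos_INR p); lra. }
  apply functional_choice in Hch. destruct Hch as [u Hu].
  set (K := fun p => INR p + 1). set (ph := fun p => pcost (K p) (u p)).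
  assert (HK : forall p, 1 <= K p) by (intros; unfold K; generalize (pos_INR p); lra).
  assert (Hub : forall p y, resource_constraint n q y d -> dom (fun _ => y) -> ph p <= cost (fun _ => y)).
  { intros p y Hy Hd. eapply Rle_trans; [apply (proj2 (Hu p) _ Hd)|].
    unfold pcost. rewrite (penalty_feasible y Hy). lra. }
  destruct feasible_point as [y0 [Hy0 Hd0]].
  (* Growth of the [p]-th problem at the [r]-th minimizer, plus the change of weight. As the optimal
     values are bounded, this controls both the distance between minimizers and their penalty. *)
  assert (Hgrow : forall p r, (p <= r)%nat -> ph p + modulus * sqdist (u r) (u p) + (K r - K p) / 2 * penalty d (u r) <= ph r).
  { intros p r Hpr. destruct (Hu p) as [Hdp Hmp]. destruct (Hu r) as [Hdr _].
    assert (H1 := minimizer_growth (K p) (u p) (u r) Hdp Hmp Hdr).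
    assert (H2 := coercive_gap (K p) (u r) (u p) (HK p)).
    unfold ph. unfold pcost at 2. unfold pcost in H1 at 2. lra. }
  assert (Hsd : forall v w, 0 <= sqdist v w).
  { intros. apply rsum_nonneg; intros; apply rsum_nonneg; intros; apply Rplus_le_le_0_compat; [apply pow2_ge_0|].
    apply rsum_nonneg; intros; apply pow2_ge_0. }
  assert (Hmo := modulus_pos).
  assert (HKm : forall p r, (p <= r)%nat -> K p <= K r).
  { intros p r Hpr. unfold K. apply le_INR in Hpr. lra. }
  assert (Hmono : forall p r, (p <= r)%nat -> ph p <= ph r).
  { intros p r Hpr. assert (H := Hgrow p r Hpr).
    assert (0 <= modulus * sqdist (u r) (u p)) by (apply Rmult_le_pos; [lra|auto]).
    assert (0 <= (K r - K p) / 2 * penalty d (u r)).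
    { apply Rmult_le_pos; [generalize (HKm p r Hpr); lra|apply penalty_nonneg]. } lra. }
  destruct (ex_finite_lim_seq_incr ph (cost (fun _ => y0))) as [phi Hphi].
  { intros p. apply Hmono. lia. }
  { intros p. now apply Hub. }
  assert (Hphle : forall p, ph p <= phi).
  { intros p. change (Rbar_le (ph p) phi).
    refine (is_lim_seq_le_loc (fun _ => ph p) ph _ _ _ (is_lim_seq_const _) Hphi).
    exists p. intros r Hr. now apply Hmono. }
  destruct (cauchy_converges u) as [l Hl].
  { intros eps He.
    destruct (is_lim_seq_near _ _ Hphi (eps * modulus) ltac:(apply Rmult_lt_0_compat; lra)) as [N HN].
    exists N.
    assert (Hsym : forall v w, sqdist v w = sqdist w v).
    { intros v w. apply rsum_ext; intros i _. apply rsum_ext; intros k _. f_equal; [ring|].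
      apply rsum_ext; intros; ring. }
    assert (Hlt : forall p r, (N <= p)%nat -> (p <= r)%nat -> sqdist (u r) (u p) < eps).
    { intros p r Hp Hr. assert (H := Hgrow p r Hr).
      assert (0 <= (K r - K p) / 2 * penalty d (u r)).
      { apply Rmult_le_pos; [generalize (HKm p r Hr); lra|apply penalty_nonneg]. }
      assert (H2 := HN p Hp). apply Rabs_def2 in H2. assert (H3 := Hphle r).
      apply Rmult_lt_reg_l with modulus; [auto|]. lra. }
    intros p r Hp Hr. destruct (Nat.le_ge_cases p r); [rewrite Hsym|]; apply Hlt; auto. }
  assert (Hpen : penalty d l = 0).
  { apply Rle_antisym; [|apply penalty_nonneg].
    apply Rnot_lt_le. intros Hpos.
    assert (Hlimp := penalty_lim u l d Hl).
    destruct (is_lim_seq_near _ _ Hlimp (penalty d l / 2) ltac:(lra)) as [N HN].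
    (* If the limit violated a constraint, a growing multiple of a penalty bounded away from 0 would
       exceed the bounded optimal values. *)
    destruct (INR_unbounded (4 * (phi - ph 0%nat) / penalty d l)) as [N2 HN2].
    set (p := Nat.max N N2).
    assert (H1 := HN p ltac:(lia)). apply Rabs_def2 in H1.
    assert (H2 := Hgrow 0%nat p ltac:(lia)). assert (H3 := Hphle p).
    assert (0 <= modulus * sqdist (u p) (u 0%nat)) by (apply Rmult_le_pos; [lra|auto]).
    assert (H5 : INR N2 <= INR p) by (apply le_INR; lia).
    assert (H6 : 4 * (phi - ph 0%nat) < INR p * penalty d l).
    { apply Rmult_lt_compat_r with (r := penalty d l) in HN2; [|auto].
      replace (4 * (phi - ph 0%nat) / penalty d l * penalty d l) with (4 * (phi - ph 0%nat)) in HN2 by (field; lra).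
      assert (INR N2 * penalty d l <= INR p * penalty d l) by (apply Rmult_le_compat_r; lra). lra. }
    assert (EK : K p - K 0%nat = INR p) by (unfold K; simpl; ring). rewrite EK in H2.
    assert (INR p / 2 * (penalty d l / 2) <= INR p / 2 * penalty d (u p)).
    { apply Rmult_le_compat_l; [generalize (pos_INR p); lra|lra]. }
    lra. }
  destruct (cost_lsc u l ph phi Hl) as [Hdl Hcl]; auto.
  { intros p. apply Hu. }
  { intros p. unfold ph, pcost. assert (0 <= K p / 2 * penalty d (u p)).
    { apply Rmult_le_pos; [generalize (HK p); lra|apply penalty_nonneg]. } lra. }
  destruct (penalty_zero l Hpen) as [Hres Hdiag].
  set (xs := l 0%nat) in *.
  assert (Hloc : forall i j, (i < n)%nat -> (j < m)%nat -> fj i (S j) (l (S j) i) = fj i (S j) (xs i)).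
  { intros i j Hi Hj. destruct (fj_ok i (S j) Hi ltac:(lia)) as [HL _]. apply HL. intros k Hk.
    now apply Hdiag. }
  assert (Hdx : dom (fun _ => xs)).
  { intros i j Hi Hj. rewrite <- Hloc by auto. now apply Hdl. }
  assert (Hcx : cost (fun _ => xs) = cost l).
  { unfold cost. apply rsum_ext. intros i Hi. f_equal. apply rsum_ext. intros j Hj. now rewrite Hloc. }
  assert (Hopt : cost (fun _ => xs) = phi).
  { apply Rle_antisym; [lra|].
    change (Rbar_le phi (cost (fun _ => xs))).
    refine (is_lim_seq_le ph (fun _ => cost (fun _ => xs)) _ _ _ Hphi (is_lim_seq_const _)).
    intros p. now apply Hub. }
  exists xs. split; [|split; [exact Hdx|]].
  - split; [exact Hres|]. intros y Hy. rewrite (cost_diag xs Hdx).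
    destruct (total_cost n m f0 fj y) as [r|] eqn:E; [|exact I].
    assert (Hdy : dom (fun _ => y)).
    { intros i j Hi Hj. unfold total_cost in E.
      assert (H := ERsum_finite n _ ltac:(rewrite E; discriminate) i Hi). unfold local_cost in H.
      apply (ERsum_from1_finite m (fun j => fj i j (y i))); [|exact Hj].
      intros E'. apply H. rewrite E'. reflexivity. }
    rewrite (cost_diag y Hdy) in E. injection E as <-. simpl. rewrite Hopt.
    change (Rbar_le phi (cost (fun _ => y))).
    refine (is_lim_seq_le ph (fun _ => cost (fun _ => y)) _ _ _ Hphi (is_lim_seq_const _)).
    intros p. now apply Hub.
  - intros eps He.
    destruct (is_lim_seq_near _ _ Hphi eps He) as [N HN]. assert (Hph := HN N (le_n N)).
    apply Rabs_def2 in Hph.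
    set (uN := u N). set (k := K N).
    exists (fun j i k' => - k * (uN (S j) i k' - uN 0%nat i k')),
      (fun k' => - k * rsum n (fun i => uN 0%nat i k' - d i k')).
    intros v Hv. destruct (Hu N) as [HdN HmN].
    assert (H1 := minimizer_growth k uN v HdN HmN Hv).
    assert (Hsx : 0 <= c / 2 * sqx v uN).
    { apply Rmult_le_pos; [lra|]. apply rsum_nonneg; intros; apply rsum_nonneg; intros; apply pow2_ge_0. }
    (* This is the second-order expansion of the penalty at [uN]: the squares in [v] cancel and an
       affine function with the weighted residuals of [uN] as slopes remains. The residual sum of
       [v] is rewritten with [xs] in place of [d] by the resource constraint. *)
    assert (E : k / 2 * (penalty d uN - penalty d v + penalty zero2 (diffp v uN))
      = k * penalty d uN + rsum n (fun i => rsum q (fun k' =>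
          - k * rsum n (fun i => uN 0%nat i k' - d i k') * (v 0%nat i k' - xs i k')
          + rsum m (fun j => - k * (uN (S j) i k' - uN 0%nat i k') * (v (S j) i k' - v 0%nat i k'))))).
    { unfold penalty.
      set (A1 := rsum n (fun i => rsum q (fun k' => rsum m (fun j => (uN (S j) i k' - uN 0%nat i k') ^ 2)))).
      set (B1 := rsum q (fun k' => rsum n (fun i => uN 0%nat i k' - d i k') ^ 2)).
      set (A2 := rsum n (fun i => rsum q (fun k' => rsum m (fun j => (v (S j) i k' - v 0%nat i k') ^ 2)))).
      set (B2 := rsum q (fun k' => rsum n (fun i => v 0%nat i k' - d i k') ^ 2)).
      assert (EA : rsum n (fun i => rsum q (fun k' => rsum m (fun j => - k * (uN (S j) i k' - uN 0%nat i k') * (v (S j) i k' - v 0%nat i k'))))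
        = k / 2 * (- A1 - A2 + rsum n (fun i => rsum q (fun k' => rsum m (fun j => (diffp v uN (S j) i k' - diffp v uN 0%nat i k') ^ 2))))).
      { unfold A1, A2. rewrite <- (Ropp_involutive (_ - _ + _)).
        match goal with |- _ = k / 2 * - - (- ?a - ?b + ?e) =>
          replace (k / 2 * - - (- a - b + e)) with (k / 2 * (e - (a + b))) by ring end.
        rewrite <- rsum_plus, <- rsum_minus, <- rsum_scal. apply rsum_ext; intros i _.
        rewrite <- rsum_plus, <- rsum_minus, <- rsum_scal. apply rsum_ext; intros k' _.
        rewrite <- rsum_plus, <- rsum_minus, <- rsum_scal. apply rsum_ext; intros j _.
        unfold diffp. field. }
      assert (EB : rsum n (fun i => rsum q (fun k' => - k * rsum n (fun i => uN 0%nat i k' - d i k') * (v 0%nat i k' - xs i k')))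
        = k / 2 * (- B1 - B2 + rsum q (fun k' => rsum n (fun i => diffp v uN 0%nat i k' - 0) ^ 2))).
      { rewrite rsum_swap. unfold B1, B2.
        match goal with |- _ = k / 2 * (- ?a - ?b + ?e) =>
          replace (k / 2 * (- a - b + e)) with (k / 2 * (e - (a + b))) by ring end.
        rewrite <- rsum_plus, <- rsum_minus, <- rsum_scal. apply rsum_ext; intros k' Hk'.
        rewrite rsum_scal.
        rewrite (rsum_ext n (fun i => diffp v uN 0%nat i k' - 0)
          (fun i => (v 0%nat i k' - d i k') - (uN 0%nat i k' - d i k'))) by (intros; unfold diffp; ring).
        rewrite (rsum_minus n (fun i => v 0%nat i k' - d i k')).
        assert (Ex : rsum n (fun i => v 0%nat i k' - xs i k') = rsum n (fun i => v 0%nat i k' - d i k'))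
          by (rewrite !rsum_minus, (Hres k' Hk'); reflexivity).
        rewrite Ex. field. }
      rewrite (rsum_ext n (fun i => rsum q (fun k' =>
          - k * rsum n (fun i => uN 0%nat i k' - d i k') * (v 0%nat i k' - xs i k')
          + rsum m (fun j => - k * (uN (S j) i k' - uN 0%nat i k') * (v (S j) i k' - v 0%nat i k'))))
        (fun i => rsum q (fun k' => - k * rsum n (fun i => uN 0%nat i k' - d i k') * (v 0%nat i k' - xs i k'))
          + rsum q (fun k' => rsum m (fun j => - k * (uN (S j) i k' - uN 0%nat i k') * (v (S j) i k' - v 0%nat i k')))))
        by (intros; now rewrite <- rsum_plus).
      rewrite rsum_plus, EA, EB. field. }
    assert (Hpk : 0 <= k / 2 * penalty d uN).
    { apply Rmult_le_pos; [generalize (HK N); unfold k; lra|apply penalty_nonneg]. }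
    rewrite Hopt. unfold ph in Hph. fold uN k in Hph. unfold pcost in H1, Hph.
    lra.
Qed.
End Duality.

(** * The storage function and its dissipation *)

Definition rsum2 (n q : nat) (F : nat -> nat -> R) : R := rsum n (fun i => rsum q (F i)).

Lemma rsum2_ext n q F G :
  (forall i k, (i < n)%nat -> (k < q)%nat -> F i k = G i k) -> rsum2 n q F = rsum2 n q G.
Proof. intros H. apply rsum_ext; intros i Hi. apply rsum_ext; auto. Qed.

Lemma rsum2_le n q F G :
  (forall i k, (i < n)%nat -> (k < q)%nat -> F i k <= G i k) -> rsum2 n q F <= rsum2 n q G.
Proof. intros H. apply rsum_le; intros i Hi. apply rsum_le; auto. Qed.

Lemma rsum2_nonneg n q F :
  (forall i k, (i < n)%nat -> (k < q)%nat -> 0 <= F i k) -> 0 <= rsum2 n q F.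
Proof. intros H. apply rsum_nonneg; intros i Hi. apply rsum_nonneg; auto. Qed.

Lemma rsum2_plus n q F G : rsum2 n q (fun i k => F i k + G i k) = rsum2 n q F + rsum2 n q G.
Proof. unfold rsum2. rewrite <- rsum_plus. apply rsum_ext; intros; apply rsum_plus. Qed.

Lemma rsum2_minus n q F G : rsum2 n q (fun i k => F i k - G i k) = rsum2 n q F - rsum2 n q G.
Proof. unfold rsum2. rewrite <- rsum_minus. apply rsum_ext; intros; apply rsum_minus. Qed.

Lemma rsum2_scal n q a F : rsum2 n q (fun i k => a * F i k) = a * rsum2 n q F.
Proof. unfold rsum2. rewrite <- rsum_scal. apply rsum_ext; intros; apply rsum_scal. Qed.

Lemma rsum2_opp n q F : rsum2 n q (fun i k => - F i k) = - rsum2 n q F.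
Proof. unfold rsum2. rewrite <- rsum_opp. apply rsum_ext; intros; apply rsum_opp. Qed.

Lemma rsum2_term_le n q F i k :
  (forall i k, (i < n)%nat -> (k < q)%nat -> 0 <= F i k) -> (i < n)%nat -> (k < q)%nat ->
  F i k <= rsum2 n q F.
Proof.
  intros H Hi Hk. apply Rle_trans with (rsum q (F i)).
  - apply (rsum_term_le q (F i)); auto.
  - apply (rsum_term_le n (fun i => rsum q (F i))); auto. intros; apply rsum_nonneg; auto.
Qed.

Lemma dl_rsum2 n q (F : R -> nat -> nat -> R) t l :
  (forall i k, (i < n)%nat -> (k < q)%nat -> D (fun s => F s i k) t (l i k)) ->
  D (fun s => rsum2 n q (F s)) t (rsum2 n q l).
Proof.
  intros H. unfold rsum2. apply (dl_rsum n (fun s i => rsum q (F s i))).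
  intros i Hi. apply (dl_rsum q (fun s k => F s i k)). auto.
Qed.

(** [y] is the proximal point of [s + y], and monotonicity of subgradients makes proximal maps
    nonexpansive; so [y] inherits continuity from the differentiable curve [s + y]. *)
Lemma subgradient_curve_cont q (y s : R -> nat -> R) (fv : R -> R) (thd : nat -> R) t0 t k :
  t0 < t ->
  (forall t1 t2, t0 < t1 -> t0 < t2 -> fv t1 + rsum q (fun k => s t1 k * (y t2 k - y t1 k)) <= fv t2) ->
  (forall k, (k < q)%nat -> D (fun r => s r k + y r k) t (thd k)) ->
  (k < q)%nat -> continuity_pt (fun r => y r k) t.
Proof.
  intros Ht Hsub Hth Hk.
    assert (Hnonexp : forall t1, t0 < t1 ->
      rsum q (fun k => (y t1 k - y t k) ^ 2) <= rsum q (fun k => ((s t1 k + y t1 k) - (s t k + y t k)) ^ 2)).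
    { intros t1 H1. assert (A1 := Hsub t1 t H1 Ht). assert (A2 := Hsub t t1 Ht H1).
      assert (A3 : 0 <= rsum q (fun k => (s t1 k - s t k) * (y t1 k - y t k))).
      { rewrite (rsum_ext q _ (fun k => - (1) * (s t1 k * (y t k - y t1 k)) - s t k * (y t1 k - y t k))) by (intros; ring).
        rewrite rsum_minus, rsum_scal. lra. }
      apply Rle_trans with (rsum q (fun k => ((s t1 k + y t1 k) - (s t k + y t k)) ^ 2
         - 2 * ((s t1 k - s t k) * (y t1 k - y t k)))).
      - apply rsum_le. intros k' _. generalize (pow2_ge_0 (s t1 k' - s t k')). lra.
      - rewrite rsum_minus, rsum_scal. lra. }
    assert (L : lim0 (fun e => rsum q (fun k => ((s (t + e) k + y (t + e) k) - (s t k + y t k)) ^ 2)) 0).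
    { replace 0 with (rsum q (fun _ => 0)) by (rewrite rsum_const; ring).
      apply (lim0_rsum q (fun e k => ((s (t + e) k + y (t + e) k) - (s t k + y t k)) ^ 2)).
      intros k' Hk'.
      assert (L1 : lim0 (fun e => (s (t + e) k' + y (t + e) k') + - (s t k' + y t k')) 0).
      { replace 0 with ((s t k' + y t k') + - (s t k' + y t k')) by ring.
        apply lim0_plus; [|apply lim0_const].
        exact (lim0_cont (fun r => s r k' + y r k') t (dl_cont _ _ _ (Hth k' Hk'))). }
      replace 0 with (0 * (0 * 1)) by ring.
      apply lim0_mult; [exact L1|]. apply lim0_mult; [exact L1|apply lim0_const]. }
    apply cont_of_lim0. intros eps He.
    destruct (L (eps ^ 2) ltac:(apply pow_lt; lra)) as [del [Hd Hl]].
    exists (Rmin del (t - t0)). split; [apply Rmin_glb_lt; lra|]. intros e He0 Hes.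
    generalize (Rmin_l del (t - t0)) (Rmin_r del (t - t0)). intros.
    assert (H2 := Hl e He0 ltac:(lra)). rewrite Rminus_0_r in H2. apply Rabs_def2 in H2.
    assert (Hte : t0 < t + e).
    { assert (Hes' : Rabs e < t - t0) by lra. apply Rabs_def2 in Hes'. lra. }
    assert (H3 := Hnonexp (t + e) Hte).
    assert (H4 : (y (t + e) k - y t k) ^ 2 < eps ^ 2).
    { apply Rle_lt_trans with (rsum q (fun k => (y (t + e) k - y t k) ^ 2)); [|lra].
      apply (rsum_term_le q (fun k => (y (t + e) k - y t k) ^ 2)); auto. intros; apply pow2_ge_0. }
    rewrite <- (Rabs_right eps) by lra. apply Rsqr_lt_abs_0. unfold Rsqr. lra.
Qed.

(* [s] is a subgradient selection of a convex function along the curve [y], with values [fv];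
   the displayed potential is the Moreau envelope gap at [y + s], a C^1 function of it. *)
Lemma envelope_derivative q (y s : R -> nat -> R) (fv : R -> R) (fx : R) (X thd : nat -> R) t0 t :
  t0 < t ->
  (forall t1 t2, t0 < t1 -> t0 < t2 -> fv t1 + rsum q (fun k => s t1 k * (y t2 k - y t1 k)) <= fv t2) ->
  (forall k, (k < q)%nat -> D (fun r => s r k + y r k) t (thd k)) ->
  D (fun r => fx - fv r - rsum q (fun k => s r k * (X k - y r k)) + / 2 * rsum q (fun k => (y r k - X k) ^ 2))
    t (rsum q (fun k => (y t k - X k) * thd k)).
Proof.
  intros Ht Hsub Hth.
  set (H := fun r => fx - fv r - rsum q (fun k => s r k * (X k - y r k)) + / 2 * rsum q (fun k => (y r k - X k) ^ 2)).
  assert (Hinc : forall t1 t2, t0 < t1 -> t0 < t2 ->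
    rsum q (fun k => (y t1 k - X k) * ((s t2 k + y t2 k) - (s t1 k + y t1 k))) <= H t2 - H t1).
  { intros t1 t2 H1 H2. assert (Hs := Hsub t2 t1 H2 H1).
    apply Rle_trans with (fv t1 - fv t2 - rsum q (fun k => s t2 k * (X k - y t2 k))
      + rsum q (fun k => s t1 k * (X k - y t1 k)) + / 2 * rsum q (fun k => (y t2 k - X k) ^ 2)
      - / 2 * rsum q (fun k => (y t1 k - X k) ^ 2)); [|unfold H; lra].
    apply Rle_trans with (rsum q (fun k => s t2 k * (y t1 k - y t2 k))
      - rsum q (fun k => s t2 k * (X k - y t2 k))
      + rsum q (fun k => s t1 k * (X k - y t1 k)) + / 2 * rsum q (fun k => (y t2 k - X k) ^ 2)
      - / 2 * rsum q (fun k => (y t1 k - X k) ^ 2)); [|lra].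
    rewrite <- !rsum_scal, <- rsum_minus, <- !rsum_plus, <- rsum_minus.
    apply rsum_le. intros k _. generalize (pow2_ge_0 (y t2 k - y t1 k)). lra. }
  apply (dl_squeeze q H (fun r k => y r k - X k) (fun r k => s r k + y r k) thd t (t - t0)); auto; [lra| |].
  - intros t' Ht'. apply Rabs_def2 in Ht'. split; [apply Hinc; lra|].
    assert (H1 := Hinc t' t ltac:(lra) Ht).
    rewrite (rsum_ext q _ (fun k => (-1) * ((y t' k - X k) * ((s t' k + y t' k) - (s t k + y t k))))) in H1
      by (intros; ring).
    rewrite rsum_scal in H1. lra.
  - intros k Hk. apply continuity_pt_minus; [|apply continuity_pt_const; intros ? ?; reflexivity].
    eapply subgradient_curve_cont; eauto.
Qed.

Lemma filter_family (A : Type) (P : A -> Prop) (f : A -> R -> R) (init : A -> R) tau :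
  (forall i, P i -> forall t, 0 < t -> continuity_pt (f i) t) ->
  exists F : A -> R -> R, forall i, P i ->
    F i 1 = init i /\ forall t, 1 <= t -> D (F i) t (tau * (f i t - F i t)).
Proof.
  intros H.
  apply (functional_choice (fun i (F : R -> R) => P i ->
    F 1 = init i /\ forall t, 1 <= t -> D F t (tau * (f i t - F t)))).
  intros i. destruct (classic (P i)) as [Hi|Hi]; [|exists (fun _ => 0); tauto].
  destruct (filter_exists (fun t => f i (Rmax t (1 / 2))) tau (init i) 1) as [F [HF1 HF2]].
  { intros t. apply (continuity_pt_comp (fun t => Rmax t (1 / 2)) (f i)).
    - intros eps He. exists eps. split; [exact He|]. intros s [_ Hs]. simpl in *. unfold Rdist in *.
      unfold Rmax. destruct (Rle_dec s (1 / 2)); destruct (Rle_dec t (1 / 2));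
        revert Hs; unfold Rabs; repeat destruct Rcase_abs; lra.
    - apply H; auto. generalize (Rmax_r t (1 / 2)); lra. }
  exists F. intros _. split; [exact HF1|]. intros t Ht. eapply dl_eq; [apply HF2|].
  cbv beta. rewrite Rmax_left by lra. reflexivity.
Qed.

(** * Rate of the storage along a trajectory *)

Section Energy.
Variables (n q M : nat) (f0 : nat -> (nat -> R) -> R) (g0 : nat -> (nat -> R) -> nat -> R)
  (hs0 : nat -> (nat -> R) -> nat -> nat -> R) (fj : nat -> nat -> (nat -> R) -> ER)
  (c : R) (d : nat -> nat -> R) (a : nat -> nat -> R) (h : nat -> R) (gam alpha : R).
Hypothesis Hgam : 0 < gam <= 1.
Hypothesis Hc0 : 0 <= c.
Hypothesis f0_loc : forall i, (i < n)%nat -> local q (f0 i).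
Hypothesis f0_C2 : forall i, (i < n)%nat -> C2_with q (f0 i) (g0 i) (hs0 i).
Hypothesis f0_mono : forall i, (i < n)%nat -> strongly_monotone q (g0 i) c.
Hypothesis Hh_pos : forall i, (i < n)%nat -> 0 < h i.

Variables (x v w : R -> nat -> nat -> R) (z ys : R -> nat -> nat -> nat -> R) (xs : nat -> nat -> R).

Notation Lap := (mulv n (lap n a)).
Notation S2 := (rsum2 n q).

Definition lapv (u : nat -> nat -> R) (i k : nat) : R := Lap (fun j => u j k) i.

(* [ys t j] are the proximal points: [j < M] for the [z]-equations, [j = M] for the [x]-equation. *)
Definition xd t i k := ys t M i k - x t i k.
Definition zd t j i k := ys t j i k - x t i k.
Definition vd t i k := - / h i * (x t i k - d i k) - alpha * lapv (v t) i k - w t i k.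
Definition gr t i k := g0 i (x t i) k.
Definition gd t i k := rsum q (fun l => hs0 i (x t i) k l * xd t i l).
Definition xi t i k := x t i k - xs i k.

(* The subgradient of the [j]-th nonsmooth term selected by the proximal step. *)
Definition ss t j i k :=
  if Nat.eqb j M then - gr t i k - xd t i k + v t i k + gam * rsum M (fun j' => z t j' i k)
  else - gam * z t j i k - zd t j i k.

(** The rate of [ss + ys], the argument of the proximal step. *)
Definition thd t j i k :=
  if Nat.eqb j M then xd t i k - gd t i k + vd t i k + gam * rsum M (fun j' => zd t j' i k)
  else xd t i k - gam * zd t j i k.

(** The Bregman divergence of [f0 i] from [x t i] to [xs i]. In this direction its rate pairs [xi]
    with the velocity of the gradient. *)
Definition gapD t i := f0 i (xs i) - f0 i (x t i) - rsum q (fun k => gr t i k * (xs i k - x t i k)).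
(** As [ss] is a subgradient at [ys], this is the Fenchel-Young gap of the term at [xs] and [ss]. It
    is a convex function of [ss], with subgradient [ys - xs], and the filtered references rely on
    this. *)
Definition gapG t j i :=
  erval (fj i (S j) (xs i)) - erval (fj i (S j) (ys t j i))
  - rsum q (fun k => ss t j i k * (xs i k - ys t j i k)).
Definition Psi t j i := gapG t j i + / 2 * rsum q (fun k => (ys t j i k - xs i k) ^ 2).

Hypothesis Hx : forall t i k, 0 < t -> (i < n)%nat -> (k < q)%nat -> D (fun s => x s i k) t (xd t i k).
Hypothesis Hz : forall t j i k, 0 < t -> (j < M)%nat -> (i < n)%nat -> (k < q)%nat ->
  D (fun s => z s j i k) t (zd t j i k).
Hypothesis Hv : forall t i k, 0 < t -> (i < n)%nat -> (k < q)%nat -> D (fun s => v s i k) t (vd t i k).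
Hypothesis Hw : forall t i k, 0 < t -> (i < n)%nat -> (k < q)%nat ->
  D (fun s => w s i k) t (alpha * lapv (v t) i k).
Hypothesis ys_fin : forall t j i, 0 < t -> (j <= M)%nat -> (i < n)%nat -> finite (fj i (S j) (ys t j i)).
Hypothesis ys_sub : forall t j i y, 0 < t -> (j <= M)%nat -> (i < n)%nat -> finite (fj i (S j) y) ->
  erval (fj i (S j) (ys t j i)) + rsum q (fun k => ss t j i k * (y k - ys t j i k)) <= erval (fj i (S j) y).
Hypothesis xs_fin : forall j i, (j <= M)%nat -> (i < n)%nat -> finite (fj i (S j) (xs i)).

Lemma ss_lt t j i k : (j < M)%nat -> ss t j i k = - gam * z t j i k - zd t j i k.
Proof. intros H. unfold ss. destruct (Nat.eqb_spec j M); [lia|reflexivity]. Qed.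

Lemma ss_last t i k :
  ss t M i k = - gr t i k - xd t i k + v t i k + gam * rsum M (fun j' => z t j' i k).
Proof. unfold ss. now rewrite Nat.eqb_refl. Qed.

Lemma thd_lt t j i k : (j < M)%nat -> thd t j i k = xd t i k - gam * zd t j i k.
Proof. intros H. unfold thd. destruct (Nat.eqb_spec j M); [lia|reflexivity]. Qed.

Lemma thd_last t i k :
  thd t M i k = xd t i k - gd t i k + vd t i k + gam * rsum M (fun j' => zd t j' i k).
Proof. unfold thd. now rewrite Nat.eqb_refl. Qed.

Lemma gr_deriv t i k : 0 < t -> (i < n)%nat -> (k < q)%nat -> D (fun s => gr s i k) t (gd t i k).
Proof.
  intros Ht Hi Hk. unfold gr, gd.
  apply (grad_chain q (f0 i) (g0 i) (hs0 i) (f0_loc i Hi) (f0_C2 i Hi) k (fun s => x s i)); auto.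
Qed.

Lemma f0_deriv t i : 0 < t -> (i < n)%nat ->
  D (fun s => f0 i (x s i)) t (rsum q (fun k => gr t i k * xd t i k)).
Proof.
  intros Ht Hi. unfold gr.
  apply (partial_chain q (f0 i) (g0 i) (f0_loc i Hi) (proj1 (f0_C2 i Hi))
    (grad_cont q (f0 i) (g0 i) (hs0 i) (f0_loc i Hi) (f0_C2 i Hi)) (fun s => x s i)); auto.
Qed.

Lemma theta_deriv t j i k : 0 < t -> (j <= M)%nat -> (i < n)%nat -> (k < q)%nat ->
  D (fun s => ss s j i k + ys s j i k) t (thd t j i k).
Proof.
  intros Ht Hj Hi Hk. destruct (Nat.eq_dec j M) as [->|Hne].
  - rewrite thd_last.
    apply dl_ext with (fun s => x s i k - gr s i k + v s i k + gam * rsum M (fun j' => z s j' i k)).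
    { intros s. rewrite ss_last. unfold xd. ring. }
    apply dl_plus; [apply dl_plus; [apply dl_minus|]|]; auto using gr_deriv.
    apply dl_scal. apply (dl_rsum M (fun s j' => z s j' i k)). intros; auto.
  - rewrite thd_lt by lia.
    apply dl_ext with (fun s => x s i k - gam * z s j i k).
    { intros s. rewrite ss_lt by lia. unfold zd. ring. }
    apply dl_minus; [auto|]. apply dl_scal. apply Hz; auto; lia.
Qed.

Lemma Psi_deriv t j i : 0 < t -> (j <= M)%nat -> (i < n)%nat ->
  D (fun s => Psi s j i) t (rsum q (fun k => (ys t j i k - xs i k) * thd t j i k)).
Proof.
  intros Ht Hj Hi.
  apply (envelope_derivative q (fun s => ys s j i) (fun s => ss s j i)
    (fun s => erval (fj i (S j) (ys s j i))) (erval (fj i (S j) (xs i))) (xs i) (thd t j i) 0 t Ht).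
  - intros t1 t2 H1 H2. apply ys_sub; auto.
  - intros k Hk. now apply theta_deriv.
Qed.

Lemma gapD_deriv t i : 0 < t -> (i < n)%nat ->
  D (fun s => gapD s i) t (rsum q (fun k => xi t i k * gd t i k)).
Proof.
  intros Ht Hi. unfold gapD. eapply dl_eq.
  - apply dl_minus; [apply dl_minus; [apply dl_const|now apply f0_deriv]|].
    apply (dl_rsum q (fun s k => gr s i k * (xs i k - x s i k))). intros k Hk.
    apply dl_mult; [now apply gr_deriv|]. apply dl_minus; [apply dl_const|now apply Hx].
  - rewrite Rminus_0_l, <- (Ropp_involutive (rsum q (fun k => xi t i k * gd t i k))).
    match goal with |- - ?A - ?B = - - ?C => assert (H : A + B + C = 0); [|lra] end.
    rewrite <- !rsum_plus. rewrite (rsum_ext q _ (fun _ => 0)); [rewrite rsum_const; ring|].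
    intros; unfold xi; ring.
Qed.

Lemma gapD_lower t i : (i < n)%nat -> c / 2 * rsum q (fun k => xi t i k ^ 2) <= gapD t i.
Proof.
  intros Hi.
  assert (H := strong_convexity q (f0 i) (g0 i) (hs0 i) c (f0_loc i Hi) (f0_C2 i Hi) (f0_mono i Hi) (x t i) (xs i)).
  unfold gapD, gr. rewrite (rsum_ext q (fun k => xi t i k ^ 2) (fun k => (xs i k - x t i k) ^ 2))
    by (intros; unfold xi; ring). lra.
Qed.

Lemma gapG_nonneg t j i : 0 < t -> (j <= M)%nat -> (i < n)%nat -> 0 <= gapG t j i.
Proof.
  intros Ht Hj Hi. unfold gapG. generalize (ys_sub t j i (xs i) Ht Hj Hi (xs_fin j i Hj Hi)). lra.
Qed.

Definition gap t := rsum n (fun i => gapD t i + rsum (S M) (fun j => gapG t j i)).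

Lemma gap_lower t : 0 < t -> c / 2 * S2 (fun i k => xi t i k ^ 2) <= gap t.
Proof.
  intros Ht. unfold gap, rsum2. rewrite <- rsum_scal. apply rsum_le. intros i Hi.
  assert (H := gapD_lower t i Hi).
  assert (0 <= rsum (S M) (fun j => gapG t j i)) by (apply rsum_nonneg; intros; apply gapG_nonneg; auto; lia).
  lra.
Qed.

(** The Hessian bound in the direction of the velocity, obtained as the limit of strong monotonicity
    on difference quotients. *)
Lemma xd_gd t : 0 < t -> c * S2 (fun i k => xd t i k ^ 2) <= S2 (fun i k => xd t i k * gd t i k).
Proof.
  intros Ht. unfold rsum2. rewrite <- rsum_scal. apply rsum_le. intros i Hi.
  assert (H : 0 <= rsum q (fun k => gd t i k * xd t i k) - c * rsum q (fun k => xd t i k * xd t i k)).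
  { apply (lim0_nonneg (fun s => rsum q (fun k => (gr (t + s) i k - gr t i k) / s * ((x (t + s) i k - x t i k) / s))
       + - (c) * rsum q (fun k => (x (t + s) i k - x t i k) / s * ((x (t + s) i k - x t i k) / s)))).
    - match goal with |- lim0 _ (?A - c * ?B) => replace (A - c * B) with (A + - c * B) by ring end.
      apply lim0_plus.
      + apply (lim0_rsum q (fun s k => (gr (t + s) i k - gr t i k) / s * ((x (t + s) i k - x t i k) / s))).
        intros k Hk. apply lim0_mult.
        * exact (proj1 (lim0_diff (fun s => gr s i k) t _) (gr_deriv t i k Ht Hi Hk)).
        * exact (proj1 (lim0_diff (fun s => x s i k) t _) (Hx t i k Ht Hi Hk)).
      + apply lim0_mult; [apply lim0_const|].
        apply (lim0_rsum q (fun s k => (x (t + s) i k - x t i k) / s * ((x (t + s) i k - x t i k) / s))).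
        intros k Hk. apply lim0_mult; exact (proj1 (lim0_diff (fun s => x s i k) t _) (Hx t i k Ht Hi Hk)).
    - exists 1. split; [lra|]. intros s Hs.
      assert (Hm := f0_mono i Hi (x (t + s) i) (x t i)). unfold sqnorm, vsub in Hm.
      rewrite (rsum_ext q _ (fun k => / s ^ 2 * ((gr (t + s) i k - gr t i k) * (x (t + s) i k - x t i k))))
        by (intros; field; lra).
      rewrite (rsum_ext q (fun k => _ / s * (_ / s)) (fun k => / s ^ 2 * ((x (t + s) i k - x t i k) * (x (t + s) i k - x t i k))))
        by (intros; field; lra).
      rewrite !rsum_scal. unfold gr.
      assert (0 < / s ^ 2) by (apply Rinv_0_lt_compat, pow_lt; lra).
      match goal with |- 0 <= / s ^ 2 * ?A + - c * (/ s ^ 2 * ?B) =>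
        replace (/ s ^ 2 * A + - c * (/ s ^ 2 * B)) with (/ s ^ 2 * (A - c * B)) by ring end.
      apply Rmult_le_pos; lra. }
  rewrite (rsum_ext q (fun k => xd t i k ^ 2) (fun k => xd t i k * xd t i k)) by (intros; ring).
  rewrite (rsum_ext q (fun k => xd t i k * gd t i k) (fun k => gd t i k * xd t i k)) by (intros; ring).
  lra.
Qed.

Variables (c0 Rg p r kap : R).
Hypothesis HRg : 0 <= Rg.
Hypothesis Hc0c : 0 < c0 < c.
Hypothesis Hmu : 0 < c0 / 2 - (1 + gam) * INR M / 4 - Rg.
Hypothesis Hpr : p + r = 1.
Hypothesis Hp : 0 < p.
Hypothesis Hr : 0 < r.
Hypothesis Hkap : 0 < kap.
Hypothesis Hgraph : forall N o I, rsum n (fun i => h i * o i) = 0 ->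
    rsum n (fun i => - (alpha * p) * (h i * (N i * Lap N i)) - h i * (N i * o i)
                     - r * (h i * o i ^ 2) - r * (o i * I i))
    <= - kap * rsum n (fun i => (N i - rsum n N / INR n) ^ 2 + o i ^ 2)
       + Rg * rsum n (fun i => I i ^ 2).

Definition kb := (1 + gam) * INR M / 4 - Rg.

(* The reference point: [tau = 0] for constant references, [tau > 0] for low-pass filters of the
   trajectory. [om] is the matching deviation of [w + dw/dt]. *)
Section Reference.
Variables (tau dl : R) (xh vh gh : R -> nat -> nat -> R) (zh : R -> nat -> nat -> nat -> R)
  (om : R -> nat -> nat -> R).
Hypothesis Htau : 0 <= tau.
Hypothesis Hdl : 0 <= dl.
Hypothesis Htaudl : tau + dl <= 1 / 4.
Hypothesis Htaugam : tau <= gam / 2.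
Hypothesis Hmargin :
  (tau + dl) * (INR M * (8 + 8 / gam) + 8 + 8 * Rg + 4 * ((1 + gam) * INR M / 4) + 2 * c0)
  <= c0 / 2 - (1 + gam) * INR M / 4 - Rg.
Definition bb t i k := x t i k - xh t i k.
Definition ff t j i k := z t j i k - zh t j i k.
Definition vt t i k := v t i k - vh t i k.
Definition gt t i k := gr t i k - gh t i k.
(** When the reference [vh] moves with velocity [tau * vt], this is [v + dv/dt] minus the same sum
    for [vh]. [It] is the analogue for [x + dx/dt], and [Ih] the offset of that reference from
    [xs]. *)
Definition NN t i k := vd t i k + (1 - tau) * vt t i k.
Definition It t i k := (1 - tau) * bb t i k + xd t i k.
Definition Ih t i k := xh t i k - xs i k + tau * bb t i k.

(** A quadratic correction read off from [energy_identity]: with the other rates it removes [xi]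
    from everything except the pairing with [NN]. *)
Definition qloc t i k :=
  / 2 * bb t i k ^ 2 + (xi t i k - bb t i k) * bb t i k - tau / 2 * bb t i k ^ 2
  + rsum M (fun j => xi t i k * ff t j i k - (1 + gam) * (bb t i k * ff t j i k)
      + (gam - tau) / 2 * ff t j i k ^ 2).

(** With [gh] equal to the gradient at [xs] this would be a Bregman divergence. Its rate cancels the
    product of [gt] and [xd] in the supply. *)
Definition omega0 t :=
  rsum n (fun i => f0 i (x t i) - f0 i (xs i) - rsum q (fun k => gh t i k * xi t i k)).

(** The first square is damped by the Laplacian. In the rate of [NN + om] the Laplacian cancels, so
    the second square is the one that dissipates [om]. *)
Definition gstore t i k := h i * (p / 2 * NN t i k ^ 2 + r / 2 * (NN t i k + om t i k) ^ 2).

Definition energy t :=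
  rsum n (fun i => gapD t i + rsum (S M) (fun j => Psi t j i))
  + - ((INR M + 1) / 2) * S2 (fun i k => xi t i k ^ 2)
  + (1 - tau) * (S2 (qloc t) + omega0 t)
  + kb * S2 (fun i k => bb t i k ^ 2)
  + S2 (gstore t).

(* The supply: the pairing of the primal deviations with the deviations of the subgradients. *)
Definition pairing t i k :=
  xi t i k * gt t i k
  + (xi t i k + xd t i k) * (- gt t i k - (xd t i k - tau * bb t i k) + vt t i k
       + gam * rsum M (fun j => ff t j i k))
  + rsum M (fun j => (xi t i k + zd t j i k)
       * (- gam * ff t j i k - (zd t j i k - tau * ff t j i k))).

Section AtTime.
Variable t : R.
Hypothesis Ht : 0 < t.
Hypothesis Hxh : forall i k, (i < n)%nat -> (k < q)%nat -> D (fun s => xh s i k) t (tau * bb t i k).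
Hypothesis Hzh : forall j i k, (j < M)%nat -> (i < n)%nat -> (k < q)%nat ->
  D (fun s => zh s j i k) t (tau * ff t j i k).
Hypothesis Hvh : forall i k, (i < n)%nat -> (k < q)%nat -> D (fun s => vh s i k) t (tau * vt t i k).
Hypothesis Hgh : forall i k, (i < n)%nat -> (k < q)%nat -> D (fun s => gh s i k) t (tau * gt t i k).
Hypothesis Hom : forall i k, (i < n)%nat -> (k < q)%nat ->
  D (fun s => om s i k) t (alpha * lapv (NN t) i k).
Hypothesis Hom0 : forall k, (k < q)%nat -> rsum n (fun i => h i * om t i k) = 0.

Definition vdd i k :=
  - / h i * xd t i k - alpha * lapv (vd t) i k - alpha * lapv (v t) i k.

Definition NNd i k := vdd i k + (1 - tau) * (vd t i k - tau * vt t i k).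

Hypothesis Hbal : forall i k, (i < n)%nat -> (k < q)%nat ->
  h i * NNd i k = - It t i k - alpha * (h i * lapv (NN t) i k) - h i * om t i k.

Lemma lapv_deriv (u : R -> nat -> nat -> R) ud i k :
  (forall j, (j < n)%nat -> D (fun s => u s j k) t (ud j k)) ->
  D (fun s => lapv (u s) i k) t (lapv ud i k).
Proof.
  intros H. unfold lapv, mulv. apply (dl_rsum n (fun s j => lap n a i j * u s j k)).
  intros j Hj. apply dl_scal. auto.
Qed.

Lemma vd_deriv i k : (i < n)%nat -> (k < q)%nat -> D (fun s => vd s i k) t (vdd i k).
Proof.
  intros Hi Hk. unfold vd. eapply dl_eq.
  - apply dl_minus; [apply dl_minus|].
    + apply dl_scal, dl_minus; [now apply Hx|apply dl_const].
    + apply dl_scal, (lapv_deriv v (vd t)). intros; now apply Hv.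
    + now apply Hw.
  - unfold vdd; ring.
Qed.

Lemma NN_deriv i k : (i < n)%nat -> (k < q)%nat -> D (fun s => NN s i k) t (NNd i k).
Proof.
  intros Hi Hk. unfold NN, NNd, vt. apply dl_plus; [now apply vd_deriv|].
  apply dl_scal, dl_minus; [now apply Hv|now apply Hvh].
Qed.

Lemma bb_deriv i k : (i < n)%nat -> (k < q)%nat ->
  D (fun s => bb s i k) t (xd t i k - tau * bb t i k).
Proof. intros Hi Hk. apply dl_minus; [now apply Hx|now apply Hxh]. Qed.

Lemma ff_deriv j i k : (j < M)%nat -> (i < n)%nat -> (k < q)%nat ->
  D (fun s => ff s j i k) t (zd t j i k - tau * ff t j i k).
Proof. intros Hj Hi Hk. apply dl_minus; [now apply Hz|now apply Hzh]. Qed.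

Lemma xi_deriv i k : (i < n)%nat -> (k < q)%nat -> D (fun s => xi s i k) t (xd t i k).
Proof.
  intros Hi Hk. eapply dl_eq; [apply dl_minus; [now apply Hx|apply dl_const]|ring].
Qed.

Definition qloc_rate i k :=
  bb t i k * (xd t i k - tau * bb t i k)
  + (xi t i k - bb t i k) * (xd t i k - tau * bb t i k) + tau * bb t i k * bb t i k
  - tau * (bb t i k * (xd t i k - tau * bb t i k))
  + rsum M (fun j => xd t i k * ff t j i k + xi t i k * (zd t j i k - tau * ff t j i k)
      - (1 + gam) * ((xd t i k - tau * bb t i k) * ff t j i k + bb t i k * (zd t j i k - tau * ff t j i k))
      + (gam - tau) * (ff t j i k * (zd t j i k - tau * ff t j i k))).

Lemma qloc_deriv i k : (i < n)%nat -> (k < q)%nat -> D (fun s => qloc s i k) t (qloc_rate i k).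
Proof.
  intros Hi Hk. unfold qloc, qloc_rate.
  assert (Hb := bb_deriv i k Hi Hk). assert (Hxi := xi_deriv i k Hi Hk).
  apply dl_plus.
  - eapply dl_eq.
    + apply dl_minus; [apply dl_plus|].
      * apply dl_scal, dl_sq, Hb.
      * apply dl_mult; [apply dl_minus; [exact Hxi|exact Hb]|exact Hb].
      * apply dl_scal, dl_sq, Hb.
    + cbv beta. field.
  - apply (dl_rsum M (fun s j => xi s i k * ff s j i k - (1 + gam) * (bb s i k * ff s j i k)
      + (gam - tau) / 2 * ff s j i k ^ 2)).
    intros j Hj. assert (Hf := ff_deriv j i k Hj Hi Hk). eapply dl_eq.
    + apply dl_plus; [apply dl_minus|].
      * apply dl_mult; [exact Hxi|exact Hf].
      * apply dl_scal, dl_mult; [exact Hb|exact Hf].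
      * apply dl_scal, dl_sq, Hf.
    + cbv beta. field.
Qed.

Lemma omega0_deriv :
  D omega0 t (S2 (fun i k => gt t i k * xd t i k - tau * (gt t i k * xi t i k))).
Proof.
  unfold omega0, rsum2.
  apply (dl_rsum n (fun s i => f0 i (x s i) - f0 i (xs i) - rsum q (fun k => gh s i k * xi s i k))).
  intros i Hi. eapply dl_eq.
  - apply dl_minus; [apply dl_minus; [now apply f0_deriv|apply dl_const]|].
    apply (dl_rsum q (fun s k => gh s i k * xi s i k)). intros k Hk.
    apply dl_mult; [now apply Hgh|now apply xi_deriv].
  - rewrite Rminus_0_r, <- rsum_minus. apply rsum_ext; intros; unfold gt; ring.
Qed.

Definition gstore_rate i k :=
  NN t i k * (- It t i k) - r * (om t i k * It t i k)
  + (- (alpha * p) * (h i * (NN t i k * lapv (NN t) i k)) - h i * (NN t i k * om t i k)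
     - r * (h i * om t i k ^ 2)).

Lemma gstore_deriv i k : (i < n)%nat -> (k < q)%nat -> D (fun s => gstore s i k) t (gstore_rate i k).
Proof.
  intros Hi Hk. unfold gstore. assert (HN := NN_deriv i k Hi Hk). assert (Ho := Hom i k Hi Hk).
  eapply dl_eq.
  - apply dl_scal, dl_plus; apply dl_scal, dl_sq; [exact HN|apply dl_plus; [exact HN|exact Ho]].
  - set (X := NNd i k). assert (HX := Hbal i k Hi Hk). fold X in HX.
    unfold gstore_rate. set (lN := lapv (NN t) i k) in *.
    replace (h i * (p / 2 * (2 * (NN t i k * X)) + r / 2 * (2 * ((NN t i k + om t i k) * (X + alpha * lN)))))
      with (p * NN t i k * (h i * X) + r * (NN t i k + om t i k) * (h i * X + alpha * (h i * lN))) by field.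
    rewrite HX. replace p with (1 - r) by lra. ring.
Qed.

Lemma energy_rate : exists l, D energy t l /\
  l + (1 - tau) * (S2 (pairing t) + tau * S2 (fun i k => xi t i k * gt t i k))
  <= S2 (fun i k => NN t i k * Ih t i k)
     + (1 - tau) * (1 + tau) * (c0 / 2) * S2 (fun i k => bb t i k ^ 2)
     - tau * S2 (fun i k => It t i k ^ 2)
     - dl * S2 (fun i k => xd t i k ^ 2 + bb t i k ^ 2 + rsum M (fun j => zd t j i k ^ 2))
     - kap * S2 (fun i k => (NN t i k - rsum n (fun i' => NN t i' k) / INR n) ^ 2 + om t i k ^ 2).
Proof.
  set (A1 := fun i => rsum q (fun k => xi t i k * gd t i k)
     + rsum (S M) (fun j => rsum q (fun k => (ys t j i k - xs i k) * thd t j i k))).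
  set (l := rsum n A1 + - ((INR M + 1) / 2) * S2 (fun i k => 2 * (xi t i k * xd t i k))
    + (1 - tau) * (S2 qloc_rate + S2 (fun i k => gt t i k * xd t i k - tau * (gt t i k * xi t i k)))
    + kb * S2 (fun i k => 2 * (bb t i k * (xd t i k - tau * bb t i k)))
    + S2 gstore_rate).
  exists l. split.
  { unfold energy. repeat apply dl_plus.
    - apply (dl_rsum n (fun s i => gapD s i + rsum (S M) (fun j => Psi s j i))). intros i Hi.
      apply dl_plus; [now apply gapD_deriv|]. apply (dl_rsum (S M) (fun s j => Psi s j i)).
      intros j Hj. apply Psi_deriv; auto; lia.
    - apply dl_scal, (dl_rsum2 n q (fun s i k => xi s i k ^ 2)). intros. apply dl_sq. now apply xi_deriv.
    - apply dl_scal, dl_plus; [|apply omega0_deriv].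
      apply (dl_rsum2 n q qloc). intros; now apply qloc_deriv.
    - apply dl_scal, (dl_rsum2 n q (fun s i k => bb s i k ^ 2)). intros. apply dl_sq. now apply bb_deriv.
    - apply (dl_rsum2 n q gstore). intros; now apply gstore_deriv. }
  assert (EA : rsum n A1 = S2 (fun i k => xi t i k * gd t i k
      + (xi t i k + xd t i k) * (xd t i k - gd t i k + vd t i k + gam * rsum M (fun j => zd t j i k))
      + rsum M (fun j => (xi t i k + zd t j i k) * (xd t i k - gam * zd t j i k)))).
  { unfold rsum2. apply rsum_ext. intros i Hi. unfold A1. rewrite rsum_swap, <- rsum_plus.
    apply rsum_ext. intros k Hk. cbn [rsum]. rewrite thd_last.
    rewrite (rsum_ext M _ (fun j => (xi t i k + zd t j i k) * (xd t i k - gam * zd t j i k))).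
    - unfold xi, xd. ring.
    - intros j Hj. rewrite thd_lt by auto. unfold xi, zd. ring. }
  set (loc := fun i k => tau * xd t i k ^ 2 + (1 - tau) * (tau + tau ^ 2) * bb t i k ^ 2
    + rsum M (fun j => (1 + gam) * (zd t j i k * (xd t i k - (1 - tau) * bb t i k))
        - (1 + gam - tau) * zd t j i k ^ 2
        + (1 - tau) * (2 * (1 + gam) * tau * (bb t i k * ff t j i k) - tau * (gam - tau) * ff t j i k ^ 2))
    + 2 * kb * (bb t i k * (xd t i k - tau * bb t i k))).
  set (gpt := fun i k => - (alpha * p) * (h i * (NN t i k * lapv (NN t) i k)) - h i * (NN t i k * om t i k)
     - r * (h i * om t i k ^ 2) - r * (om t i k * It t i k)).
  assert (El : l + (1 - tau) * (S2 (pairing t) + tau * S2 (fun i k => xi t i k * gt t i k))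
    = S2 (fun i k => NN t i k * Ih t i k) - S2 (fun i k => xd t i k * gd t i k) + S2 loc + S2 gpt).
  { unfold l. rewrite EA. rewrite <- !rsum2_scal, <- !rsum2_plus, <- !rsum2_scal, <- rsum2_minus, <- !rsum2_plus.
    apply rsum2_ext. intros i k Hi Hk.
    assert (HI := energy_identity M gam tau (xi t i k) (xd t i k) (bb t i k) (gd t i k) (gt t i k)
       (vd t i k) (vt t i k) (fun j => zd t j i k) (fun j => ff t j i k)).
    unfold loc, gpt, gstore_rate, qloc_rate, pairing.
    assert (HIt : It t i k = xi t i k + xd t i k - Ih t i k) by (unfold It, Ih, xi, bb; ring).
    rewrite HIt. change (vd t i k + (1 - tau) * vt t i k) with (NN t i k) in HI.
    match goal with |- ?L = ?R' =>
      match type of HI with ?L0 = ?R0 => assert (L - L0 = R' - R0); [|lra] end end.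
    cbv beta. field. }
  rewrite El.
  assert (H1 := xd_gd t Ht).
  assert (H2 : S2 gpt <= - kap * S2 (fun i k => (NN t i k - rsum n (fun i' => NN t i' k) / INR n) ^ 2 + om t i k ^ 2)
     + Rg * S2 (fun i k => It t i k ^ 2)).
  { unfold rsum2. rewrite !(rsum_swap n q). rewrite <- !rsum_scal, <- rsum_plus.
    apply rsum_le. intros k Hk.
    exact (Hgraph (fun i => NN t i k) (fun i => om t i k) (fun i => It t i k) (Hom0 k Hk)). }
  assert (H3 : S2 loc - c * S2 (fun i k => xd t i k ^ 2) + Rg * S2 (fun i k => It t i k ^ 2)
     - (1 - tau) * (1 + tau) * (c0 / 2) * S2 (fun i k => bb t i k ^ 2) + tau * S2 (fun i k => It t i k ^ 2)
     <= - dl * S2 (fun i k => xd t i k ^ 2 + bb t i k ^ 2 + rsum M (fun j => zd t j i k ^ 2))).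
  { rewrite <- !rsum2_scal, <- !rsum2_minus, <- !rsum2_plus, <- !rsum2_minus, <- !rsum2_plus.
    apply rsum2_le. intros i k Hi Hk.
    assert (HL := local_dissipation M gam tau dl c c0 Rg (xd t i k) (bb t i k)
      (fun j => zd t j i k) (fun j => ff t j i k) Hgam Htau Hdl Htaudl Htaugam HRg (Rlt_le _ _ (proj2 Hc0c)) (Rlt_le _ _ (proj1 Hc0c)) Hmargin).
    unfold loc, It, kb. lra. }
  lra.
Qed.
End AtTime.
End Reference.

Hypothesis Hn : (0 < n)%nat.
Hypothesis Hlap_left : forall u, rsum n (fun i => h i * Lap u i) = 0.
Hypothesis Hlap_const : forall s i, (i < n)%nat -> Lap (fun _ => s) i = 0.
Hypothesis Hhw : forall t k, 0 < t -> (k < q)%nat -> rsum n (fun i => h i * w t i k) = 0.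
Hypothesis Hxs : resource_constraint n q xs d.

Lemma lapv_plus u u' i k : lapv (fun i k => u i k + u' i k) i k = lapv u i k + lapv u' i k.
Proof. unfold lapv, mulv. rewrite <- rsum_plus. apply rsum_ext; intros; ring. Qed.

Lemma lapv_scal s u i k : lapv (fun i k => s * u i k) i k = s * lapv u i k.
Proof. unfold lapv, mulv. rewrite <- rsum_scal. apply rsum_ext; intros; ring. Qed.

Lemma lapv_ext u u' i k : (forall j, (j < n)%nat -> u j k = u' j k) -> lapv u i k = lapv u' i k.
Proof. intros H. apply mulv_eq. auto. Qed.

(** [w + dw/dt] minus [- / h * (xs - d)], its value at an equilibrium with [x = xs]. *)
Definition om1 t i k := w t i k + alpha * lapv (v t) i k + / h i * (xs i k - d i k).
Definition PP t i k := v t i k + vd t i k.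

Lemma om1_deriv t i k : 0 < t -> (i < n)%nat -> (k < q)%nat ->
  D (fun s => om1 s i k) t (alpha * lapv (PP t) i k).
Proof.
  intros Ht Hi Hk. unfold om1, PP. eapply dl_eq.
  - apply dl_plus; [apply dl_plus|apply dl_const]; [now apply Hw|].
    apply dl_scal, (lapv_deriv t v (vd t)). intros; now apply Hv.
  - rewrite lapv_plus. ring.
Qed.

(** [h] annihilates the Laplacian, [w] has zero [h]-mean, and [xs] and [d] have equal totals. *)
Lemma om1_sum t k : 0 < t -> (k < q)%nat -> rsum n (fun i => h i * om1 t i k) = 0.
Proof.
  intros Ht Hk. unfold om1.
  rewrite (rsum_ext n _ (fun i => h i * w t i k + alpha * (h i * Lap (fun j => v t j k) i) + (xs i k - d i k))).
  - rewrite !rsum_plus, rsum_scal, rsum_minus, Hlap_left, (Hxs k Hk), Hhw by auto. ring.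
  - intros i Hi. unfold lapv. field. generalize (Hh_pos i Hi); lra.
Qed.

Lemma PP_balance t i k : (i < n)%nat ->
  h i * (vdd t i k + vd t i k)
  = - (xi t i k + xd t i k) - alpha * (h i * lapv (PP t) i k) - h i * om1 t i k.
Proof.
  intros Hi. unfold PP. rewrite lapv_plus. unfold vdd, om1, xi.
  set (lv := lapv (v t) i k). set (lvd := lapv (vd t) i k).
  unfold vd. fold lv. field. generalize (Hh_pos i Hi); lra.
Qed.

(** A value of [dl] that the margin permits when [tau = 0]. *)
Definition dl0 := Rmin (1 / 4) ((c0 / 2 - (1 + gam) * INR M / 4 - Rg)
  / (INR M * (8 + 8 / gam) + 8 + 8 * Rg + 4 * ((1 + gam) * INR M / 4) + 2 * c0)).

Lemma budget_pos : 0 < INR M * (8 + 8 / gam) + 8 + 8 * Rg + 4 * ((1 + gam) * INR M / 4) + 2 * c0.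
Proof.
  assert (HM := pos_INR M).
  assert (0 < 8 / gam) by (apply Rdiv_lt_0_compat; lra).
  assert (0 <= INR M * (8 + 8 / gam)) by (apply Rmult_le_pos; lra).
  assert (0 <= (1 + gam) * INR M) by (apply Rmult_le_pos; lra). lra.
Qed.

Lemma dl0_spec : 0 < dl0 <= 1 / 4 /\
  dl0 * (INR M * (8 + 8 / gam) + 8 + 8 * Rg + 4 * ((1 + gam) * INR M / 4) + 2 * c0)
  <= c0 / 2 - (1 + gam) * INR M / 4 - Rg.
Proof.
  assert (HB := budget_pos). set (B := INR M * (8 + 8 / gam) + 8 + 8 * Rg + 4 * ((1 + gam) * INR M / 4) + 2 * c0) in *.
  unfold dl0. fold B. set (m := c0 / 2 - (1 + gam) * INR M / 4 - Rg) in *.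
  split; [split; [apply Rmin_glb_lt; [lra|now apply Rdiv_lt_0_compat]|apply Rmin_l]|].
  apply Rle_trans with (m / B * B); [apply Rmult_le_compat_r; [lra|apply Rmin_r]|right; field; lra].
Qed.

(* Dissipation seen from a fixed reference; [gap] is the Fenchel gap, i.e. the distance of the
   current subgradients to dual optimality. *)
Definition diss t :=
  gap t + S2 (fun i k => xd t i k ^ 2 + xi t i k ^ 2 + rsum M (fun j => zd t j i k ^ 2))
  + S2 (fun i k => (PP t i k - rsum n (fun i' => PP t i' k) / INR n) ^ 2 + om1 t i k ^ 2).

(** The fraction [c0 / c] of [gap] pays for the term in [bb ^ 2] of [energy_rate]; what is left of
    it, with [dl0] and [kap], is guaranteed dissipation. The constant involves no dual reference. *)
Definition k1 := Rmin (1 - c0 / c) (Rmin dl0 kap).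

Lemma k1_spec : 0 < k1 /\ k1 <= 1 - c0 / c /\ k1 <= dl0 /\ k1 <= kap.
Proof.
  destruct dl0_spec as [H _].
  assert (0 < 1 - c0 / c).
  { assert (c0 / c < 1); [|lra]. apply Rmult_lt_reg_r with c; [lra|].
    unfold Rdiv. rewrite Rmult_assoc, Rinv_l by lra. lra. }
  unfold k1. generalize (Rmin_l (1 - c0 / c) (Rmin dl0 kap)) (Rmin_r (1 - c0 / c) (Rmin dl0 kap))
    (Rmin_l dl0 kap) (Rmin_r dl0 kap). intros.
  split; [apply Rmin_glb_lt; [lra|apply Rmin_glb_lt; lra]|lra].
Qed.

Lemma gap_nonneg t : 0 < t -> 0 <= gap t.
Proof.
  intros Ht. eapply Rle_trans; [|apply gap_lower; auto].
  apply Rmult_le_pos; [lra|]. apply rsum2_nonneg; intros; apply pow2_ge_0.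
Qed.

Lemma psi_sum t :
  rsum n (fun i => gapD t i + rsum (S M) (fun j => Psi t j i))
  = gap t + S2 (fun i k => / 2 * (xi t i k + xd t i k) ^ 2
        + rsum M (fun j => / 2 * (xi t i k + zd t j i k) ^ 2)).
Proof.
  unfold gap, rsum2. rewrite <- rsum_plus. apply rsum_ext. intros i Hi.
  rewrite Rplus_assoc. f_equal. unfold Psi. rewrite rsum_plus. f_equal.
  rewrite (rsum_ext (S M) _ (fun j => rsum q (fun k => / 2 * (ys t j i k - xs i k) ^ 2)))
    by (intros; now rewrite rsum_scal).
  rewrite rsum_swap. apply rsum_ext. intros k Hk. cbn [rsum].
  rewrite (rsum_ext M (fun j => / 2 * (ys t j i k - xs i k) ^ 2) (fun j => / 2 * (xi t i k + zd t j i k) ^ 2))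
    by (intros; unfold xi, zd; f_equal; f_equal; ring).
  replace (ys t M i k - xs i k) with (xi t i k + xd t i k) by (unfold xi, xd; ring). ring.
Qed.

Lemma omega0_eq gh t : omega0 gh t = S2 (fun i k => xi t i k * gt gh t i k) - rsum n (fun i => gapD t i).
Proof.
  unfold omega0, rsum2. rewrite <- rsum_minus. apply rsum_ext. intros i _. unfold gapD.
  rewrite (rsum_ext q (fun k => xi t i k * gt gh t i k)
    (fun k => - (gr t i k * (xs i k - x t i k)) - gh t i k * xi t i k)) by (intros; unfold gt, xi; ring).
  rewrite rsum_minus, rsum_opp. ring.
Qed.

(** Convexity is tested at [xs] shifted by 1 and by -1 in direction [k]. The bound stands in for
    boundedness of the trajectory, which is not known beforehand. *)
Lemma gr_bound : exists Cg : nat -> nat -> R, forall t i k, (i < n)%nat -> (k < q)%nat ->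
  Rabs (gr t i k) <= gapD t i + Cg i k.
Proof.
  exists (fun i k => Rabs (f0 i (upd (xs i) k (xs i k + 1)) - f0 i (xs i))
    + Rabs (f0 i (upd (xs i) k (xs i k + - (1))) - f0 i (xs i))).
  intros t i k Hi Hk.
  assert (H : forall s, gapD t i >= f0 i (xs i) - f0 i (upd (xs i) k (xs i k + s)) + gr t i k * s).
  { intros s. set (y := upd (xs i) k (xs i k + s)).
    assert (H := strong_convexity q (f0 i) (g0 i) (hs0 i) c (f0_loc i Hi) (f0_C2 i Hi) (f0_mono i Hi) (x t i) y).
    assert (0 <= c / 2 * rsum q (fun k => (y k - x t i k) ^ 2)).
    { apply Rmult_le_pos; [lra|]. apply rsum_nonneg; intros; apply pow2_ge_0. }
    assert (E : rsum q (fun k => g0 i (x t i) k * (y k - x t i k))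
      = rsum q (fun k => gr t i k * (xs i k - x t i k)) + gr t i k * s).
    { assert (E1 : rsum q (fun k' => gr t i k' * (y k' - xs i k')) = gr t i k * s).
      { rewrite (rsum_single q _ k); auto.
        - unfold y, upd. rewrite Nat.eqb_refl. ring.
        - intros k' _ Hk'. unfold y, upd. destruct (Nat.eqb_spec k' k); [contradiction|ring]. }
      rewrite <- E1, <- rsum_plus. apply rsum_ext; intros; unfold gr; ring. }
    unfold gapD. lra. }
  assert (H1 := H 1). assert (H2 := H (- (1))).
  set (A := f0 i (upd (xs i) k (xs i k + 1)) - f0 i (xs i)) in *.
  set (B := f0 i (upd (xs i) k (xs i k + - (1))) - f0 i (xs i)) in *.
  generalize (Rle_abs A) (Rle_abs B) (Rabs_pos A) (Rabs_pos B). intros.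
  apply Rabs_le. unfold A, B in *. lra.
Qed.

(** * Fixed dual references *)

Section FixedReference.
Variables (sh : nat -> nat -> nat -> R) (vh0 : nat -> R) (eps : R).
Hypothesis Hdual : forall u, dom n (S M) fj u ->
  cost n (S M) f0 fj (fun _ => xs) - eps
    + rsum n (fun i => rsum q (fun k => vh0 k * (u 0%nat i k - xs i k)
        + rsum (S M) (fun j => sh j i k * (u (S j) i k - u 0%nat i k)))) <= cost n (S M) f0 fj u.

Definition fxh (t : R) := xs.
(** Chosen so that the formulas of [ss], taken at rest, return the multipliers: [- gam * fzh] is
    [sh j] for [j < M], and [fgh] makes the last one [sh M]. The multiplier [vh0] is common to all
    agents, so the Laplacian annihilates it. *)
Definition fzh (t : R) j i k := - sh j i k / gam.
Definition fvh (t : R) (i k : nat) := vh0 k.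
Definition fgh (t : R) i k := vh0 k + gam * rsum M (fun j => fzh t j i k) - sh M i k.

Definition fenergy := energy 0 fxh fvh fgh fzh om1.

(** The supply is the linear form of the actual subgradients minus that of the certificate. The
    former equals [gap] plus the difference of costs; the certificate, evaluated at [x] and the
    proximal points, bounds the latter by this difference plus [eps]. *)
Lemma fixed_pairing t : 0 < t -> gap t - eps <= S2 (pairing 0 fxh fvh fgh fzh t).
Proof.
  intros Ht.
  set (u := fun j => match j with O => x t | S j' => ys t j' end).
  assert (Hdm : dom n (S M) fj u) by (intros i j Hi Hj; apply ys_fin; auto; lia).
  assert (Hd := Hdual u Hdm).
  assert (HP : S2 (pairing 0 fxh fvh fgh fzh t)
    = S2 (fun i k => xi t i k * gr t i k + rsum (S M) (fun j => ss t j i k * (ys t j i k - xs i k)))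
      - S2 (fun i k => vh0 k * (x t i k - xs i k) + rsum (S M) (fun j => sh j i k * (ys t j i k - x t i k)))).
  { rewrite <- rsum2_minus. apply rsum2_ext. intros i k Hi Hk.
    cbn [rsum]. rewrite ss_last.
    rewrite (rsum_ext M (fun j => ss t j i k * (ys t j i k - xs i k))
       (fun j => (- gam * z t j i k - zd t j i k) * (xi t i k + zd t j i k)))
      by (intros j Hj; rewrite ss_lt by auto; unfold xi, zd; ring).
    rewrite (rsum_ext M (fun j => sh j i k * (ys t j i k - x t i k))
       (fun j => - gam * fzh t j i k * zd t j i k))
      by (intros j Hj; unfold fzh, zd; field; lra).
    unfold pairing, gt, fgh, fvh, vt, ff, bb, fxh.
    rewrite (rsum_minus M (fun j => z t j i k)).
    set (zh := fun j => fzh t j i k).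
    rewrite (rsum_ext M (fun j => (xi t i k + zd t j i k) * (- gam * (z t j i k - fzh t j i k) - (zd t j i k - 0 * (z t j i k - fzh t j i k))))
      (fun j => (- gam * z t j i k - zd t j i k) * (xi t i k + zd t j i k)
        - (- gam * fzh t j i k * zd t j i k) + gam * xi t i k * zh j)) by (intros; unfold zh; ring).
    rewrite rsum_plus, rsum_minus, rsum_scal.
    assert (Hxd : ys t M i k = x t i k + xd t i k) by (unfold xd; ring). rewrite Hxd.
    fold zh. unfold xi. ring. }
  assert (HG : S2 (fun i k => xi t i k * gr t i k + rsum (S M) (fun j => ss t j i k * (ys t j i k - xs i k)))
    = gap t + cost n (S M) f0 fj u - cost n (S M) f0 fj (fun _ => xs)).
  { unfold rsum2, gap, cost. rewrite <- rsum_plus, <- rsum_minus. apply rsum_ext. intros i Hi.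
    rewrite rsum_plus. unfold gapD. unfold u at 1.
    rewrite (rsum_swap q (S M) (fun k j => ss t j i k * (ys t j i k - xs i k))).
    assert (E1 : rsum q (fun k => xi t i k * gr t i k) = - rsum q (fun k => gr t i k * (xs i k - x t i k))).
    { rewrite <- rsum_opp.
      apply rsum_ext; intros; unfold xi; ring. }
    rewrite E1.
    assert (E2 : rsum (S M) (fun j => rsum q (fun k => ss t j i k * (ys t j i k - xs i k)))
      = rsum (S M) (fun j => gapG t j i) + rsum (S M) (fun j => erval (fj i (S j) (u (S j) i)))
        - rsum (S M) (fun j => erval (fj i (S j) (xs i)))).
    { rewrite <- rsum_plus, <- rsum_minus. apply rsum_ext. intros j Hj. unfold gapG, u.
      rewrite (rsum_ext q (fun k => ss t j i k * (xs i k - ys t j i k)) (fun k => -1 * (ss t j i k * (ys t j i k - xs i k))))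
        by (intros; ring).
      rewrite rsum_scal. ring. }
    rewrite E2. ring. }
  rewrite HP, HG. unfold rsum2. cbn [u] in Hd. lra.
Qed.

Lemma fixed_rate t : 0 < t -> exists l, D fenergy t l /\ l <= eps - k1 * diss t.
Proof.
  intros Ht. destruct dl0_spec as [Hdl1 Hdl2].
  assert (HNP : forall s i k, NN 0 fvh s i k = PP s i k + - vh0 k).
  { intros. unfold NN, vt, PP, fvh. ring. }
  assert (Hlap : forall s i k, (i < n)%nat -> lapv (NN 0 fvh s) i k = lapv (PP s) i k).
  { intros s i k Hi. unfold lapv.
    rewrite (mulv_eq n (lap n a) (fun j => NN 0 fvh s j k) (fun j => PP s j k + - vh0 k) i)
      by (intros; apply HNP).
    assert (H := lapv_plus (PP s) (fun _ k => - vh0 k) i k). unfold lapv in H. rewrite H, Hlap_const by auto. ring. }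
  destruct (energy_rate 0 dl0 fxh fvh fgh fzh om1) with (t := t) as [l [Hl1 Hl2]]; auto; try lra.
  - intros i k Hi Hk. eapply dl_eq; [exact (dl_const (fxh 0 i k) t)|ring].
  - intros j i k Hj Hi Hk. eapply dl_eq; [exact (dl_const (fzh 0 j i k) t)|ring].
  - intros i k Hi Hk. eapply dl_eq; [exact (dl_const (fvh 0 i k) t)|ring].
  - intros i k Hi Hk. eapply dl_eq; [exact (dl_const (fgh 0 i k) t)|ring].
  - intros i k Hi Hk. rewrite Hlap by auto. now apply om1_deriv.
  - intros k Hk. now apply om1_sum.
  - intros i k Hi Hk. rewrite Hlap by auto. assert (H := PP_balance t i k Hi).
    unfold NNd, It, bb, fxh. unfold xi in H.
    replace (vdd t i k + (1 - 0) * (vd t i k - 0 * vt fvh t i k)) with (vdd t i k + vd t i k) by ring.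
    rewrite H. ring.
  - exists l. split; [exact Hl1|].
    assert (HP := fixed_pairing t Ht).
    assert (HI : S2 (fun i k => NN 0 fvh t i k * Ih 0 fxh t i k) = 0).
    { unfold rsum2. rewrite (rsum_ext n _ (fun _ => 0)); [rewrite rsum_const; ring|].
      intros i _. rewrite (rsum_ext q _ (fun _ => 0)); [rewrite rsum_const; ring|].
      intros; unfold Ih, fxh; ring. }
    rewrite HI in Hl2.
    rewrite (rsum2_ext n q (fun i k => (NN 0 fvh t i k - _) ^ 2 + om1 t i k ^ 2)
       (fun i k => (PP t i k - rsum n (fun i' => PP t i' k) / INR n) ^ 2 + om1 t i k ^ 2)) in Hl2.
    2: { intros i k Hi Hk. do 2 f_equal. rewrite HNP.
         rewrite (rsum_ext n (fun i' => NN 0 fvh t i' k) (fun i' => PP t i' k + - vh0 k)) by (intros; apply HNP).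
         rewrite rsum_plus, rsum_const. field. apply not_0_INR; lia. }
    assert (Hg := gap_lower t Ht). assert (Hg0 := gap_nonneg t Ht).
    destruct k1_spec as [Hk0 [Hk1 [Hk2 Hk3]]].
    set (X2 := S2 (fun i k => xi t i k ^ 2)) in *.
    change (S2 (fun i k => bb fxh t i k ^ 2)) with X2 in Hl2.
    change (S2 (fun i k => xd t i k ^ 2 + bb fxh t i k ^ 2 + rsum M (fun j => zd t j i k ^ 2)))
      with (S2 (fun i k => xd t i k ^ 2 + xi t i k ^ 2 + rsum M (fun j => zd t j i k ^ 2))) in Hl2.
    unfold diss.
    set (T1 := S2 (fun i k => xd t i k ^ 2 + xi t i k ^ 2 + rsum M (fun j => zd t j i k ^ 2))) in *.
    set (T2 := S2 (fun i k => (PP t i k - rsum n (fun i' => PP t i' k) / INR n) ^ 2 + om1 t i k ^ 2)) in *.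
    assert (HT1 : 0 <= T1).
    { apply rsum2_nonneg; intros. repeat apply Rplus_le_le_0_compat; try apply pow2_ge_0.
      apply rsum_nonneg; intros; apply pow2_ge_0. }
    assert (HT2 : 0 <= T2) by (apply rsum2_nonneg; intros; apply Rplus_le_le_0_compat; apply pow2_ge_0).
    assert (k1 * T1 <= dl0 * T1) by (apply Rmult_le_compat_r; lra).
    assert (k1 * T2 <= kap * T2) by (apply Rmult_le_compat_r; lra).
    assert (k1 * gap t <= (1 - c0 / c) * gap t) by (apply Rmult_le_compat_r; lra).
    assert (c0 / 2 * X2 <= c0 / c * gap t).
    { replace (c0 / 2 * X2) with (c0 / c * (c / 2 * X2)) by (field; lra).
      apply Rmult_le_compat_l; [|lra]. apply Rlt_le, Rdiv_lt_0_compat; lra. }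
    lra.
Qed.

(** The remaining squares are dropped or completed, and [xi ^ 2] is left with total coefficient
    [A > 0]; the bound is the minimum of the resulting quadratic. It depends on the certificate,
    unlike the coefficient of [diss] in [fixed_rate]. *)
Lemma fixed_bounded_below : exists B, forall t, 0 < t -> B <= fenergy t.
Proof.
  set (A := c - (1 + gam) * INR M / 4 - Rg).
  assert (HA : 0 < A) by (unfold A; lra).
  exists (S2 (fun i k => - (g0 i (xs i) k - fgh 0 i k) ^ 2 / (4 * A))). intros t Ht.
  unfold fenergy, energy.
  assert (H1 : S2 (fun i k => c / 2 * xi t i k ^ 2 + (/ 2 * (xi t i k + xd t i k) ^ 2
        + rsum M (fun j => / 2 * (xi t i k + zd t j i k) ^ 2)))
     <= rsum n (fun i => gapD t i + rsum (S M) (fun j => Psi t j i))).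
  { rewrite psi_sum, rsum2_plus, rsum2_scal. generalize (gap_lower t Ht). lra. }
  assert (H2 : S2 (fun i k => (g0 i (xs i) k - fgh 0 i k) * xi t i k + c / 2 * xi t i k ^ 2) <= omega0 fgh t).
  { unfold omega0, rsum2. apply rsum_le. intros i Hi.
    assert (H := strong_convexity q (f0 i) (g0 i) (hs0 i) c (f0_loc i Hi) (f0_C2 i Hi) (f0_mono i Hi) (xs i) (x t i)).
    rewrite (rsum_ext q _ (fun k => g0 i (xs i) k * (x t i k - xs i k) - fgh t i k * xi t i k + c / 2 * (x t i k - xs i k) ^ 2))
      by (intros; unfold xi, fgh, fzh; ring).
    rewrite rsum_plus, rsum_minus, rsum_scal. lra. }
  assert (H3 : 0 <= S2 (gstore 0 fvh om1 t)).
  { apply rsum2_nonneg. intros i k Hi Hk. unfold gstore. apply Rmult_le_pos; [generalize (Hh_pos i Hi); lra|].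
    apply Rplus_le_le_0_compat; apply Rmult_le_pos; try apply pow2_ge_0; lra. }
  assert (H4 : S2 (fun i k => - (g0 i (xs i) k - fgh 0 i k) ^ 2 / (4 * A))
    <= S2 (fun i k => c / 2 * xi t i k ^ 2 + (/ 2 * (xi t i k + xd t i k) ^ 2
        + rsum M (fun j => / 2 * (xi t i k + zd t j i k) ^ 2)))
      + - ((INR M + 1) / 2) * S2 (fun i k => xi t i k ^ 2)
      + (S2 (qloc 0 fxh fzh t) + S2 (fun i k => (g0 i (xs i) k - fgh 0 i k) * xi t i k + c / 2 * xi t i k ^ 2))
      + kb * S2 (fun i k => bb fxh t i k ^ 2)).
  { rewrite <- !rsum2_scal, <- !rsum2_plus. apply rsum2_le. intros i k Hi Hk.
    set (e := g0 i (xs i) k - fgh 0 i k). unfold qloc. change (bb fxh t i k) with (xi t i k).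
    set (X := xi t i k). set (a0 := xd t i k).
    assert (Hs : - (gam / 2) * INR M * X ^ 2 <= rsum M (fun j => / 2 * (X + zd t j i k) ^ 2)
       + rsum M (fun j => X * ff fzh t j i k - (1 + gam) * (X * ff fzh t j i k) + (gam - 0) / 2 * ff fzh t j i k ^ 2)).
    { rewrite <- rsum_plus. apply Rle_trans with (rsum M (fun _ => - (gam / 2) * X ^ 2)).
      - rewrite rsum_const. right; ring.
      - apply rsum_le. intros j _. set (f := ff fzh t j i k).
        assert (0 <= gam / 2 * (f - X) ^ 2) by (apply Rmult_le_pos; [lra|apply pow2_ge_0]).
        generalize (pow2_ge_0 (X + zd t j i k)). lra. }
    assert (He : - e ^ 2 / (4 * A) <= e * X + A * X ^ 2).
    { assert (0 <= A * (X + e / (2 * A)) ^ 2) by (apply Rmult_le_pos; [lra|apply pow2_ge_0]).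
      replace (A * (X + e / (2 * A)) ^ 2) with (A * X ^ 2 + e * X + e ^ 2 / (4 * A)) in H by (field; lra).
      unfold Rdiv in *. lra. }
    assert (0 <= (X + a0) ^ 2) by apply pow2_ge_0.
    assert (0 <= (1 - gam) * (INR M * X ^ 2)).
    { apply Rmult_le_pos; [lra|]. apply Rmult_le_pos; [apply pos_INR|apply pow2_ge_0]. }
    assert (HM2 : 0 <= INR M * X ^ 2) by (apply Rmult_le_pos; [apply pos_INR|apply pow2_ge_0]).
    unfold A, kb in *. lra. }
  lra.
Qed.
End FixedReference.

Variables (C1 C2 hstar : R).
Hypothesis Halpha : 0 < alpha.
Hypothesis Hh_sum : rsum n h = 1.
Hypothesis HMc : INR M <= c.
Hypothesis HC1 : 0 <= C1.
Hypothesis HC2 : 0 <= C2.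
Hypothesis Hhs : 0 < hstar.
Hypothesis Hmin : forall i, (i < n)%nat -> hstar <= h i <= 1.
Hypothesis Hdev1 : forall u,
  rsum n (fun i => (u i - rsum n (fun l => h l * u l)) ^ 2) <= C1 * rsum n (fun i => Lap u i ^ 2).
Hypothesis Hdev2 : forall u,
  rsum n (fun i => (u i - rsum n (fun l => h l * u l)) ^ 2)
  <= C2 * rsum n (fun i => (u i - rsum n u / INR n) ^ 2).

Hypothesis dual_certificate : forall eps, 0 < eps -> exists sh vh0, forall u, dom n (S M) fj u ->
  cost n (S M) f0 fj (fun _ => xs) - eps
    + rsum n (fun i => rsum q (fun k => vh0 k * (u 0%nat i k - xs i k)
        + rsum (S M) (fun j => sh j i k * (u (S j) i k - u 0%nat i k)))) <= cost n (S M) f0 fj u.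

(** * Low-pass filtered references *)

(* The references are the trajectory filtered by [d/dt hat = tau (. - hat)]. Since the filter is an
   average over the past and Fenchel gaps are convex along it, the supply dominates [gap - hat gap]. *)
Section LowPass.
Variables (tau : R) (xh vh gh : R -> nat -> nat -> R) (zh : R -> nat -> nat -> nat -> R)
  (Dh : R -> nat -> R) (Gh : R -> nat -> nat -> R).
Hypothesis Htau : 0 < tau <= 1 / 4.
Hypothesis Htaugam : tau <= gam / 2.
Hypothesis Hbud :
  tau * (INR M * (8 + 8 / gam) + 8 + 8 * Rg + 4 * ((1 + gam) * INR M / 4) + 2 * c0)
  <= c0 / 2 - (1 + gam) * INR M / 4 - Rg.
Hypothesis Htaukap : tau * (C1 / (2 * alpha ^ 2)) <= kap.
Hypothesis Hxh : forall t i k, 1 <= t -> (i < n)%nat -> (k < q)%nat ->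
  D (fun s => xh s i k) t (tau * bb xh t i k).
Hypothesis Hzh : forall t j i k, 1 <= t -> (j < M)%nat -> (i < n)%nat -> (k < q)%nat ->
  D (fun s => zh s j i k) t (tau * ff zh t j i k).
Hypothesis Hvh : forall t i k, 1 <= t -> (i < n)%nat -> (k < q)%nat ->
  D (fun s => vh s i k) t (tau * vt vh t i k).
Hypothesis Hgh : forall t i k, 1 <= t -> (i < n)%nat -> (k < q)%nat ->
  D (fun s => gh s i k) t (tau * gt gh t i k).
Hypothesis HDh : forall t i, 1 <= t -> (i < n)%nat ->
  D (fun s => Dh s i) t (tau * (gapD t i - Dh t i)).
Hypothesis HGh : forall t j i, 1 <= t -> (j <= M)%nat -> (i < n)%nat ->
  D (fun s => Gh s j i) t (tau * (gapG t j i - Gh t j i)).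

(** The formula of [ss] with every velocity replaced by that of the filtered variable; by linearity
    it is a filter of [ss]. *)
Definition sref t j i k :=
  if Nat.eqb j M then - gh t i k - tau * bb xh t i k + vh t i k + gam * rsum M (fun j' => zh t j' i k)
  else - gam * zh t j i k - tau * ff zh t j i k.
Definition PH t i k := vh t i k + tau * vt vh t i k.
(** The value of [om1] with which the filtered variables satisfy [PP_balance]; by linearity it is a
    filter of [om1]. *)
Definition oh t i k := - / h i * Ih tau xh t i k - alpha * lapv (PH t) i k - tau * NN tau vh t i k.
Definition om2 t i k := om1 t i k - oh t i k.

(** The comparisons along the filters start from equality at time 1. Only the divergences [Dh] start
    higher, because [xh] does not start at [x]: its initial value has to satisfy [init_o]. *)
Hypothesis init_s : forall j i k, (j <= M)%nat -> (i < n)%nat -> (k < q)%nat -> sref 1 j i k = ss 1 j i k.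
Hypothesis init_g : forall i k, (i < n)%nat -> (k < q)%nat -> gh 1 i k = gr 1 i k.
Hypothesis init_G : forall j i, (j <= M)%nat -> (i < n)%nat -> Gh 1 j i = gapG 1 j i.
Hypothesis init_D : forall i, (i < n)%nat ->
  gapD 1 i + c0 / 2 * (c / (c - c0)) * rsum q (fun k => (x 1 i k - xh 1 i k) ^ 2) <= Dh 1 i.
Hypothesis init_D' : forall i, (i < n)%nat -> c0 / 2 * rsum q (fun k => (xh 1 i k - xs i k) ^ 2) <= Dh 1 i.
Hypothesis init_o : forall i k, (i < n)%nat -> (k < q)%nat -> alpha * lapv (PH 1) i k = tau * om2 1 i k.

Lemma sref_deriv t j i k : 1 <= t -> (j <= M)%nat -> (i < n)%nat -> (k < q)%nat ->
  D (fun s => sref s j i k) t (tau * (ss t j i k - sref t j i k)).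
Proof.
  intros Ht Hj Hi Hk. assert (Ht0 : 0 < t) by lra. unfold sref.
  destruct (Nat.eqb_spec j M) as [->|Hne].
  - rewrite ss_last. eapply dl_eq.
    + apply dl_plus; [apply dl_plus; [apply dl_minus|]|].
      * apply dl_opp. now apply Hgh.
      * apply dl_scal, dl_minus; [now apply Hx|now apply Hxh].
      * now apply Hvh.
      * apply dl_scal, (dl_rsum M (fun s j' => zh s j' i k)). intros; now apply Hzh.
    + rewrite rsum_scal. unfold ff, gt, vt, bb. rewrite (rsum_minus M (fun j => z t j i k)). ring.
  - rewrite ss_lt by lia. eapply dl_eq.
    + apply dl_minus; apply dl_scal; [apply Hzh|apply dl_minus; [apply Hz|apply Hzh]]; auto; lia.
    + unfold ff. ring.
Qed.

(** For fixed [t], the gap at time [s] lies above its tangent at time [t] by convexity in [ss].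
    Filtering in [s] preserves this, the tangent being affine, and the result is read at [s = t]. *)
Lemma filtered_gapG t j i : 1 <= t -> (j <= M)%nat -> (i < n)%nat ->
  gapG t j i - Gh t j i <= rsum q (fun k => (ys t j i k - xs i k) * (ss t j i k - sref t j i k)).
Proof.
  intros Ht Hj Hi.
  set (phi := fun s => Gh s j i - gapG t j i + rsum q (fun k => (ys t j i k - xs i k) * (ss t j i k - sref s j i k))).
  assert (Hsub : forall s, 0 < s ->
    gapG t j i + rsum q (fun k => (ys t j i k - xs i k) * (ss s j i k - ss t j i k)) <= gapG s j i).
  { intros s Hs. unfold gapG.
    assert (H := ys_sub s j i (ys t j i) Hs Hj Hi (ys_fin t j i ltac:(lra) Hj Hi)).
    assert (E : rsum q (fun k => ss s j i k * (ys t j i k - ys s j i k))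
      = - rsum q (fun k => ss s j i k * (xs i k - ys t j i k)) + rsum q (fun k => ss s j i k * (xs i k - ys s j i k))).
    { rewrite <- rsum_opp, <- rsum_plus.
      apply rsum_ext; intros; ring. }
    assert (E2 : rsum q (fun k => (ys t j i k - xs i k) * (ss s j i k - ss t j i k))
      = - rsum q (fun k => ss s j i k * (xs i k - ys t j i k)) + rsum q (fun k => ss t j i k * (xs i k - ys t j i k))).
    { rewrite <- rsum_opp, <- rsum_plus.
      apply rsum_ext; intros; ring. }
    lra. }
  assert (Hphi : 0 <= phi t).
  { apply (filter_nonneg phi tau 1); [| |exact Ht].
    - intros s Hs. eexists. split.
      + apply dl_plus; [apply dl_minus; [now apply HGh|apply dl_const]|].
        apply (dl_rsum q (fun s k => (ys t j i k - xs i k) * (ss t j i k - sref s j i k))).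
        intros k Hk. apply dl_scal, dl_minus; [apply dl_const|now apply sref_deriv].
      + assert (H := Hsub s ltac:(lra)). unfold phi.
        assert (E : rsum q (fun k => (ys t j i k - xs i k) * (0 - tau * (ss s j i k - sref s j i k)))
          = tau * - (rsum q (fun k => (ys t j i k - xs i k) * (ss s j i k - ss t j i k))
             + rsum q (fun k => (ys t j i k - xs i k) * (ss t j i k - sref s j i k)))).
        { rewrite <- rsum_plus, <- rsum_opp, <- rsum_scal.
          apply rsum_ext; intros; ring. }
        rewrite E.
        assert (0 <= tau * (gapG s j i - (gapG t j i + rsum q (fun k => (ys t j i k - xs i k) * (ss s j i k - ss t j i k)))))
          by (apply Rmult_le_pos; lra). lra.
    - unfold phi. rewrite init_G by auto. assert (H := Hsub 1 ltac:(lra)).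
      assert (E : rsum q (fun k => (ys t j i k - xs i k) * (ss t j i k - sref 1 j i k))
         = - rsum q (fun k => (ys t j i k - xs i k) * (ss 1 j i k - ss t j i k))).
      { rewrite <- rsum_opp.
        apply rsum_ext; intros k Hk. rewrite init_s by auto. ring. }
      lra. }
  unfold phi in Hphi. lra.
Qed.

(** The tangent argument again, now with the surplus of strong convexity: the filter in [s] of
    [(x t - x s) ^ 2] dominates [(x t - xh) ^ 2] by Jensen's inequality. Using [c0 < c] leaves room
    for the mismatch of [xh] and [x] at time 1. *)
Lemma filtered_gapD t i : 1 <= t -> (i < n)%nat ->
  gapD t i - Dh t i + c0 / 2 * rsum q (fun k => bb xh t i k ^ 2)
  <= rsum q (fun k => xi t i k * gt gh t i k).
Proof.
  intros Ht Hi.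
  set (Q := fun s => rsum q (fun k => (x t i k - xh s i k) ^ 2)).
  set (phi := fun s => Dh s i - gapD t i + rsum q (fun k => xi t i k * (gr t i k - gh s i k)) - c0 / 2 * Q s).
  assert (Hsc : forall s, gapD t i + rsum q (fun k => xi t i k * (gr s i k - gr t i k))
     + c / 2 * rsum q (fun k => (x t i k - x s i k) ^ 2) <= gapD s i).
  { intros s.
    assert (H := strong_convexity q (f0 i) (g0 i) (hs0 i) c (f0_loc i Hi) (f0_C2 i Hi) (f0_mono i Hi) (x s i) (x t i)).
    fold (gr s i) in H. unfold gapD.
    assert (E : rsum q (fun k => xi t i k * (gr s i k - gr t i k))
       = rsum q (fun k => gr t i k * (xs i k - x t i k)) - rsum q (fun k => gr s i k * (xs i k - x s i k))
         + rsum q (fun k => g0 i (x s i) k * (x t i k - x s i k))).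
    { rewrite <- rsum_minus, <- rsum_plus. apply rsum_ext; intros; unfold xi, gr; ring. }
    lra. }
  assert (Hphi : 0 <= phi t).
  { apply (filter_nonneg phi tau 1); [| |exact Ht].
    - intros s Hs. eexists. split.
      + apply dl_minus; [apply dl_plus; [apply dl_minus; [now apply HDh|apply dl_const]|]|].
        * apply (dl_rsum q (fun s k => xi t i k * (gr t i k - gh s i k))).
          intros k Hk. apply dl_scal, dl_minus; [apply dl_const|now apply Hgh].
        * apply dl_scal, (dl_rsum q (fun s k => (x t i k - xh s i k) ^ 2)). intros k Hk.
          apply dl_sq, dl_minus; [apply dl_const|now apply Hxh].
      + assert (H := Hsc s). unfold phi.
        assert (E : rsum q (fun k => xi t i k * (0 - tau * gt gh s i k))
          = tau * - (rsum q (fun k => xi t i k * (gr s i k - gr t i k))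
             + rsum q (fun k => xi t i k * (gr t i k - gh s i k)))).
        { rewrite <- rsum_plus, <- rsum_opp, <- rsum_scal.
          apply rsum_ext; intros; unfold gt; ring. }
        rewrite E.
        assert (E2 : rsum q (fun k => 2 * ((x t i k - xh s i k) * (0 - tau * bb xh s i k)))
           <= tau * (rsum q (fun k => (x t i k - x s i k) ^ 2) - Q s)).
        { unfold Q. rewrite <- rsum_minus, <- rsum_scal. apply rsum_le. intros k _. unfold bb.
          assert (0 <= tau * (x s i k - xh s i k) ^ 2) by (apply Rmult_le_pos; [lra|apply pow2_ge_0]). lra. }
        set (X := rsum q (fun k => (x t i k - x s i k) ^ 2)) in *.
        assert (HX : 0 <= X) by (apply rsum_nonneg; intros; apply pow2_ge_0).
        assert (c0 / 2 * X <= c / 2 * X) by (apply Rmult_le_compat_r; lra).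
        assert (c0 / 2 * rsum q (fun k => 2 * ((x t i k - xh s i k) * (0 - tau * bb xh s i k)))
          <= c0 / 2 * (tau * (X - Q s))) by (apply Rmult_le_compat_l; lra).
        assert (0 <= tau * (gapD s i - (gapD t i + rsum q (fun k => xi t i k * (gr s i k - gr t i k)) + c0 / 2 * X)))
          by (apply Rmult_le_pos; lra). lra.
    - unfold phi. assert (H := Hsc 1). assert (HD := init_D i Hi).
      assert (E : rsum q (fun k => xi t i k * (gr t i k - gh 1 i k))
         = - rsum q (fun k => xi t i k * (gr 1 i k - gr t i k))).
      { rewrite <- rsum_opp.
        apply rsum_ext; intros k Hk. rewrite init_g by auto. ring. }
      assert (HQ : c0 / 2 * Q 1 <= c / 2 * rsum q (fun k => (x t i k - x 1 i k) ^ 2)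
         + c0 / 2 * (c / (c - c0)) * rsum q (fun k => (x 1 i k - xh 1 i k) ^ 2)).
      { unfold Q. rewrite <- !rsum_scal, <- rsum_plus. apply rsum_le. intros k _.
        set (A := x t i k - x 1 i k). set (B := x 1 i k - xh 1 i k).
        replace (x t i k - xh 1 i k) with (A + B) by (unfold A, B; ring).
        (* Young's inequality with the weight that keeps [c / 2] in front of [A ^ 2]; its price is
           the extra term in [init_D]. *)
        assert (0 <= / (2 * (c - c0)) * ((c - c0) * A - c0 * B) ^ 2).
        { apply Rmult_le_pos; [apply Rlt_le, Rinv_0_lt_compat; lra|apply pow2_ge_0]. }
        replace (/ (2 * (c - c0)) * ((c - c0) * A - c0 * B) ^ 2)
          with (c / 2 * A ^ 2 + c0 / 2 * (c / (c - c0)) * B ^ 2 - c0 / 2 * (A + B) ^ 2) in H0 by (field; lra).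
        lra. }
      lra. }
  unfold phi, Q in Hphi. unfold gt, bb. lra.
Qed.

Lemma Gh_nonneg t j i : 1 <= t -> (j <= M)%nat -> (i < n)%nat -> 0 <= Gh t j i.
Proof.
  intros Ht Hj Hi. apply (filter_nonneg (fun s => Gh s j i) tau 1); auto.
  - intros s Hs. eexists. split; [now apply HGh|].
    assert (0 <= tau * gapG s j i) by (apply Rmult_le_pos; [lra|apply gapG_nonneg; auto; lra]). lra.
  - rewrite init_G by auto. apply gapG_nonneg; auto; lra.
Qed.

Lemma Dh_lower t i : 1 <= t -> (i < n)%nat -> c0 / 2 * rsum q (fun k => (xh t i k - xs i k) ^ 2) <= Dh t i.
Proof.
  intros Ht Hi.
  assert (H : 0 <= Dh t i - c0 / 2 * rsum q (fun k => (xh t i k - xs i k) ^ 2)); [|lra].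
  apply (filter_nonneg (fun s => Dh s i - c0 / 2 * rsum q (fun k => (xh s i k - xs i k) ^ 2)) tau 1); auto.
  - intros s Hs. eexists. split.
    + apply dl_minus; [now apply HDh|]. apply dl_scal, (dl_rsum q (fun s k => (xh s i k - xs i k) ^ 2)).
      intros k Hk. apply dl_sq, dl_minus; [now apply Hxh|apply dl_const].
    + assert (HD := gapD_lower s i Hi).
      assert (HX : 0 <= rsum q (fun k => xi s i k ^ 2)) by (apply rsum_nonneg; intros; apply pow2_ge_0).
      assert (c0 / 2 * rsum q (fun k => xi s i k ^ 2) <= c / 2 * rsum q (fun k => xi s i k ^ 2))
        by (apply Rmult_le_compat_r; lra).
      assert (E2 : rsum q (fun k => 2 * ((xh s i k - xs i k) * (tau * bb xh s i k - 0)))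
           <= tau * (rsum q (fun k => xi s i k ^ 2) - rsum q (fun k => (xh s i k - xs i k) ^ 2))).
      { rewrite <- rsum_minus, <- rsum_scal. apply rsum_le. intros k _. unfold bb, xi.
        assert (0 <= tau * (x s i k - xh s i k) ^ 2) by (apply Rmult_le_pos; [lra|apply pow2_ge_0]). lra. }
      set (X := rsum q (fun k => xi s i k ^ 2)) in *.
      assert (c0 / 2 * rsum q (fun k => 2 * ((xh s i k - xs i k) * (tau * bb xh s i k - 0)))
        <= c0 / 2 * (tau * (X - rsum q (fun k => (xh s i k - xs i k) ^ 2)))) by (apply Rmult_le_compat_l; lra).
      assert (0 <= tau * (gapD s i - c0 / 2 * X)) by (apply Rmult_le_pos; lra). lra.
  - generalize (init_D' i Hi). lra.
Qed.

Lemma NN_PH t i k : NN tau vh t i k = PP t i k - PH t i k.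
Proof. unfold NN, PP, PH, vt. ring. Qed.

Lemma lapv_NN t i k : lapv (NN tau vh t) i k = lapv (PP t) i k - lapv (PH t) i k.
Proof.
  assert (H := lapv_plus (NN tau vh t) (PH t) i k).
  rewrite <- (lapv_ext (PP t)) in H by (intros; rewrite NN_PH; ring). lra.
Qed.

Lemma PH_deriv t i k : 1 <= t -> (i < n)%nat -> (k < q)%nat ->
  D (fun s => PH s i k) t (tau * NN tau vh t i k).
Proof.
  intros Ht Hi Hk. assert (Ht0 : 0 < t) by lra. unfold PH. eapply dl_eq.
  - apply dl_plus; [now apply Hvh|]. apply dl_scal, dl_minus; [now apply Hv|now apply Hvh].
  - unfold NN. ring.
Qed.

Lemma Ih_deriv t i k : 1 <= t -> (i < n)%nat -> (k < q)%nat ->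
  D (fun s => Ih tau xh s i k) t (tau * It tau xh t i k).
Proof.
  intros Ht Hi Hk. assert (Ht0 : 0 < t) by lra. unfold Ih. eapply dl_eq.
  - apply dl_plus; [apply dl_minus; [now apply Hxh|apply dl_const]|].
    apply dl_scal, dl_minus; [now apply Hx|now apply Hxh].
  - unfold It. ring.
Qed.

Lemma NN_balance t i k : (i < n)%nat ->
  h i * NNd tau vh t i k = - It tau xh t i k - alpha * (h i * lapv (NN tau vh t) i k) - h i * om2 t i k.
Proof.
  intros Hi. assert (H := PP_balance t i k Hi). rewrite lapv_NN.
  unfold om2, oh.
  replace (NNd tau vh t i k) with (vdd t i k + vd t i k - tau * NN tau vh t i k) by (unfold NNd, NN; ring).
  rewrite Rmult_minus_distr_l, H.
  replace (xi t i k + xd t i k) with (It tau xh t i k + Ih tau xh t i k) by (unfold It, Ih, xi, bb; ring).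
  field. generalize (Hh_pos i Hi); lra.
Qed.

Lemma oh_deriv t i k : 1 <= t -> (i < n)%nat -> (k < q)%nat -> D (fun s => oh s i k) t (tau * om2 t i k).
Proof.
  intros Ht Hi Hk. assert (Ht0 : 0 < t) by lra. unfold oh. eapply dl_eq.
  - apply dl_minus; [apply dl_minus|].
    + apply dl_scal. now apply Ih_deriv.
    + apply dl_scal, (lapv_deriv t PH (fun i k => tau * NN tau vh t i k)). intros; now apply PH_deriv.
    + apply dl_scal. apply NN_deriv; auto.
  - rewrite lapv_scal. assert (H := NN_balance t i k Hi). assert (Hh := Hh_pos i Hi).
    replace (NNd tau vh t i k) with (/ h i * (h i * NNd tau vh t i k)) by (field; lra).
    rewrite H. field. lra.
Qed.

(** The filtered form of the equation for the rate of [om1]. The defect solves a homogeneous linear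
    equation with initial value 0, and comparison applied to it and to its opposite shows that it
    vanishes. *)
Lemma om2_link t i k : 1 <= t -> (i < n)%nat -> (k < q)%nat -> alpha * lapv (PH t) i k = tau * om2 t i k.
Proof.
  intros Ht Hi Hk.
  assert (Hd : forall s, 1 <= s -> D (fun s => alpha * lapv (PH s) i k - tau * om2 s i k) s
    (- tau * (alpha * lapv (PH s) i k - tau * om2 s i k))).
  { intros s Hs. assert (Hs0 : 0 < s) by lra. eapply dl_eq.
    - apply dl_minus.
      + apply dl_scal, (lapv_deriv s PH (fun i k => tau * NN tau vh s i k)). intros; now apply PH_deriv.
      + apply dl_scal, dl_minus; [now apply om1_deriv|now apply oh_deriv].
    - rewrite lapv_scal, lapv_NN. ring. }
  assert (H0 := init_o i k Hi Hk).
  assert (H1 : 0 <= alpha * lapv (PH t) i k - tau * om2 t i k).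
  { apply (filter_nonneg (fun s => alpha * lapv (PH s) i k - tau * om2 s i k) tau 1); auto; [|lra].
    intros s Hs. eexists. split; [now apply Hd|lra]. }
  assert (H2 : 0 <= - (alpha * lapv (PH t) i k - tau * om2 t i k)).
  { apply (filter_nonneg (fun s => - (alpha * lapv (PH s) i k - tau * om2 s i k)) tau 1); auto; [|lra].
    intros s Hs. eexists. split; [apply dl_opp; now apply Hd|lra]. }
  lra.
Qed.

Lemma om2_deriv t i k : 1 <= t -> (i < n)%nat -> (k < q)%nat ->
  D (fun s => om2 s i k) t (alpha * lapv (NN tau vh t) i k).
Proof.
  intros Ht Hi Hk. assert (Ht0 : 0 < t) by lra. eapply dl_eq.
  - apply dl_minus; [now apply om1_deriv|now apply oh_deriv].
  - rewrite <- om2_link, lapv_NN by auto. ring.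
Qed.

Lemma om2_sum t k : 1 <= t -> (k < q)%nat -> rsum n (fun i => h i * om2 t i k) = 0.
Proof.
  intros Ht Hk. apply Rmult_eq_reg_l with tau; [|lra].
  rewrite <- rsum_scal, (rsum_ext n _ (fun i => alpha * (h i * Lap (fun j => PH t j k) i))).
  - rewrite rsum_scal, Hlap_left. ring.
  - intros i Hi. replace (tau * (h i * om2 t i k)) with (h i * (tau * om2 t i k)) by ring.
    rewrite <- om2_link by auto. unfold lapv. ring.
Qed.

Definition hmean (u : nat -> nat -> R) k := rsum n (fun i => h i * u i k).

(** The definition of [oh] is summed against [h], which annihilates the Laplacian. This controls the
    mean of [NN], which the graph does not dissipate. *)
Lemma NN_hmean t k : 1 <= t -> (k < q)%nat ->
  rsum n (fun i => Ih tau xh t i k) = - tau * hmean (NN tau vh t) k.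
Proof.
  intros Ht Hk. assert (H1 := om2_sum t k Ht Hk). assert (H2 := om1_sum t k ltac:(lra) Hk).
  assert (H : rsum n (fun i => h i * oh t i k) = 0).
  { unfold om2 in H1. rewrite (rsum_ext n _ (fun i => h i * om1 t i k - h i * oh t i k)) in H1 by (intros; ring).
    rewrite rsum_minus in H1. lra. }
  unfold oh in H.
  rewrite (rsum_ext n _ (fun i => - (1) * Ih tau xh t i k - alpha * (h i * Lap (fun j => PH t j k) i) - tau * (h i * NN tau vh t i k))) in H.
  - rewrite !rsum_minus, !rsum_scal, Hlap_left in H. unfold hmean. lra.
  - intros i Hi. unfold lapv. field. generalize (Hh_pos i Hi); lra.
Qed.

Definition PHd t i k := PH t i k - hmean (PH t) k.

Lemma PHd_bound t : 1 <= t ->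
  S2 (fun i k => PHd t i k ^ 2) <= tau ^ 2 * (C1 / alpha ^ 2) * S2 (fun i k => om2 t i k ^ 2).
Proof.
  intros Ht. unfold rsum2. rewrite !(rsum_swap n q), <- rsum_scal. apply rsum_le. intros k Hk.
  eapply Rle_trans; [apply (Hdev1 (fun i => PH t i k))|].
  rewrite <- !rsum_scal. apply rsum_le. intros i Hi.
  assert (H := om2_link t i k Ht Hi Hk). unfold lapv in H.
  replace (Lap (fun i => PH t i k) i) with (/ alpha * (tau * om2 t i k)) by (rewrite <- H; field; lra).
  right. field. lra.
Qed.

(** The weight [(1 - tau) / tau] turns the filter rates of [Dh] and [Gh] into the gap differences
    that the supply dominates; the separate sum of [Dh] matches the term [tau * (xi * gt)] in
    [energy_rate]. The rate of the last term cancels [NN * Ih], which has no sign. *)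
Definition lyap t :=
  energy tau xh vh gh zh om2 t + (1 - tau) * rsum n (Dh t)
  + (1 - tau) / tau * rsum n (fun i => Dh t i + rsum (S M) (fun j => Gh t j i))
  - / tau * S2 (fun i k => PHd t i k * Ih tau xh t i k).

Lemma filtered_pairing t : 1 <= t ->
  S2 (fun i k => xi t i k * gt gh t i k) + rsum n (fun i => rsum (S M) (fun j => gapG t j i - Gh t j i))
  <= S2 (pairing tau xh vh gh zh t).
Proof.
  intros Ht. unfold rsum2. rewrite <- rsum_plus. apply rsum_le. intros i Hi.
  apply Rle_trans with (rsum q (fun k => xi t i k * gt gh t i k)
    + rsum (S M) (fun j => rsum q (fun k => (ys t j i k - xs i k) * (ss t j i k - sref t j i k)))).
  - apply Rplus_le_compat_l. apply rsum_le. intros j Hj. apply filtered_gapG; auto; lia.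
  - right. rewrite rsum_swap, <- rsum_plus. apply rsum_ext. intros k Hk. cbn [rsum].
    rewrite ss_last. unfold sref at 2. rewrite Nat.eqb_refl.
    rewrite (rsum_ext M _ (fun j => (xi t i k + zd t j i k) * (- gam * ff zh t j i k - (zd t j i k - tau * ff zh t j i k)))).
    + unfold pairing, gt, vt, ff, bb. rewrite (rsum_minus M (fun j => z t j i k)). unfold xi, xd. ring.
    + intros j Hj. rewrite ss_lt by auto. unfold sref. destruct (Nat.eqb_spec j M); [lia|].
      unfold ff, xi, zd. ring.
Qed.

Lemma lyap_rate t : 1 <= t -> exists l, D lyap t l /\ l <= 0.
Proof.
  intros Ht. assert (Ht0 : 0 < t) by lra.
  destruct (energy_rate tau 0 xh vh gh zh om2) with (t := t) as [l [Hl1 Hl2]]; auto; try lra.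
  - intros; now apply om2_deriv.
  - intros; now apply om2_sum.
  - intros; now apply NN_balance.
  - set (NNm := fun i k => NN tau vh t i k - hmean (NN tau vh t) k).
    eexists. split.
    + unfold lyap. apply dl_minus; [apply dl_plus; [apply dl_plus|]|].
      * exact Hl1.
      * apply dl_scal, (dl_rsum n Dh). intros; now apply HDh.
      * apply dl_scal, (dl_rsum n (fun s i => Dh s i + rsum (S M) (fun j => Gh s j i))). intros i Hi.
        apply dl_plus; [now apply HDh|]. apply (dl_rsum (S M) (fun s j => Gh s j i)).
        intros j Hj. apply HGh; auto; lia.
      * apply dl_scal, (dl_rsum2 n q (fun s i k => PHd s i k * Ih tau xh s i k)) with (l := fun i k => tau * NNm i k * Ih tau xh t i k + PHd t i k * (tau * It tau xh t i k)).
        intros i k Hi Hk. apply dl_mult; [|now apply Ih_deriv].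
        unfold PHd. eapply dl_eq.
        -- apply dl_minus; [now apply PH_deriv|]. unfold hmean.
           apply (dl_rsum n (fun s i => h i * PH s i k)). intros; apply dl_scal; now apply PH_deriv.
        -- unfold NNm, hmean. rewrite Rmult_minus_distr_l, <- rsum_scal. f_equal. apply rsum_ext; intros; ring.
    + assert (HP := filtered_pairing t Ht).
      set (X := S2 (fun i k => xi t i k * gt gh t i k)) in *.
      set (Ds := rsum n (fun i => gapD t i)). set (Dhs := rsum n (Dh t)).
      set (GG := rsum n (fun i => rsum (S M) (fun j => gapG t j i - Gh t j i))) in *.
      assert (E1 : rsum n (fun i => tau * (gapD t i - Dh t i)) = tau * (Ds - Dhs)).
      { rewrite rsum_scal, rsum_minus. reflexivity. }
      assert (E2 : rsum n (fun i => tau * (gapD t i - Dh t i) + rsum (S M) (fun j => tau * (gapG t j i - Gh t j i)))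
         = tau * (Ds - Dhs + GG)).
      { rewrite rsum_plus, E1. unfold GG. rewrite Rmult_plus_distr_l, <- rsum_scal. f_equal.
        apply rsum_ext; intros; apply rsum_scal. }
      assert (E3 : S2 (fun i k => tau * NNm i k * Ih tau xh t i k + PHd t i k * (tau * It tau xh t i k))
         = tau * (S2 (fun i k => NNm i k * Ih tau xh t i k) + S2 (fun i k => PHd t i k * It tau xh t i k))).
      { rewrite <- rsum2_plus, <- rsum2_scal. apply rsum2_ext; intros; ring. }
      rewrite E1, E2, E3.
      replace ((1 - tau) / tau * (tau * (Ds - Dhs + GG))) with ((1 - tau) * (Ds - Dhs + GG)) by (field; lra).
      replace (/ tau * (tau * (S2 (fun i k => NNm i k * Ih tau xh t i k) + S2 (fun i k => PHd t i k * It tau xh t i k))))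
        with (S2 (fun i k => NNm i k * Ih tau xh t i k) + S2 (fun i k => PHd t i k * It tau xh t i k)) by (field; lra).
      assert (HOm : c0 / 2 * S2 (fun i k => bb xh t i k ^ 2) <= X - Ds + Dhs).
      { assert (H : Ds - Dhs + c0 / 2 * S2 (fun i k => bb xh t i k ^ 2) <= X); [|lra].
        unfold Ds, Dhs, X, rsum2. rewrite <- rsum_minus, <- rsum_scal, <- rsum_plus.
        apply rsum_le. intros i Hi. now apply filtered_gapD. }
      (* Centring [NN] is favourable: by [NN_hmean] the difference is [tau] times a square. *)
      assert (HNI : S2 (fun i k => NN tau vh t i k * Ih tau xh t i k) <= S2 (fun i k => NNm i k * Ih tau xh t i k)).
      { unfold rsum2. rewrite !(rsum_swap n q). apply rsum_le. intros k Hk.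
        assert (H := NN_hmean t k Ht Hk).
        rewrite (rsum_ext n (fun i => NNm i k * Ih tau xh t i k)
          (fun i => NN tau vh t i k * Ih tau xh t i k - hmean (NN tau vh t) k * Ih tau xh t i k)) by (intros; unfold NNm; ring).
        rewrite rsum_minus, rsum_scal, H.
        assert (0 <= tau * hmean (NN tau vh t) k ^ 2) by (apply Rmult_le_pos; [lra|apply pow2_ge_0]). lra. }
      set (O2 := S2 (fun i k => om2 t i k ^ 2)).
      set (I2 := S2 (fun i k => It tau xh t i k ^ 2)) in *.
      (* Since [PHd] is of order [tau * om2], Young's inequality with weight [tau] is covered by the
         dissipation of [om2] and the reserve [tau * It ^ 2]. *)
      assert (HPI : - S2 (fun i k => PHd t i k * It tau xh t i k) <= kap * O2 + tau * I2).
      { assert (HB := PHd_bound t Ht). fold O2 in HB.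
        assert (HO : 0 <= O2) by (apply rsum2_nonneg; intros; apply pow2_ge_0).
        assert (HI2 : 0 <= I2) by (apply rsum2_nonneg; intros; apply pow2_ge_0).
        assert (H : - S2 (fun i k => PHd t i k * It tau xh t i k) <= / (2 * tau) * S2 (fun i k => PHd t i k ^ 2) + tau / 2 * I2).
        { unfold I2. rewrite <- rsum2_opp, <- !rsum2_scal, <- rsum2_plus.
          apply rsum2_le. intros i k _ _.
          assert (0 <= / (2 * tau) * (PHd t i k + tau * It tau xh t i k) ^ 2).
          { apply Rmult_le_pos; [apply Rlt_le, Rinv_0_lt_compat; lra|apply pow2_ge_0]. }
          replace (/ (2 * tau) * (PHd t i k + tau * It tau xh t i k) ^ 2)
            with (/ (2 * tau) * PHd t i k ^ 2 + PHd t i k * It tau xh t i k + tau / 2 * It tau xh t i k ^ 2) in H by (field; lra).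
          lra. }
        assert (H2 : / (2 * tau) * S2 (fun i k => PHd t i k ^ 2) <= / (2 * tau) * (tau ^ 2 * (C1 / alpha ^ 2) * O2)).
        { apply Rmult_le_compat_l; [apply Rlt_le, Rinv_0_lt_compat; lra|exact HB]. }
        replace (/ (2 * tau) * (tau ^ 2 * (C1 / alpha ^ 2) * O2)) with (tau * (C1 / (2 * alpha ^ 2)) * O2) in H2 by (field; lra).
        assert (tau * (C1 / (2 * alpha ^ 2)) * O2 <= kap * O2) by (apply Rmult_le_compat_r; lra).
        assert (0 <= tau * I2) by (apply Rmult_le_pos; lra). lra. }
      assert (HN2 : O2 <= S2 (fun i k => (NN tau vh t i k - rsum n (fun i' => NN tau vh t i' k) / INR n) ^ 2 + om2 t i k ^ 2)).
      { unfold O2. apply rsum2_le. intros i k _ _.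
        generalize (pow2_ge_0 (NN tau vh t i k - rsum n (fun i' => NN tau vh t i' k) / INR n)). lra. }
      assert (kap * O2 <= kap * S2 (fun i k => (NN tau vh t i k - rsum n (fun i' => NN tau vh t i' k) / INR n) ^ 2 + om2 t i k ^ 2))
        by (apply Rmult_le_compat_l; lra).
      set (B2 := S2 (fun i k => bb xh t i k ^ 2)) in *.
      assert ((1 - tau) * (X + GG) <= (1 - tau) * S2 (pairing tau xh vh gh zh t)) by (apply Rmult_le_compat_l; lra).
      assert ((1 - tau) * (1 + tau) * (c0 / 2 * B2) <= (1 - tau) * (1 + tau) * (X - Ds + Dhs)).
      { apply Rmult_le_compat_l; [apply Rmult_le_pos; lra|exact HOm]. }
      lra.
Qed.

(** Young weight for the cross term of [lyap]: minimising [gstore] over [NN] leaves at least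
    [p * r * hstar / 2 * om2 ^ 2], and [C1 / alpha ^ 2] relates [PHd] to [om2]. *)
Definition thw := p * r * hstar * alpha ^ 2 / (C1 + 1).
Hypothesis Hlow1 : tau * (1 + c0 / 2 + INR M + / thw) <= c / 8.
Hypothesis Hlow2 :
  tau * (c / 8 + 2 * (c + 3 * INR M + 2) ^ 2 / c + 1 / 2 + INR M / gam + / thw) <= 3 * c0 / 8.

Lemma thw_pos : 0 < thw.
Proof.
  unfold thw. apply Rdiv_lt_0_compat; [|lra].
  apply Rmult_lt_0_compat; [|apply pow_lt; lra].
  apply Rmult_lt_0_compat; [apply Rmult_lt_0_compat; lra|lra].
Qed.

Lemma Dh_nonneg t i : 1 <= t -> (i < n)%nat -> 0 <= Dh t i.
Proof.
  intros Ht Hi. eapply Rle_trans; [|apply Dh_lower; auto].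
  apply Rmult_le_pos; [lra|]. apply rsum_nonneg; intros; apply pow2_ge_0.
Qed.

(** [omega0] has no sign, but with the separate sum of [Dh] it dominates [c0 / 2 * bb ^ 2] by
    [filtered_gapD]. The offset of [xh] from [xs] is covered by the large weight on [Dh], and
    [storage_lower] concludes coordinatewise. *)
Lemma lyap_lower t : 1 <= t -> c / 16 * S2 (fun i k => xi t i k ^ 2) <= lyap t.
Proof.
  intros Ht. assert (Ht0 : 0 < t) by lra. assert (Hth := thw_pos).
  unfold lyap, energy. rewrite psi_sum, omega0_eq.
  set (de := fun i k => xh t i k - xs i k).
  assert (HD : S2 (fun i k => c0 / 2 * bb xh t i k ^ 2)
     <= S2 (fun i k => xi t i k * gt gh t i k) - rsum n (fun i => gapD t i) + rsum n (Dh t)).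
  { rewrite rsum2_scal.
    assert (H : rsum n (fun i => gapD t i) - rsum n (Dh t) + c0 / 2 * S2 (fun i k => bb xh t i k ^ 2)
      <= S2 (fun i k => xi t i k * gt gh t i k)); [|lra].
    unfold rsum2. rewrite <- rsum_minus, <- rsum_scal, <- rsum_plus.
    apply rsum_le. intros i Hi. now apply filtered_gapD. }
  assert (HE : S2 (fun i k => c0 / (2 * tau) * de i k ^ 2)
     <= / tau * rsum n (fun i => Dh t i + rsum (S M) (fun j => Gh t j i))).
  { rewrite rsum2_scal. replace (c0 / (2 * tau)) with (/ tau * (c0 / 2)) by (field; lra).
    rewrite Rmult_assoc. apply Rmult_le_compat_l; [apply Rlt_le, Rinv_0_lt_compat; lra|].
    unfold rsum2. rewrite <- rsum_scal. apply rsum_le. intros i Hi.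
    assert (0 <= rsum (S M) (fun j => Gh t j i)) by (apply rsum_nonneg; intros; apply Gh_nonneg; auto; lia).
    generalize (Dh_lower t i Ht Hi). unfold de. lra. }
  assert (HG : S2 (fun i k => p * r * hstar / 2 * om2 t i k ^ 2) <= S2 (gstore tau vh om2 t)).
  { apply rsum2_le. intros i k Hi _. unfold gstore. destruct (Hmin i Hi) as [Hm1 Hm2].
    set (N := NN tau vh t i k). set (o := om2 t i k).
    assert (E : p / 2 * N ^ 2 + r / 2 * (N + o) ^ 2 = / 2 * (N + r * o) ^ 2 + p * r / 2 * o ^ 2).
    { replace p with (1 - r) by lra. field. }
    rewrite E.
    assert (0 <= p * r / 2 * o ^ 2).
    { apply Rmult_le_pos; [|apply pow2_ge_0]. assert (0 < p * r) by (apply Rmult_lt_0_compat; lra). lra. }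
    assert (0 <= h i * (/ 2 * (N + r * o) ^ 2)).
    { apply Rmult_le_pos; [lra|]. apply Rmult_le_pos; [lra|apply pow2_ge_0]. }
    assert (hstar * (p * r / 2 * o ^ 2) <= h i * (p * r / 2 * o ^ 2)) by (apply Rmult_le_compat_r; lra).
    lra. }
  assert (HP : / tau * S2 (fun i k => PHd t i k * Ih tau xh t i k)
     <= S2 (fun i k => p * r * hstar / 2 * om2 t i k ^ 2)
        + S2 (fun i k => (de i k ^ 2 + tau ^ 2 * bb xh t i k ^ 2) / thw)).
  { apply Rle_trans with (thw / (2 * tau ^ 2) * S2 (fun i k => PHd t i k ^ 2)
       + S2 (fun i k => (de i k ^ 2 + tau ^ 2 * bb xh t i k ^ 2) / thw)).
    - rewrite <- !rsum2_scal, <- rsum2_plus. apply rsum2_le. intros i k _ _.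
      unfold Ih. fold (de i k). set (D1 := de i k). set (B1 := bb xh t i k). set (P1 := PHd t i k).
      assert (H0 : 0 <= thw / 2 * (P1 / tau - (D1 + tau * B1) / thw) ^ 2)
        by (apply Rmult_le_pos; [lra|apply pow2_ge_0]).
      assert (H1 : 0 <= / (2 * thw) * (D1 - tau * B1) ^ 2).
      { apply Rmult_le_pos; [apply Rlt_le, Rinv_0_lt_compat; lra|apply pow2_ge_0]. }
      replace (thw / 2 * (P1 / tau - (D1 + tau * B1) / thw) ^ 2)
        with (thw / (2 * tau ^ 2) * P1 ^ 2 - / tau * (P1 * (D1 + tau * B1)) + / (2 * thw) * (D1 + tau * B1) ^ 2) in H0
        by (field; lra).
      replace ((D1 ^ 2 + tau ^ 2 * B1 ^ 2) / thw)
        with (/ (2 * thw) * (D1 + tau * B1) ^ 2 + / (2 * thw) * (D1 - tau * B1) ^ 2) by (field; lra).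
      lra.
    - apply Rplus_le_compat_r.
      eapply Rle_trans; [apply Rmult_le_compat_l; [|now apply PHd_bound]|].
      { apply Rlt_le, Rdiv_lt_0_compat; [auto|]. apply Rmult_lt_0_compat; [lra|apply pow_lt; lra]. }
      rewrite rsum2_scal. set (O2 := S2 (fun i k => om2 t i k ^ 2)).
      assert (HO : 0 <= O2) by (apply rsum2_nonneg; intros; apply pow2_ge_0).
      replace (thw / (2 * tau ^ 2) * (tau ^ 2 * (C1 / alpha ^ 2) * O2))
        with (p * r * hstar / 2 * (C1 / (C1 + 1)) * O2) by (unfold thw; field; lra).
      apply Rmult_le_compat_r; [auto|].
      assert (0 < p * r * hstar) by (apply Rmult_lt_0_compat; [apply Rmult_lt_0_compat; lra|lra]).
      assert (C1 / (C1 + 1) <= 1).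
      { apply Rmult_le_reg_r with (C1 + 1); [lra|]. unfold Rdiv. rewrite Rmult_assoc, Rinv_l; lra. }
      assert (p * r * hstar / 2 * (C1 / (C1 + 1)) <= p * r * hstar / 2 * 1) by (apply Rmult_le_compat_l; lra).
      lra. }
  assert (Hgap := gap_lower t Ht0).
  assert (Hloc : c / 16 * S2 (fun i k => xi t i k ^ 2)
    <= c / 2 * S2 (fun i k => xi t i k ^ 2)
      + S2 (fun i k => / 2 * (xi t i k + xd t i k) ^ 2 + rsum M (fun j => / 2 * (xi t i k + zd t j i k) ^ 2))
      + - ((INR M + 1) / 2) * S2 (fun i k => xi t i k ^ 2)
      + (1 - tau) * (S2 (qloc tau xh zh t) + S2 (fun i k => c0 / 2 * bb xh t i k ^ 2)
          + S2 (fun i k => c0 / (2 * tau) * de i k ^ 2))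
      + kb * S2 (fun i k => bb xh t i k ^ 2)
      - S2 (fun i k => (de i k ^ 2 + tau ^ 2 * bb xh t i k ^ 2) / thw)).
  { rewrite <- !rsum2_scal, <- !rsum2_plus, <- rsum2_scal, <- !rsum2_plus, <- rsum2_minus.
    apply rsum2_le. intros i k Hi Hk.
    assert (H := storage_lower M gam tau c c0 Rg thw (xd t i k) (bb xh t i k) (de i k)
      (fun j => zd t j i k) (fun j => ff zh t j i k) Hgam ltac:(lra) Htaugam ltac:(lra) HMc Hth ltac:(lra) Hlow1 Hlow2).
    cbv beta in H.
    assert (Ex : xi t i k = de i k + bb xh t i k) by (unfold xi, de, bb; ring).
    unfold qloc, kb. rewrite Ex.
    replace (de i k + bb xh t i k - bb xh t i k) with (de i k) by ring.
    assert (c / 16 * (de i k + bb xh t i k) ^ 2 <= c / 8 * (bb xh t i k ^ 2 + de i k ^ 2)).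
    { assert (0 <= c / 16 * (de i k - bb xh t i k) ^ 2) by (apply Rmult_le_pos; [lra|apply pow2_ge_0]). lra. }
    lra. }
  assert ((1 - tau) * S2 (fun i k => c0 / 2 * bb xh t i k ^ 2)
    <= (1 - tau) * (S2 (fun i k => xi t i k * gt gh t i k) - rsum n (fun i => gapD t i) + rsum n (Dh t)))
    by (apply Rmult_le_compat_l; lra).
  assert ((1 - tau) * S2 (fun i k => c0 / (2 * tau) * de i k ^ 2)
    <= (1 - tau) * (/ tau * rsum n (fun i => Dh t i + rsum (S M) (fun j => Gh t j i))))
    by (apply Rmult_le_compat_l; lra).
  assert (Ed : (1 - tau) / tau * rsum n (fun i => Dh t i + rsum (S M) (fun j => Gh t j i))
    = (1 - tau) * (/ tau * rsum n (fun i => Dh t i + rsum (S M) (fun j => Gh t j i))))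
    by (unfold Rdiv; ring).
  rewrite Ed. lra.
Qed.

Definition lagd t :=
  S2 (fun i k => (xh t i k - xs i k) ^ 2 + oh t i k ^ 2 + rsum M (fun j => ff zh t j i k ^ 2))
  + rsum n (fun i => Dh t i + rsum (S M) (fun j => Gh t j i)).

Definition lags t :=
  S2 (fun i k => / 2 * (xh t i k - xs i k) ^ 2 + / 2 * oh t i k ^ 2
     + rsum M (fun j => / 2 * ff zh t j i k ^ 2))
  + rsum n (fun i => Dh t i + rsum (S M) (fun j => Gh t j i)).

Lemma DG_nonneg t : 1 <= t -> 0 <= rsum n (fun i => Dh t i + rsum (S M) (fun j => Gh t j i)).
Proof.
  intros Ht. apply rsum_nonneg. intros i Hi. apply Rplus_le_le_0_compat; [now apply Dh_nonneg|].
  apply rsum_nonneg; intros; apply Gh_nonneg; auto; lia.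
Qed.

Lemma lags_nonneg t : 1 <= t -> 0 <= lags t.
Proof.
  intros Ht. apply Rplus_le_le_0_compat; [|now apply DG_nonneg].
  apply rsum2_nonneg; intros. repeat apply Rplus_le_le_0_compat;
    try (apply Rmult_le_pos; [lra|apply pow2_ge_0]).
  apply rsum_nonneg; intros; apply Rmult_le_pos; [lra|apply pow2_ge_0].
Qed.

(** The filters are driven by quantities contained in [diss], so the lags decay up to a forcing;
    this carries smallness of [diss] over to the filtered variables. *)
Lemma lags_rate t : 1 <= t -> exists l, D lags t l /\ l <= / tau * diss t - tau / 2 * lagd t.
Proof.
  intros Ht. assert (Ht0 : 0 < t) by lra. eexists. split.
  - unfold lags. apply dl_plus.
    + apply (dl_rsum2 n q (fun s i k => / 2 * (xh s i k - xs i k) ^ 2 + / 2 * oh s i k ^ 2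
        + rsum M (fun j => / 2 * ff zh s j i k ^ 2))) with
        (l := fun i k => / 2 * (2 * ((xh t i k - xs i k) * (tau * bb xh t i k - 0)))
           + / 2 * (2 * (oh t i k * (tau * om2 t i k)))
           + rsum M (fun j => / 2 * (2 * (ff zh t j i k * (zd t j i k - tau * ff zh t j i k))))).
      intros i k Hi Hk. apply dl_plus; [apply dl_plus|].
      * eapply dl_eq; [apply dl_scal, dl_sq, dl_minus; [now apply Hxh|apply dl_const]|reflexivity].
      * eapply dl_eq; [apply dl_scal, dl_sq; now apply oh_deriv|reflexivity].
      * apply (dl_rsum M (fun s j => / 2 * ff zh s j i k ^ 2)). intros j Hj.
        eapply dl_eq; [apply dl_scal, dl_sq, dl_minus; [now apply Hz|now apply Hzh]|reflexivity].
    + apply (dl_rsum n (fun s i => Dh s i + rsum (S M) (fun j => Gh s j i))) with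
        (l := fun i => tau * (gapD t i - Dh t i) + rsum (S M) (fun j => tau * (gapG t j i - Gh t j i))).
      intros i Hi. apply dl_plus; [now apply HDh|]. apply (dl_rsum (S M) (fun s j => Gh s j i)).
      intros j Hj. apply HGh; auto; lia.
  - assert (E : rsum n (fun i => tau * (gapD t i - Dh t i) + rsum (S M) (fun j => tau * (gapG t j i - Gh t j i)))
      = tau * (gap t - rsum n (fun i => Dh t i + rsum (S M) (fun j => Gh t j i)))).
    { unfold gap. rewrite <- rsum_minus, <- rsum_scal. apply rsum_ext. intros i _.
      rewrite rsum_scal, rsum_minus. ring. }
    rewrite E.
    assert (Hit : tau / 2 <= / tau /\ / (2 * tau) <= / tau /\ tau <= / tau).
    { assert (4 <= / tau).
      { apply Rmult_le_reg_r with tau; [lra|]. rewrite Rinv_l; lra. }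
      assert (/ (2 * tau) = / tau / 2) by (field; lra). lra. }
    assert (Hg := gap_nonneg t Ht0). assert (Hdg := DG_nonneg t Ht).
    set (GG := rsum n (fun i => Dh t i + rsum (S M) (fun j => Gh t j i))) in *.
    assert (HS : S2 (fun i k => / 2 * (2 * ((xh t i k - xs i k) * (tau * bb xh t i k - 0)))
           + / 2 * (2 * (oh t i k * (tau * om2 t i k)))
           + rsum M (fun j => / 2 * (2 * (ff zh t j i k * (zd t j i k - tau * ff zh t j i k)))))
      <= / tau * (S2 (fun i k => xd t i k ^ 2 + xi t i k ^ 2 + rsum M (fun j => zd t j i k ^ 2))
          + S2 (fun i k => (PP t i k - rsum n (fun i' => PP t i' k) / INR n) ^ 2 + om1 t i k ^ 2))
        - tau / 2 * S2 (fun i k => (xh t i k - xs i k) ^ 2 + oh t i k ^ 2 + rsum M (fun j => ff zh t j i k ^ 2))).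
    { rewrite <- rsum2_plus, <- !rsum2_scal, <- rsum2_minus. apply rsum2_le. intros i k _ _.
      assert (H1 : rsum M (fun j => / 2 * (2 * (ff zh t j i k * (zd t j i k - tau * ff zh t j i k))))
        <= / tau * rsum M (fun j => zd t j i k ^ 2) - tau / 2 * rsum M (fun j => ff zh t j i k ^ 2)).
      { rewrite <- !rsum_scal, <- rsum_minus. apply rsum_le. intros j _.
        set (e := zd t j i k). set (f := ff zh t j i k).
        assert (H : 0 <= / (2 * tau) * (e - tau * f) ^ 2).
        { apply Rmult_le_pos; [apply Rlt_le, Rinv_0_lt_compat; lra|apply pow2_ge_0]. }
        replace (/ (2 * tau) * (e - tau * f) ^ 2) with (/ (2 * tau) * e ^ 2 - e * f + tau / 2 * f ^ 2) in H by (field; lra).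
        assert (/ (2 * tau) * e ^ 2 <= / tau * e ^ 2) by (apply Rmult_le_compat_r; [apply pow2_ge_0|lra]).
        lra. }
      set (y := xh t i k - xs i k). replace (bb xh t i k) with (xi t i k - y) by (unfold bb, xi, y; ring).
      set (X := xi t i k).
      assert (H2 : y * (X - y) <= / 2 * X ^ 2 - / 2 * y ^ 2) by (generalize (pow2_ge_0 (X - y)); lra).
      unfold om2. set (o := oh t i k). set (o1 := om1 t i k).
      assert (H3 : o * (o1 - o) <= / 2 * o1 ^ 2 - / 2 * o ^ 2) by (generalize (pow2_ge_0 (o1 - o)); lra).
      assert (H4 : tau * (y * (X - y)) <= tau * (/ 2 * X ^ 2 - / 2 * y ^ 2)) by (apply Rmult_le_compat_l; lra).
      assert (H5 : tau * (o * (o1 - o)) <= tau * (/ 2 * o1 ^ 2 - / 2 * o ^ 2)) by (apply Rmult_le_compat_l; lra).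
      assert (H6 : tau / 2 * X ^ 2 <= / tau * X ^ 2) by (apply Rmult_le_compat_r; [apply pow2_ge_0|lra]).
      assert (H7 : tau / 2 * o1 ^ 2 <= / tau * o1 ^ 2) by (apply Rmult_le_compat_r; [apply pow2_ge_0|lra]).
      assert (H8 : 0 <= / tau * xd t i k ^ 2) by (apply Rmult_le_pos; [lra|apply pow2_ge_0]).
      assert (H9 : 0 <= / tau * (PP t i k - rsum n (fun i' => PP t i' k) / INR n) ^ 2)
        by (apply Rmult_le_pos; [lra|apply pow2_ge_0]).
      lra. }
    assert (tau * gap t <= / tau * gap t) by (apply Rmult_le_compat_r; lra).
    assert (0 <= tau * GG) by (apply Rmult_le_pos; lra).
    unfold diss, lagd. fold GG. lra.
Qed.

Lemma gh_bound Cg :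
  (forall t i k, (i < n)%nat -> (k < q)%nat -> Rabs (gr t i k) <= gapD t i + Cg i k) ->
  forall t i k, 1 <= t -> (i < n)%nat -> (k < q)%nat -> Rabs (gh t i k) <= Dh t i + Cg i k.
Proof.
  intros HC t i k Ht Hi Hk.
  assert (H0 : gapD 1 i <= Dh 1 i).
  { assert (H := init_D i Hi).
    assert (0 <= c0 / 2 * (c / (c - c0)) * rsum q (fun k => (x 1 i k - xh 1 i k) ^ 2)); [|lra].
    apply Rmult_le_pos; [|apply rsum_nonneg; intros; apply pow2_ge_0].
    apply Rmult_le_pos; [lra|]. apply Rlt_le, Rdiv_lt_0_compat; lra. }
  assert (Hb : forall s, gr s i k <= gapD s i + Cg i k /\ - gr s i k <= gapD s i + Cg i k).
  { intros s. assert (H := HC s i k Hi Hk). generalize (Rle_abs (gr s i k)) (Rle_abs (- gr s i k)).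
    rewrite Rabs_Ropp. lra. }
  assert (H1 : 0 <= Dh t i + Cg i k - gh t i k).
  { apply (filter_nonneg (fun s => Dh s i + Cg i k - gh s i k) tau 1); auto.
    - intros s Hs. eexists. split.
      + apply dl_minus; [apply dl_plus; [now apply HDh|apply dl_const]|now apply Hgh].
      + unfold gt. assert (0 <= tau * (gapD s i + Cg i k - gr s i k)).
        { apply Rmult_le_pos; [lra|]. generalize (Hb s); lra. } lra.
    - rewrite init_g by auto. generalize (Hb 1); lra. }
  assert (H2 : 0 <= Dh t i + Cg i k + gh t i k).
  { apply (filter_nonneg (fun s => Dh s i + Cg i k + gh s i k) tau 1); auto.
    - intros s Hs. eexists. split.
      + apply dl_plus; [apply dl_plus; [now apply HDh|apply dl_const]|now apply Hgh].
      + unfold gt. assert (0 <= tau * (gapD s i + Cg i k + gr s i k)).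
        { apply Rmult_le_pos; [lra|]. generalize (Hb s); lra. } lra.
    - rewrite init_g by auto. generalize (Hb 1); lra. }
  apply Rabs_le. lra.
Qed.

(** [NN] is [PP - PH]. The deviations of both from their [h]-means are controlled separately, and
    the remaining mean through [NN_hmean]. *)
Lemma NN_small t : 1 <= t ->
  S2 (fun i k => NN tau vh t i k ^ 2)
  <= 4 * C2 * S2 (fun i k => (PP t i k - rsum n (fun i' => PP t i' k) / INR n) ^ 2)
     + 4 * S2 (fun i k => PHd t i k ^ 2)
     + 2 * (INR n / tau) ^ 2 * S2 (fun i k => Ih tau xh t i k ^ 2).
Proof.
  intros Ht. unfold rsum2. rewrite !(rsum_swap n q), <- !rsum_scal, <- !rsum_plus.
  apply rsum_le. intros k Hk.
  set (N := fun i => NN tau vh t i k). set (u := fun i => PP t i k).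
  assert (HN : hmean (NN tau vh t) k = hmean (PP t) k - hmean (PH t) k).
  { unfold hmean. rewrite <- rsum_minus. apply rsum_ext; intros; rewrite NN_PH; ring. }
  assert (H1 := Hdev2 u). change (rsum n (fun l => h l * u l)) with (hmean (PP t) k) in H1.
  assert (H2 := rsum_sq_le n (fun i => Ih tau xh t i k)). rewrite NN_hmean in H2 by auto.
  set (m := hmean (NN tau vh t) k) in *.
  assert (H3 : rsum n (fun i => NN tau vh t i k ^ 2)
    <= rsum n (fun i => 4 * (u i - hmean (PP t) k) ^ 2 + 4 * PHd t i k ^ 2 + 2 * m ^ 2)).
  { apply rsum_le. intros i Hi. rewrite NN_PH. fold (u i). unfold PHd.
    set (P1 := PH t i k). set (h1 := hmean (PP t) k). set (h2 := hmean (PH t) k) in *.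
    rewrite HN. fold h1.
    generalize (pow2_ge_0 (u i - h1 + (P1 - h2))) (pow2_ge_0 ((u i - h1) - (P1 - h2) - (h1 - h2))). lra. }
  rewrite !rsum_plus, !rsum_scal, rsum_const in H3.
  assert (H4 : 2 * (INR n * m ^ 2) <= 2 * (INR n / tau) ^ 2 * rsum n (fun i => Ih tau xh t i k ^ 2)).
  { replace (2 * (INR n * m ^ 2)) with (2 * INR n / tau ^ 2 * (- tau * m) ^ 2) by (field; lra).
    replace (2 * (INR n / tau) ^ 2 * rsum n (fun i => Ih tau xh t i k ^ 2))
      with (2 * INR n / tau ^ 2 * (INR n * rsum n (fun i => Ih tau xh t i k ^ 2))) by (field; lra).
    apply Rmult_le_compat_l; [|exact H2].
    unfold Rdiv. apply Rmult_le_pos; [generalize (pos_INR n); lra|].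
    apply Rlt_le, Rinv_0_lt_compat, pow_lt; lra. }
  unfold u in *. lra.
Qed.

(** The quadratic terms and filtered gaps are of order [diss + lagd]. In [omega0], however, [xi] is
    only of order [e] while the gradient deviation is merely bounded, so the estimate is linear in
    [e]. *)
Lemma lyap_upper : exists K, 0 <= K /\
  forall t e, 1 <= t -> 0 < e <= 1 -> diss t + lagd t <= e ^ 2 -> lyap t <= K * e.
Proof.
  destruct gr_bound as [Cg HCg]. assert (HCh := gh_bound Cg HCg).
  set (KP := 2 * (tau ^ 2 * (C1 / alpha ^ 2))).
  set (KN := 4 * C2 + 4 * KP + 2 * (INR n / tau) ^ 2).
  set (K0 := (INR M + 2) + (3 * INR M + 3) + INR M + (2 * KN + 2) + (1 + / tau) + (/ tau * (KP + 1))).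
  (* The 2 accounts for [gapD <= 1] and [Dh <= 1], and [2 * Cg] for the bounds of the gradient and
     of its filter. *)
  set (KC := S2 (fun i k => Rabs (2 + 2 * Cg i k))).
  assert (HM := pos_INR M). assert (Hit : 0 < / tau) by (apply Rinv_0_lt_compat; lra).
  assert (HKP : 0 <= KP).
  { unfold KP. apply Rmult_le_pos; [lra|]. apply Rmult_le_pos; [apply pow2_ge_0|].
    unfold Rdiv. apply Rmult_le_pos; [lra|]. apply Rlt_le, Rinv_0_lt_compat, pow_lt; lra. }
  assert (HKN : 0 <= KN) by (unfold KN; generalize (pow2_ge_0 (INR n / tau)); lra).
  assert (HKC : 0 <= KC) by (apply rsum2_nonneg; intros; apply Rabs_pos).
  assert (HK0 : 0 <= K0).
  { unfold K0. assert (0 <= / tau * (KP + 1)) by (apply Rmult_le_pos; lra). lra. }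
  exists (K0 + KC). split; [lra|].
  intros t e Ht He HV. assert (Ht0 : 0 < t) by lra.
  set (V := diss t + lagd t) in *.
  assert (HVe : V <= e) by (apply Rle_trans with (e ^ 2); [auto|]; assert (e * e <= 1 * e) by (apply Rmult_le_compat_r; lra); lra).
  set (de := fun i k => xh t i k - xs i k).
  set (T1 := S2 (fun i k => xd t i k ^ 2 + xi t i k ^ 2 + rsum M (fun j => zd t j i k ^ 2))).
  set (T2a := S2 (fun i k => (PP t i k - rsum n (fun i' => PP t i' k) / INR n) ^ 2)).
  set (T2b := S2 (fun i k => om1 t i k ^ 2)).
  set (T3 := S2 (fun i k => de i k ^ 2 + oh t i k ^ 2 + rsum M (fun j => ff zh t j i k ^ 2))).
  set (GG := rsum n (fun i => Dh t i + rsum (S M) (fun j => Gh t j i))).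
  assert (EV : V = gap t + T1 + (T2a + T2b) + (T3 + GG)).
  { unfold V, diss, lagd, T2a, T2b. rewrite <- rsum2_plus. reflexivity. }
  assert (HT1 : 0 <= T1).
  { apply rsum2_nonneg; intros. repeat apply Rplus_le_le_0_compat; try apply pow2_ge_0.
    apply rsum_nonneg; intros; apply pow2_ge_0. }
  assert (HT2a : 0 <= T2a) by (apply rsum2_nonneg; intros; apply pow2_ge_0).
  assert (HT2b : 0 <= T2b) by (apply rsum2_nonneg; intros; apply pow2_ge_0).
  assert (HT3 : 0 <= T3).
  { apply rsum2_nonneg; intros. repeat apply Rplus_le_le_0_compat; try apply pow2_ge_0.
    apply rsum_nonneg; intros; apply pow2_ge_0. }
  assert (HGG : 0 <= GG) by now apply DG_nonneg.
  assert (Hgap := gap_nonneg t Ht0).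
  assert (Hterms : forall i k, xi t i k ^ 2 <= xd t i k ^ 2 + xi t i k ^ 2 + rsum M (fun j => zd t j i k ^ 2)
      /\ de i k ^ 2 <= de i k ^ 2 + oh t i k ^ 2 + rsum M (fun j => ff zh t j i k ^ 2)
      /\ oh t i k ^ 2 <= de i k ^ 2 + oh t i k ^ 2 + rsum M (fun j => ff zh t j i k ^ 2)).
  { intros i k. assert (0 <= rsum M (fun j => zd t j i k ^ 2)) by (apply rsum_nonneg; intros; apply pow2_ge_0).
    assert (0 <= rsum M (fun j => ff zh t j i k ^ 2)) by (apply rsum_nonneg; intros; apply pow2_ge_0).
    generalize (pow2_ge_0 (xd t i k)) (pow2_ge_0 (oh t i k)) (pow2_ge_0 (de i k)). lra. }
  assert (HX : S2 (fun i k => xi t i k ^ 2) <= T1) by (apply rsum2_le; intros; apply Hterms).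
  assert (HX0 : 0 <= S2 (fun i k => xi t i k ^ 2)) by (apply rsum2_nonneg; intros; apply pow2_ge_0).
  assert (HD : S2 (fun i k => de i k ^ 2) <= T3) by (apply rsum2_le; intros; apply Hterms).
  assert (HO : S2 (fun i k => oh t i k ^ 2) <= T3) by (apply rsum2_le; intros; apply Hterms).
  assert (Hpsi : S2 (fun i k => / 2 * (xi t i k + xd t i k) ^ 2 + rsum M (fun j => / 2 * (xi t i k + zd t j i k) ^ 2))
    <= (INR M + 1) * T1).
  { unfold T1. rewrite <- rsum2_scal. apply rsum2_le. intros i k _ _.
    assert (H : rsum M (fun j => / 2 * (xi t i k + zd t j i k) ^ 2)
       <= INR M * xi t i k ^ 2 + rsum M (fun j => zd t j i k ^ 2)).
    { rewrite <- rsum_const, <- rsum_plus. apply rsum_le. intros j _.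
      generalize (pow2_ge_0 (xi t i k - zd t j i k)). lra. }
    assert (0 <= INR M * (xd t i k ^ 2 + rsum M (fun j => zd t j i k ^ 2))).
    { apply Rmult_le_pos; [auto|]. apply Rplus_le_le_0_compat; [apply pow2_ge_0|apply rsum_nonneg; intros; apply pow2_ge_0]. }
    generalize (pow2_ge_0 (xi t i k - xd t i k)). lra. }
  assert (Hql : S2 (qloc tau xh zh t) <= (3 * INR M + 2) * T1 + (3 * INR M + 2) * T3).
  { unfold T1, T3. rewrite <- !rsum2_scal, <- rsum2_plus. apply rsum2_le. intros i k _ _. unfold qloc.
    assert (Eb : bb xh t i k = xi t i k - de i k) by (unfold bb, xi, de; ring). rewrite Eb.
    set (X := xi t i k). set (y := de i k).
    assert (H : rsum M (fun j => X * ff zh t j i k - (1 + gam) * ((X - y) * ff zh t j i k) + (gam - tau) / 2 * ff zh t j i k ^ 2)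
       <= INR M * (3 * X ^ 2 + 2 * y ^ 2) + 2 * rsum M (fun j => ff zh t j i k ^ 2)).
    { rewrite <- rsum_const, <- rsum_scal, <- rsum_plus. apply rsum_le. intros j _. set (f := ff zh t j i k).
      assert (0 <= (1 + gam) * (/ 2 * (X - y + f) ^ 2))
        by (apply Rmult_le_pos; [lra|]; apply Rmult_le_pos; [lra|apply pow2_ge_0]).
      assert (0 <= (1 - gam) * (X - y) ^ 2) by (apply Rmult_le_pos; [lra|apply pow2_ge_0]).
      assert (0 <= (1 - gam) * f ^ 2) by (apply Rmult_le_pos; [lra|apply pow2_ge_0]).
      assert (0 <= tau * f ^ 2) by (apply Rmult_le_pos; [lra|apply pow2_ge_0]).
      generalize (pow2_ge_0 (X - f)) (pow2_ge_0 (X + y)) (pow2_ge_0 X). lra. }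
    assert (0 <= INR M * xd t i k ^ 2) by (apply Rmult_le_pos; [auto|apply pow2_ge_0]).
    assert (0 <= INR M * oh t i k ^ 2) by (apply Rmult_le_pos; [auto|apply pow2_ge_0]).
    assert (0 <= INR M * y ^ 2) by (apply Rmult_le_pos; [auto|apply pow2_ge_0]).
    assert (Hz0 : 0 <= rsum M (fun j => zd t j i k ^ 2)) by (apply rsum_nonneg; intros; apply pow2_ge_0).
    assert (Hf0 : 0 <= rsum M (fun j => ff zh t j i k ^ 2)) by (apply rsum_nonneg; intros; apply pow2_ge_0).
    assert (0 <= INR M * rsum M (fun j => zd t j i k ^ 2)) by (apply Rmult_le_pos; auto).
    assert (0 <= INR M * rsum M (fun j => ff zh t j i k ^ 2)) by (apply Rmult_le_pos; auto).
    assert (0 <= tau * (X - y) ^ 2) by (apply Rmult_le_pos; [lra|apply pow2_ge_0]).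
    generalize (pow2_ge_0 X) (pow2_ge_0 y) (pow2_ge_0 (xd t i k)) (pow2_ge_0 (oh t i k)). lra. }
  assert (HgD : forall i, (i < n)%nat -> 0 <= gapD t i <= V /\ 0 <= Dh t i <= V).
  { intros i Hi.
    assert (HG1 : forall i, (i < n)%nat -> 0 <= rsum (S M) (fun j => gapG t j i))
      by (intros; apply rsum_nonneg; intros; apply gapG_nonneg; auto; lia).
    assert (HG2 : forall i, (i < n)%nat -> 0 <= rsum (S M) (fun j => Gh t j i))
      by (intros; apply rsum_nonneg; intros; apply Gh_nonneg; auto; lia).
    assert (HG3 : forall i, (i < n)%nat -> 0 <= gapD t i).
    { intros i' Hi'. eapply Rle_trans; [|now apply gapD_lower].
      apply Rmult_le_pos; [lra|apply rsum_nonneg; intros; apply pow2_ge_0]. }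
    assert (H1 : gapD t i + rsum (S M) (fun j => gapG t j i) <= gap t).
    { apply (rsum_term_le n (fun i => gapD t i + rsum (S M) (fun j => gapG t j i))); auto.
      intros; apply Rplus_le_le_0_compat; auto. }
    assert (H2 : Dh t i + rsum (S M) (fun j => Gh t j i) <= GG).
    { apply (rsum_term_le n (fun i => Dh t i + rsum (S M) (fun j => Gh t j i))); auto.
      intros; apply Rplus_le_le_0_compat; auto. now apply Dh_nonneg. }
    generalize (HG1 i Hi) (HG2 i Hi) (HG3 i Hi) (Dh_nonneg t i Ht Hi). lra. }
  assert (Hom : omega0 gh t <= KC * e).
  { rewrite omega0_eq.
    assert (H0 : 0 <= rsum n (fun i => gapD t i)) by (apply rsum_nonneg; intros; now apply HgD).
    assert (H1 : S2 (fun i k => xi t i k * gt gh t i k) <= e * KC).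
    { unfold KC. rewrite <- rsum2_scal. apply rsum2_le. intros i k Hi Hk.
      eapply Rle_trans; [apply Rle_abs|]. rewrite Rabs_mult.
      apply Rmult_le_compat; try apply Rabs_pos.
      - apply Rsqr_incr_0_var; [|lra]. rewrite <- Rsqr_abs. unfold Rsqr.
        assert (xi t i k ^ 2 <= S2 (fun i k => xi t i k ^ 2))
          by (apply (rsum2_term_le n q (fun i k => xi t i k ^ 2)); auto; intros; apply pow2_ge_0). lra.
      - eapply Rle_trans; [|apply Rle_abs]. unfold gt, Rminus.
        eapply Rle_trans; [apply Rabs_triang|]. rewrite Rabs_Ropp.
        generalize (HCg t i k Hi Hk) (HCh t i k Ht Hi Hk) (HgD i Hi). lra. }
    lra. }
  assert (Hkb : kb * S2 (fun i k => bb xh t i k ^ 2) <= INR M * (T1 + T3)).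
  { apply Rle_trans with (INR M / 2 * S2 (fun i k => bb xh t i k ^ 2)).
    - apply Rmult_le_compat_r; [apply rsum2_nonneg; intros; apply pow2_ge_0|]. unfold kb.
      assert (0 <= (1 - gam) * INR M) by (apply Rmult_le_pos; lra). lra.
    - replace (INR M * (T1 + T3)) with (INR M / 2 * (2 * (T1 + T3))) by field.
      apply Rmult_le_compat_l; [lra|].
      apply Rle_trans with (2 * S2 (fun i k => xi t i k ^ 2) + 2 * S2 (fun i k => de i k ^ 2)); [|lra].
      rewrite <- !rsum2_scal, <- rsum2_plus. apply rsum2_le. intros i k _ _.
      replace (bb xh t i k) with (xi t i k - de i k) by (unfold bb, xi, de; ring).
      generalize (pow2_ge_0 (xi t i k + de i k)). lra. }
  assert (Ho2 : S2 (fun i k => om2 t i k ^ 2) <= 2 * T2b + 2 * T3).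
  { apply Rle_trans with (2 * T2b + 2 * S2 (fun i k => oh t i k ^ 2)); [|lra].
    unfold T2b. rewrite <- !rsum2_scal, <- rsum2_plus. apply rsum2_le. intros i k _ _. unfold om2.
    generalize (pow2_ge_0 (om1 t i k + oh t i k)). lra. }
  assert (HI : S2 (fun i k => Ih tau xh t i k ^ 2) <= T1 + T3).
  { apply Rle_trans with (S2 (fun i k => xi t i k ^ 2) + S2 (fun i k => de i k ^ 2)); [|lra].
    rewrite <- rsum2_plus. apply rsum2_le. intros i k _ _.
    replace (Ih tau xh t i k) with ((1 - tau) * de i k + tau * xi t i k) by (unfold Ih, bb, xi, de; ring).
    set (X := xi t i k). set (y := de i k).
    assert (0 <= tau * (1 - tau) * (X - y) ^ 2) by (apply Rmult_le_pos; [apply Rmult_le_pos; lra|apply pow2_ge_0]).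
    assert (0 <= (1 - tau) * X ^ 2) by (apply Rmult_le_pos; [lra|apply pow2_ge_0]).
    assert (0 <= tau * y ^ 2) by (apply Rmult_le_pos; [lra|apply pow2_ge_0]). lra. }
  assert (HPH : S2 (fun i k => PHd t i k ^ 2) <= KP * V).
  { eapply Rle_trans; [now apply PHd_bound|].
    assert (tau ^ 2 * (C1 / alpha ^ 2) * S2 (fun i k => om2 t i k ^ 2) <= tau ^ 2 * (C1 / alpha ^ 2) * (2 * V))
      by (apply Rmult_le_compat_l; [unfold KP in HKP; lra|lra]). unfold KP. lra. }
  assert (HNN : S2 (fun i k => NN tau vh t i k ^ 2) <= KN * V).
  { eapply Rle_trans; [now apply NN_small|]. fold T2a.
    assert (4 * C2 * T2a <= 4 * C2 * V) by (apply Rmult_le_compat_l; lra).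
    assert (2 * (INR n / tau) ^ 2 * S2 (fun i k => Ih tau xh t i k ^ 2) <= 2 * (INR n / tau) ^ 2 * V)
      by (apply Rmult_le_compat_l; [generalize (pow2_ge_0 (INR n / tau)); lra|lra]).
    unfold KN. lra. }
  assert (Hgs : S2 (gstore tau vh om2 t) <= 2 * (KN * V) + 2 * V).
  { apply Rle_trans with (2 * S2 (fun i k => NN tau vh t i k ^ 2) + S2 (fun i k => om2 t i k ^ 2)); [|lra].
    rewrite <- rsum2_scal, <- rsum2_plus. apply rsum2_le. intros i k Hi _. unfold gstore.
    destruct (Hmin i Hi) as [Hm1 Hm2].
    set (N := NN tau vh t i k). set (o := om2 t i k).
    assert (H0 : p / 2 * N ^ 2 + r / 2 * (N + o) ^ 2 <= 2 * N ^ 2 + o ^ 2).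
    { assert (0 <= r / 2 * (N - o) ^ 2) by (apply Rmult_le_pos; [lra|apply pow2_ge_0]).
      assert (0 <= p * N ^ 2) by (apply Rmult_le_pos; [lra|apply pow2_ge_0]).
      assert (0 <= p * o ^ 2) by (apply Rmult_le_pos; [lra|apply pow2_ge_0]).
      replace r with (1 - p) in * by lra. generalize (pow2_ge_0 N) (pow2_ge_0 o). lra. }
    assert (H1 : 0 <= p / 2 * N ^ 2 + r / 2 * (N + o) ^ 2)
      by (apply Rplus_le_le_0_compat; apply Rmult_le_pos; try apply pow2_ge_0; lra).
    assert (h i * (p / 2 * N ^ 2 + r / 2 * (N + o) ^ 2) <= 1 * (p / 2 * N ^ 2 + r / 2 * (N + o) ^ 2))
      by (apply Rmult_le_compat_r; lra). lra. }
  assert (Hcr : - / tau * S2 (fun i k => PHd t i k * Ih tau xh t i k) <= / tau * (KP * V + V)).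
  { replace (- / tau * S2 (fun i k => PHd t i k * Ih tau xh t i k))
      with (/ tau * - S2 (fun i k => PHd t i k * Ih tau xh t i k)) by ring.
    apply Rmult_le_compat_l; [lra|].
    apply Rle_trans with (S2 (fun i k => PHd t i k ^ 2) + S2 (fun i k => Ih tau xh t i k ^ 2)); [|lra].
    rewrite <- rsum2_opp, <- rsum2_plus. apply rsum2_le. intros i k _ _.
    generalize (pow2_ge_0 (PHd t i k + Ih tau xh t i k)) (pow2_ge_0 (PHd t i k)) (pow2_ge_0 (Ih tau xh t i k)). lra. }
  assert (HDs : rsum n (Dh t) <= GG).
  { apply rsum_le. intros i Hi.
    assert (0 <= rsum (S M) (fun j => Gh t j i)) by (apply rsum_nonneg; intros; apply Gh_nonneg; auto; lia). lra. }
  assert (HD0 : 0 <= rsum n (Dh t)) by (apply rsum_nonneg; intros; now apply HgD).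
  unfold lyap, energy. fold GG. rewrite psi_sum.
  assert (A1 : (1 - tau) * (S2 (qloc tau xh zh t) + omega0 gh t)
    <= (3 * INR M + 2) * V + KC * e).
  { assert (HQ0 : 0 <= INR M * V) by (apply Rmult_le_pos; lra).
    assert (HQ1 : 0 <= KC * e) by (apply Rmult_le_pos; lra).
    assert (HQ2 : (3 * INR M + 2) * (T1 + T3) <= (3 * INR M + 2) * V) by (apply Rmult_le_compat_l; lra).
    assert ((1 - tau) * (S2 (qloc tau xh zh t) + omega0 gh t) <= (1 - tau) * ((3 * INR M + 2) * V + KC * e))
      by (apply Rmult_le_compat_l; lra).
    assert (0 <= tau * ((3 * INR M + 2) * V + KC * e)) by (apply Rmult_le_pos; lra). lra. }
  assert (A2 : (1 - tau) * rsum n (Dh t) <= V).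
  { assert (0 <= tau * rsum n (Dh t)) by (apply Rmult_le_pos; lra). lra. }
  assert (A3 : (1 - tau) / tau * GG <= / tau * V).
  { replace ((1 - tau) / tau * GG) with (/ tau * GG - GG) by (field; lra).
    assert (/ tau * GG <= / tau * V) by (apply Rmult_le_compat_l; lra). lra. }
  assert (A4 : - ((INR M + 1) / 2) * S2 (fun i k => xi t i k ^ 2) <= 0).
  { assert (0 <= (INR M + 1) / 2 * S2 (fun i k => xi t i k ^ 2)) by (apply Rmult_le_pos; lra). lra. }
  assert (A5 : INR M * (T1 + T3) <= INR M * V) by (apply Rmult_le_compat_l; lra).
  assert (A6 : (INR M + 1) * T1 <= (INR M + 1) * V) by (apply Rmult_le_compat_l; lra).
  assert (A7 : K0 * V <= K0 * e) by (apply Rmult_le_compat_l; lra).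
  unfold K0 in A7 at 1. assert (0 <= V) by lra. lra.
Qed.

(** Otherwise the fixed-reference storage plus a multiple of [lags] would decrease at a constant
    rate, against its lower bound. The multiple is such that the forcing of [lags] uses up half of
    [k1 * diss]. *)
Lemma dissipation_small del : 0 < del -> exists t, 1 <= t /\ diss t + lagd t < del.
Proof.
  intros Hdel. apply NNPP. intros Hno.
  assert (Hbig : forall t, 1 <= t -> del <= diss t + lagd t).
  { intros t Ht. apply Rnot_lt_le. intros H. apply Hno. now exists t. }
  destruct k1_spec as [Hk1 _]. set (k2 := k1 * tau ^ 2 / 4).
  assert (Htt : 0 < tau ^ 2 <= 1).
  { split; [apply pow_lt; lra|]. assert (tau * tau <= 1 * 1) by (apply Rmult_le_compat; lra). lra. }
  assert (Hk2 : 0 < k2) by (unfold k2; apply Rdiv_lt_0_compat; [apply Rmult_lt_0_compat; lra|lra]).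
  (* [k1] and [k2] are independent of the certificate, so [eps] can be fixed before the certificate
     and its lower bound [B]. *)
  set (eps := k2 * del / 2). assert (He : 0 < eps) by (unfold eps; apply Rdiv_lt_0_compat; [now apply Rmult_lt_0_compat|lra]).
  destruct (dual_certificate eps He) as [sh [vh0 Hd]].
  destruct (fixed_bounded_below sh vh0) as [B HB].
  set (Q := fun t => fenergy sh vh0 t + k1 * tau / 2 * lags t).
  assert (Hrate : forall t, 1 <= t -> exists l, D Q t l /\ l <= - eps).
  { intros t Ht. destruct (fixed_rate sh vh0 eps Hd t) as [l1 [H1 H1']]; [lra|].
    destruct (lags_rate t Ht) as [l2 [H2 H2']]. eexists. split.
    - unfold Q. apply dl_plus; [exact H1|]. apply dl_scal. exact H2.
    - assert (Hg := gap_nonneg t ltac:(lra)). assert (HG := Hbig t Ht).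
      assert (Hds : 0 <= diss t).
      { unfold diss. repeat apply Rplus_le_le_0_compat; [auto| |]; apply rsum2_nonneg; intros;
          repeat apply Rplus_le_le_0_compat; try apply pow2_ge_0; apply rsum_nonneg; intros; apply pow2_ge_0. }
      assert (k1 * tau / 2 * l2 <= k1 * tau / 2 * (/ tau * diss t - tau / 2 * lagd t)).
      { apply Rmult_le_compat_l; [|auto]. assert (0 < k1 * tau) by (apply Rmult_lt_0_compat; lra). lra. }
      replace (k1 * tau / 2 * (/ tau * diss t - tau / 2 * lagd t))
        with (k1 / 2 * diss t - k2 * lagd t) in H by (unfold k2; field; lra).
      assert (k2 * diss t <= k1 / 2 * diss t).
      { apply Rmult_le_compat_r; [auto|]. unfold k2.
        assert (k1 * tau ^ 2 <= k1 * 1) by (apply Rmult_le_compat_l; lra). lra. }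
      assert (k2 * del <= k2 * (diss t + lagd t)) by (apply Rmult_le_compat_l; lra).
      unfold eps in *. lra. }
  set (T := (Rabs (Q 1) + Rabs B + 1) / eps).
  assert (HT : 0 < T).
  { apply Rdiv_lt_0_compat; [generalize (Rabs_pos (Q 1)) (Rabs_pos B); lra|auto]. }
  assert (Hgrow := growth_bound Q (- eps) 1 Hrate 1 (1 + T) ltac:(lra)).
  assert (Hlow : B <= Q (1 + T)).
  { unfold Q. assert (H1 := HB (1 + T) ltac:(lra)). assert (H2 := lags_nonneg (1 + T) ltac:(lra)).
    assert (0 <= k1 * tau / 2 * lags (1 + T)); [|lra].
    apply Rmult_le_pos; [|auto]. assert (0 < k1 * tau) by (apply Rmult_lt_0_compat; lra). lra. }
  replace (- eps * (1 + T - 1)) with (- (Rabs (Q 1) + Rabs B + 1)) in Hgrow by (unfold T; field; lra).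
  generalize (Rle_abs (Q 1)) (Rle_abs (- B)). rewrite Rabs_Ropp. lra.
Qed.

Lemma filtered_convergence i k : (i < n)%nat -> (k < q)%nat -> cv_infty_fun (fun t => x t i k) (xs i k).
Proof.
  intros Hi Hk eps He. destruct lyap_upper as [K [HK Hup]].
  set (e := Rmin 1 (c / 32 * eps ^ 2 / (K + 1))).
  assert (He2 : 0 < c / 32 * eps ^ 2) by (apply Rmult_lt_0_compat; [lra|now apply pow_lt]).
  assert (Hepos : 0 < e <= 1).
  { split; [apply Rmin_glb_lt; [lra|apply Rdiv_lt_0_compat; lra]|apply Rmin_l]. }
  assert (HKe : K * e <= c / 32 * eps ^ 2).
  { apply Rle_trans with ((K + 1) * e); [lra|].
    apply Rle_trans with ((K + 1) * (c / 32 * eps ^ 2 / (K + 1))).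
    - apply Rmult_le_compat_l; [lra|apply Rmin_r].
    - right; field; lra. }
  destruct (dissipation_small (e ^ 2)) as [t0 [Ht0 HV]]; [apply pow_lt; lra|].
  exists t0. intros t Ht.
  assert (Hdec := growth_bound lyap 0 1 lyap_rate t0 t ltac:(lra)).
  assert (H0 := Hup t0 e Ht0 Hepos (Rlt_le _ _ HV)).
  assert (Hl := lyap_lower t ltac:(lra)).
  assert (H1 := rsum2_term_le n q (fun i k => xi t i k ^ 2) i k ltac:(intros; apply pow2_ge_0) Hi Hk).
  cbv beta in H1.
  assert (H2 : xi t i k ^ 2 < eps ^ 2).
  { apply Rmult_lt_reg_l with (c / 16); [lra|].
    assert (c / 16 * xi t i k ^ 2 <= c / 16 * S2 (fun i k => xi t i k ^ 2)) by (apply Rmult_le_compat_l; lra).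
    lra. }
  unfold xi in H2. apply Rsqr_incrst_0; [|apply Rabs_pos|lra]. rewrite <- Rsqr_abs. unfold Rsqr. lra.
Qed.

End LowPass.

(** * Starting values and rate of the filters *)

Hypothesis Hlapform : forall u, 0 <= rsum n (fun i => h i * (u i * Lap u i)).

(** The value of [PH] at time 1 when [vh] starts at [base - tau * X]. *)
Definition filter_start tau (base : nat -> nat -> R) X i k :=
  (base i k - tau * X i k) + tau * (v 1 i k - (base i k - tau * X i k)).

(* The link [alpha L PH = tau om2] at the initial time of the filters is a linear equation for the
   initial reference [X], with positive definite matrix [1 + tau^2 H + alpha (1 - tau) H L]. *)
Lemma filter_start_exists tau base : 0 < tau < 1 -> exists X : nat -> nat -> R,
  forall i k, (i < n)%nat -> (k < q)%nat ->
  alpha * lapv (filter_start tau base X) i k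
  = tau * (om1 1 i k - (- / h i * (X i k - xs i k + tau * (x 1 i k - X i k))
      - alpha * lapv (filter_start tau base X) i k
      - tau * (vd 1 i k + (1 - tau) * (v 1 i k - (base i k - tau * X i k))))).
Proof.
  intros Ht.
  set (A := fun i j => (if Nat.eqb j i then 1 + tau ^ 2 * h i else 0) + alpha * (1 - tau) * (h i * lap n a i j)).
  set (P0 := fun i k => (1 - tau) * base i k + tau * v 1 i k).
  set (rhs := fun k i => / (1 - tau) * (xs i k - tau * x 1 i k - h i * om1 1 i k
     - tau * (h i * (vd 1 i k + (1 - tau) * (v 1 i k - base i k)))
     + alpha * (1 - tau) / tau * (h i * lapv P0 i k))).
  assert (HA : forall u i, (i < n)%nat ->
    mulv n A u i = (1 + tau ^ 2 * h i) * u i + alpha * (1 - tau) * (h i * Lap u i)).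
  { intros u i Hi. unfold A, mulv.
    rewrite (rsum_ext n _ (fun j => (if Nat.eqb j i then (1 + tau ^ 2 * h i) * u j else 0)
       + alpha * (1 - tau) * h i * (lap n a i j * u j)))
      by (intros; destruct (Nat.eqb _ _); ring).
    rewrite rsum_plus, rsum_scal, (rsum_single n _ i Hi), Nat.eqb_refl; [ring|].
    intros j _ Hj. destruct (Nat.eqb_spec j i); [contradiction|reflexivity]. }
  assert (Hsol : forall k, exists X : nat -> R, forall i, (i < n)%nat -> mulv n A X i = rhs k i).
  { intros k. apply posdef_solve. intros u. unfold qform.
    rewrite (rsum_ext n (fun i => u i * mulv n A u i)
      (fun i => u i ^ 2 + (tau ^ 2 * (h i * u i ^ 2) + alpha * (1 - tau) * (h i * (u i * Lap u i)))))
      by (intros i Hi; rewrite HA by auto; ring).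
    rewrite rsum_plus, rsum_plus, !rsum_scal.
    assert (0 <= tau ^ 2 * rsum n (fun i => h i * u i ^ 2)).
    { apply Rmult_le_pos; [apply pow2_ge_0|]. apply rsum_nonneg. intros i Hi.
      apply Rmult_le_pos; [generalize (Hh_pos i Hi); lra|apply pow2_ge_0]. }
    assert (0 <= alpha * (1 - tau) * rsum n (fun i => h i * (u i * Lap u i))).
    { apply Rmult_le_pos; [|apply Hlapform]. apply Rmult_le_pos; lra. }
    lra. }
  destruct (functional_choice _ Hsol) as [X HX].
  exists (fun i k => X k i). intros i k Hi Hk.
  assert (HL : lapv (filter_start tau base (fun i k => X k i)) i k
     = lapv P0 i k + - (tau * (1 - tau)) * Lap (X k) i).
  { assert (H := lapv_plus P0 (fun i k => - (tau * (1 - tau)) * X k i) i k).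
    rewrite lapv_scal in H. change (lapv (fun i k => X k i) i k) with (Lap (X k) i) in H.
    rewrite <- H. apply lapv_ext. intros; unfold filter_start, P0; ring. }
  rewrite HL. assert (H := HX k i Hi). rewrite HA in H by auto. unfold rhs in H.
  assert (Hh := Hh_pos i Hi).
  set (Y := X k i) in *. set (LY := Lap (X k) i) in *. set (L0 := lapv P0 i k) in *.
  set (o := om1 1 i k) in *. set (vd1 := vd 1 i k) in *. set (B := base i k) in *.
  set (v1 := v 1 i k) in *. set (x1 := x 1 i k) in *. set (s1 := xs i k) in *.
  assert (E : (1 + tau ^ 2 * h i) * Y + alpha * (1 - tau) * (h i * LY)
    - / (1 - tau) * (s1 - tau * x1 - h i * o - tau * (h i * (vd1 + (1 - tau) * (v1 - B))) + alpha * (1 - tau) / tau * (h i * L0)) = 0) by lra.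
  apply Rminus_diag_uniq.
  match goal with |- ?G = 0 => assert (EG : G = - (tau * (1 - tau) / h i) *
    ((1 + tau ^ 2 * h i) * Y + alpha * (1 - tau) * (h i * LY)
    - / (1 - tau) * (s1 - tau * x1 - h i * o - tau * (h i * (vd1 + (1 - tau) * (v1 - B))) + alpha * (1 - tau) / tau * (h i * L0)))) end.
  { field. lra. }
  rewrite EG, E. ring.
Qed.

Lemma rsum_cont m (f : R -> nat -> R) t :
  (forall i, (i < m)%nat -> continuity_pt (fun s => f s i) t) -> continuity_pt (fun s => rsum m (f s)) t.
Proof.
  induction m as [|m IH]; intros H; simpl.
  - apply continuity_pt_const. intros s s'; reflexivity.
  - apply (continuity_pt_plus (fun s => rsum m (f s)) (fun s => f s m)); auto with arith.
Qed.

Lemma gapG_cont t j i : 0 < t -> (j <= M)%nat -> (i < n)%nat -> continuity_pt (fun s => gapG s j i) t.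
Proof.
  intros Ht Hj Hi.
  apply continuity_pt_locally_ext with (fun s => Psi s j i - / 2 * rsum q (fun k => (ys s j i k - xs i k) ^ 2)) 1.
  { lra. }
  { intros s _. unfold Psi. ring. }
  apply continuity_pt_minus; [eapply dl_cont; now apply Psi_deriv|].
  apply continuity_pt_scal, (rsum_cont q (fun s k => (ys s j i k - xs i k) ^ 2)). intros k Hk.
  assert (Hy : continuity_pt (fun s => ys s j i k) t).
  { apply (subgradient_curve_cont q (fun s => ys s j i) (fun s => ss s j i)
      (fun s => erval (fj i (S j) (ys s j i))) (thd t j i) 0 t k Ht); auto.
    intros k' Hk'. now apply theta_deriv. }
  assert (Hc : continuity_pt (fun s => ys s j i k - xs i k) t).
  { apply continuity_pt_minus; [exact Hy|]. apply continuity_pt_const. intros s s'; reflexivity. }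
  apply continuity_pt_locally_ext with (fun s => (ys s j i k - xs i k) * (ys s j i k - xs i k)) 1; [lra|intros; ring|].
  now apply continuity_pt_mult.
Qed.

Lemma small_enough B b : 0 < b -> exists T, 0 < T /\ forall s, 0 < s <= T -> s * B <= b.
Proof.
  intros Hb. assert (HB := Rabs_pos B). exists (b / (Rabs B + 1)).
  split; [apply Rdiv_lt_0_compat; lra|]. intros s Hs.
  apply Rle_trans with (s * (Rabs B + 1)).
  - apply Rmult_le_compat_l; [lra|]. generalize (Rle_abs B); lra.
  - apply Rle_trans with (b / (Rabs B + 1) * (Rabs B + 1)); [apply Rmult_le_compat_r; lra|].
    right; field; lra.
Qed.

Lemma primal_convergence i k : (i < n)%nat -> (k < q)%nat -> cv_infty_fun (fun t => x t i k) (xs i k).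
Proof.
  destruct (small_enough (INR M * (8 + 8 / gam) + 8 + 8 * Rg + 4 * ((1 + gam) * INR M / 4) + 2 * c0)
    _ Hmu) as [T1 [HT1 HB1]].
  destruct (small_enough (C1 / (2 * alpha ^ 2)) _ Hkap) as [T2 [HT2 HB2]].
  destruct (small_enough (1 + c0 / 2 + INR M + / thw) (c / 8)) as [T3 [HT3 HB3]]; [lra|].
  destruct (small_enough (c / 8 + 2 * (c + 3 * INR M + 2) ^ 2 / c + 1 / 2 + INR M / gam + / thw) (3 * c0 / 8))
    as [T4 [HT4 HB4]]; [lra|].
  set (tau := Rmin (Rmin (1 / 4) (gam / 2)) (Rmin (Rmin T1 T2) (Rmin T3 T4))).
  assert (Htau : 0 < tau /\ tau <= 1 / 4 /\ tau <= gam / 2 /\ tau <= T1 /\ tau <= T2 /\ tau <= T3 /\ tau <= T4).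
  { assert (H1 := Rmin_l (Rmin (1 / 4) (gam / 2)) (Rmin (Rmin T1 T2) (Rmin T3 T4))).
    assert (H2 := Rmin_r (Rmin (1 / 4) (gam / 2)) (Rmin (Rmin T1 T2) (Rmin T3 T4))).
    fold tau in H1, H2.
    generalize (Rmin_l (1 / 4) (gam / 2)) (Rmin_r (1 / 4) (gam / 2)) (Rmin_l T1 T2) (Rmin_r T1 T2)
      (Rmin_l T3 T4) (Rmin_r T3 T4) (Rmin_l (Rmin T1 T2) (Rmin T3 T4)) (Rmin_r (Rmin T1 T2) (Rmin T3 T4)).
    intros. split; [unfold tau; repeat apply Rmin_glb_lt; lra|lra]. }
  clearbody tau. destruct Htau as [Ht0 [Ht1 [Ht2 [Ht3 [Ht4 [Ht5 Ht6]]]]]].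
  (* [zh1] and [base] solve [sref = ss] at time 1: for [j < M] this reads
     [(gam - tau) * (zh1 - z) = zd], and for [j = M] it makes [vh] start at [base - tau * X] when
     [xh] starts at [X]. *)
  set (zh1 := fun j i k => z 1 j i k + zd 1 j i k / (gam - tau)).
  set (base := fun i k => ss 1 M i k + gr 1 i k + tau * x 1 i k - gam * rsum M (fun j => zh1 j i k)).
  destruct (filter_start_exists tau base) as [X HX]; [lra|].
  assert (Hc1 : forall (A : Type) (P : A -> Prop) (f : A -> R -> R) (fd : A -> R -> R) init,
    (forall i, P i -> forall t, 0 < t -> D (f i) t (fd i t)) ->
    exists F : A -> R -> R, forall i, P i -> F i 1 = init i /\ forall t, 1 <= t -> D (F i) t (tau * (f i t - F i t))).
  { intros A P f fd init H. apply filter_family. intros i0 Hi0 t Ht. eapply dl_cont. now apply H. }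
  set (Pik := fun ik : nat * nat => (fst ik < n)%nat /\ (snd ik < q)%nat).
  destruct (Hc1 _ Pik (fun ik s => x s (fst ik) (snd ik)) (fun ik s => xd s (fst ik) (snd ik))
    (fun ik => X (fst ik) (snd ik))) as [xh Hxh]; [intros [i' k'] [Hi Hk] t Ht; now apply Hx|].
  destruct (Hc1 _ Pik (fun ik s => v s (fst ik) (snd ik)) (fun ik s => vd s (fst ik) (snd ik))
    (fun ik => base (fst ik) (snd ik) - tau * X (fst ik) (snd ik))) as [vh Hvh];
    [intros [i' k'] [Hi Hk] t Ht; now apply Hv|].
  destruct (Hc1 _ Pik (fun ik s => gr s (fst ik) (snd ik)) (fun ik s => gd s (fst ik) (snd ik))
    (fun ik => gr 1 (fst ik) (snd ik))) as [gh Hgh];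
    [intros [i' k'] [Hi Hk] t Ht; now apply gr_deriv|].
  destruct (Hc1 _ (fun jik : nat * (nat * nat) => (fst jik < M)%nat /\ Pik (snd jik))
    (fun jik s => z s (fst jik) (fst (snd jik)) (snd (snd jik)))
    (fun jik s => zd s (fst jik) (fst (snd jik)) (snd (snd jik)))
    (fun jik => zh1 (fst jik) (fst (snd jik)) (snd (snd jik)))) as [zh Hzh];
    [intros [j [i' k']] [Hj [Hi Hk]] t Ht; now apply Hz|].
  (* The initial value adds the two lower bounds demanded by [init_D] and [init_D'], all summands
     being nonnegative. *)
  destruct (Hc1 _ (fun i => (i < n)%nat) (fun i s => gapD s i) (fun i s => rsum q (fun k => xi s i k * gd s i k))
    (fun i => gapD 1 i + c0 / 2 * (c / (c - c0)) * rsum q (fun k => (x 1 i k - X i k) ^ 2)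
       + c0 / 2 * rsum q (fun k => (X i k - xs i k) ^ 2))) as [Dh HDh];
    [intros i' Hi t Ht; now apply gapD_deriv|].
  destruct (filter_family _ (fun ji : nat * nat => (fst ji <= M)%nat /\ (snd ji < n)%nat)
    (fun ji s => gapG s (fst ji) (snd ji)) (fun ji => gapG 1 (fst ji) (snd ji)) tau) as [Gh HGh];
    [intros [j i'] [Hj Hi] t Ht; now apply gapG_cont|].
  assert (Ex : forall i k, (i < n)%nat -> (k < q)%nat -> xh (i, k) 1 = X i k)
    by (intros i' k' Hi Hk; exact (proj1 (Hxh (i', k') (conj Hi Hk)))).
  assert (Ev : forall i k, (i < n)%nat -> (k < q)%nat -> vh (i, k) 1 = base i k - tau * X i k)
    by (intros i' k' Hi Hk; exact (proj1 (Hvh (i', k') (conj Hi Hk)))).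
  assert (Eg : forall i k, (i < n)%nat -> (k < q)%nat -> gh (i, k) 1 = gr 1 i k)
    by (intros i' k' Hi Hk; exact (proj1 (Hgh (i', k') (conj Hi Hk)))).
  assert (Ez : forall j i k, (j < M)%nat -> (i < n)%nat -> (k < q)%nat -> zh (j, (i, k)) 1 = zh1 j i k)
    by (intros j i' k' Hj Hi Hk; exact (proj1 (Hzh (j, (i', k')) (conj Hj (conj Hi Hk))))).
  assert (ED := fun i Hi => proj1 (HDh i Hi)). cbv beta in ED.
  assert (Hq1 : forall i, 0 <= c0 / 2 * (c / (c - c0)) * rsum q (fun k => (x 1 i k - X i k) ^ 2)).
  { intros i'. apply Rmult_le_pos; [|apply rsum_nonneg; intros; apply pow2_ge_0].
    apply Rmult_le_pos; [lra|]. apply Rlt_le, Rdiv_lt_0_compat; lra. }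
  assert (Hq2 : forall i, 0 <= c0 / 2 * rsum q (fun k => (X i k - xs i k) ^ 2)).
  { intros i'. apply Rmult_le_pos; [lra|apply rsum_nonneg; intros; apply pow2_ge_0]. }
  apply (filtered_convergence tau (fun t i k => xh (i, k) t) (fun t i k => vh (i, k) t)
    (fun t i k => gh (i, k) t) (fun t j i k => zh (j, (i, k)) t) (fun t i => Dh i t) (fun t j i => Gh (j, i) t));
    auto; try lra.
  - intros t i' k' Ht Hi Hk. exact (proj2 (Hxh (i', k') (conj Hi Hk)) t Ht).
  - intros t j i' k' Ht Hj Hi Hk. exact (proj2 (Hzh (j, (i', k')) (conj Hj (conj Hi Hk))) t Ht).
  - intros t i' k' Ht Hi Hk. exact (proj2 (Hvh (i', k') (conj Hi Hk)) t Ht).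
  - intros t i' k' Ht Hi Hk. exact (proj2 (Hgh (i', k') (conj Hi Hk)) t Ht).
  - intros t i' Ht Hi. exact (proj2 (HDh i' Hi) t Ht).
  - intros t j i' Ht Hj Hi. exact (proj2 (HGh (j, i') (conj Hj Hi)) t Ht).
  - intros j i' k' Hj Hi Hk. unfold sref. destruct (Nat.eqb_spec j M) as [->|Hne].
    + rewrite (rsum_ext M (fun j' => zh (j', (i', k')) 1) (fun j => zh1 j i' k')) by (intros; now apply Ez).
      unfold bb, vt. rewrite Ex, Ev, Eg by auto. unfold base. ring.
    + unfold ff. rewrite Ez, ss_lt by (auto; lia). unfold zh1. field. lra.
  - intros j i' Hj Hi. exact (proj1 (HGh (j, i') (conj Hj Hi))).
  - intros i' Hi. rewrite (rsum_ext q _ (fun k => (x 1 i' k - X i' k) ^ 2)) by (intros; now rewrite Ex).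
    rewrite ED by auto. generalize (Hq2 i'). lra.
  - intros i' Hi. rewrite (rsum_ext q _ (fun k => (X i' k - xs i' k) ^ 2)) by (intros; now rewrite Ex).
    rewrite ED by auto.
    assert (0 <= gapD 1 i'); [|generalize (Hq1 i'); lra].
    eapply Rle_trans; [|now apply gapD_lower].
    apply Rmult_le_pos; [lra|apply rsum_nonneg; intros; apply pow2_ge_0].
  - intros i' k' Hi Hk. assert (H := HX i' k' Hi Hk).
    unfold om2, oh. assert (EP : lapv (PH tau (fun t i k => vh (i, k) t) 1) i' k' = lapv (filter_start tau base X) i' k').
    { apply lapv_ext. intros j Hj. unfold PH, vt, filter_start. now rewrite Ev. }
    rewrite EP. unfold Ih, NN, bb, vt. rewrite Ex, Ev by auto. exact H.
Qed.

End Energy.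

(** * Parameter conditions and assembly *)

(** [mu] stands for [INR (m - 1)]. The upper bound on [beta] gives
    [b2 < c - (1 + gam) ^ 2 * mu / 4], the bound on [eta] puts the graph weight below [b2 / 4], and
    the sum stays below [c / 2] since [mu < c] and [(1 - (1 + gam) / 2) ^ 2 >= 0]. *)
Lemma parameter_margin mu c gam beta eta hstar :
  0 < mu < c -> 0 < gam -> 0 < hstar -> 0 < eta ->
  (1 + gam) * mu / (2 * c) < beta < 2 / (1 + gam) ->
  / ((c - (1 + gam) * mu / (2 * beta)) * hstar) - 1 < eta ->
  (1 + gam) * mu / 4 + (1 + 2 * eta) / (8 * (1 + eta) ^ 2 * hstar) < c / 2.
Proof.
  intros Hmu Hgam Hh Heta [Hb1 Hb2] He.
  set (b2 := c - (1 + gam) * mu / (2 * beta)) in *.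
  assert (Hgm : 0 < (1 + gam) * mu) by (apply Rmult_lt_0_compat; lra).
  assert (Hbeta : 0 < beta).
  { assert (0 < (1 + gam) * mu / (2 * c)) by (apply Rdiv_lt_0_compat; lra). lra. }
  assert (Hb2pos : 0 < b2).
  { assert (H : (1 + gam) * mu < beta * (2 * c)).
    { apply Rmult_lt_reg_r with (/ (2 * c)); [apply Rinv_0_lt_compat; lra|].
      replace (beta * (2 * c) * / (2 * c)) with beta by (field; lra). exact Hb1. }
    assert ((1 + gam) * mu / (2 * beta) < c); [|unfold b2; lra].
    apply Rmult_lt_reg_r with (2 * beta); [lra|]. unfold Rdiv. rewrite Rmult_assoc, Rinv_l; lra. }
  assert (Hib : (1 + gam) / 2 < / beta).
  { apply Rmult_lt_reg_r with beta; [auto|]. rewrite Rinv_l by lra.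
    apply Rmult_lt_reg_r with (2 / (1 + gam)); [apply Rdiv_lt_0_compat; lra|].
    replace ((1 + gam) / 2 * beta * (2 / (1 + gam))) with beta by (field; lra). lra. }
  assert (Hb2c : b2 < c - (1 + gam) ^ 2 * mu / 4).
  { assert ((1 + gam) * mu / 2 * ((1 + gam) / 2) < (1 + gam) * mu / 2 * / beta) by (apply Rmult_lt_compat_l; lra).
    unfold b2. replace ((1 + gam) * mu / (2 * beta)) with ((1 + gam) * mu / 2 * / beta) by (field; lra). lra. }
  assert (HRg : (1 + 2 * eta) / (8 * (1 + eta) ^ 2 * hstar) < b2 / 4).
  { assert (Hbh : 0 < b2 * hstar) by (apply Rmult_lt_0_compat; auto).
    assert (H1 : 1 < (1 + eta) * (b2 * hstar)).
    { apply Rmult_lt_reg_r with (/ (b2 * hstar)); [now apply Rinv_0_lt_compat|].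
      rewrite Rmult_assoc, Rinv_r by lra. lra. }
    assert (Hden : 0 < 8 * (1 + eta) ^ 2 * hstar)
      by (apply Rmult_lt_0_compat; [|auto]; apply Rmult_lt_0_compat; [lra|apply pow_lt; lra]).
    apply Rmult_lt_reg_r with (8 * (1 + eta) ^ 2 * hstar); [auto|].
    unfold Rdiv at 1. rewrite Rmult_assoc, Rinv_l by lra.
    assert (2 * (1 + eta) * 1 < 2 * (1 + eta) * ((1 + eta) * (b2 * hstar))) by (apply Rmult_lt_compat_l; lra).
    lra. }
  assert (0 <= mu * (1 - (1 + gam) / 2) ^ 2) by (apply Rmult_le_pos; [lra|apply pow2_ge_0]).
  lra.
Qed.

Lemma right_cont0_rsum n h (w : R -> nat -> R) :
  (forall i, (i < n)%nat -> right_cont0 (fun t => w t i)) ->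
  right_cont0 (fun t => rsum n (fun i => h i * w t i)).
Proof.
  induction n as [|n IH]; intros H eps He; cbn [rsum].
  - exists 1. split; [lra|]. intros. rewrite Rminus_diag, Rabs_R0; auto.
  - destruct (IH ltac:(auto with arith) (eps / 2)) as [d1 [Hd1 H1]]; [lra|].
    destruct (H n ltac:(auto) (eps / 2 / (Rabs (h n) + 1))) as [d2 [Hd2 H2]].
    { apply Rdiv_lt_0_compat; [lra|]. generalize (Rabs_pos (h n)); lra. }
    exists (Rmin d1 d2). split; [now apply Rmin_glb_lt|]. intros t Ht.
    assert (A1 := H1 t ltac:(generalize (Rmin_l d1 d2); lra)).
    assert (A2 := H2 t ltac:(generalize (Rmin_r d1 d2); lra)). cbv beta in A1, A2.
    match goal with |- Rabs ?e < _ => replace e with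
      (rsum n (fun i => h i * w t i) - rsum n (fun i => h i * w 0 i) + h n * (w t n - w 0 n)) by ring end.
    eapply Rle_lt_trans; [apply Rabs_triang|]. rewrite Rabs_mult.
    assert (Rabs (h n) * Rabs (w t n - w 0 n) <= eps / 2).
    { apply Rle_trans with ((Rabs (h n) + 1) * (eps / 2 / (Rabs (h n) + 1))).
      - apply Rmult_le_compat; try apply Rabs_pos; lra.
      - right; field. generalize (Rabs_pos (h n)); lra. }
    lra.
Qed.

(** The differential equations hold for [t > 0] only; right continuity ties the conserved [h]-mean
    of [w] to its initial value. *)
Lemma right_cont0_constant f : right_cont0 f -> (forall t, 0 < t -> D f t 0) -> forall t, 0 < t -> f t = f 0.
Proof.
  intros Hc Hd t Ht. apply NNPP. intros Hne.
  assert (Hpos : 0 < Rabs (f t - f 0)) by (apply Rabs_pos_lt; lra).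
  destruct (Hc _ Hpos) as [del [Hdel Hs]].
  set (s := Rmin t del / 2).
  assert (0 < Rmin t del) by now apply Rmin_glb_lt.
  assert (Hs1 : 0 < s < t /\ s < del) by (unfold s; generalize (Rmin_l t del) (Rmin_r t del); lra).
  assert (E : f s = f t).
  { apply Rle_antisym.
    - assert (H1 := growth_bound (fun r => - f r) 0 s).
      assert (H2 : - f t <= - f s + 0 * (t - s)); [|lra].
      apply H1; [|lra]. intros r Hr. exists (- 0). split; [apply dl_opp, Hd; lra|lra].
    - assert (H2 : f t <= f s + 0 * (t - s)); [|lra].
      apply (growth_bound f 0 s); [|lra]. intros r Hr. exists 0. split; [apply Hd; lra|lra]. }
  specialize (Hs s ltac:(lra)). rewrite E in Hs. lra.
Qed.

Theorem theorem1
  (n q m : nat) (Hm : (2 <= m)%nat)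
  (* local costs: f0 i = f_i^0 (gradient g0 i, Hessian hs0 i); fj i j = f_i^j, j = 1..m *)
  (f0 : nat -> (nat -> R) -> R) (g0 : nat -> (nat -> R) -> nat -> R)
  (hs0 : nat -> (nat -> R) -> nat -> nat -> R)
  (fj : nat -> nat -> (nat -> R) -> ER)
  (c : R) (d : nat -> nat -> R)
  (a : nat -> nat -> R) (h : nat -> R)
  (* (A1) *)
  (Hc : INR (m - 1) < c)
  (HA1 : forall i, (i < n)%nat ->
     local q (f0 i) /\ C2_with q (f0 i) (g0 i) (hs0 i) /\ strongly_monotone q (g0 i) c)
  (* (A2) *)
  (HA2 : forall i j, (i < n)%nat -> (1 <= j <= m)%nat ->
     local q (fj i j) /\ proper_fun q (fj i j) /\ convex_fun (fj i j) /\ closed_fun q (fj i j))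
  (* (A3): weighted directed strongly connected graph *)
  (Ha_nonneg : forall i j, (i < n)%nat -> (j < n)%nat -> 0 <= a i j)
  (Ha_diag : forall i, (i < n)%nat -> a i i = 0)
  (HA3 : strongly_connected n a)
  (* h : positive left eigenvector of L_n, normalized *)
  (Hh_pos : forall i, (i < n)%nat -> 0 < h i)
  (Hh_left : forall j, (j < n)%nat -> rsum n (fun i => h i * lap n a i j) = 0)
  (Hh_sum : rsum n h = 1)
  (* (A4) *)
  (HA4 : exists y, resource_constraint n q y d /\ total_cost n m f0 fj y <> PInf)
  (gamma alpha : R)
  (Hgamma : 0 < gamma < / INR (m - 1))
  (Halpha : 0 < alpha)
  (Hparams : exists beta eta lam2 hstar,
     (1 + gamma) * INR (m - 1) / (2 * c) < beta < 2 / (1 + gamma) /\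
     0 < eta /\
     is_lambda2_nq n q (boldL n a h) lam2 /\
     is_min_idx n h hstar /\
     alpha > (eta + 1) ^ 2 / (eta * lam2) /\
     eta > Rmax (/ ((c - (1 + gamma) * INR (m - 1) / (2 * beta)) * hstar) - 1) 0)
  (x : R -> nat -> nat -> R) (z : R -> nat -> nat -> nat -> R)
  (v w : R -> nat -> nat -> R)
  (Htraj : algorithmA_traj n q m a h d g0 fj gamma alpha x z v w) :
  exists xs : nat -> nat -> R,
    (forall i k, (i < n)%nat -> (k < q)%nat -> cv_infty_fun (fun t => x t i k) (xs i k)) /\
    is_solution n q m f0 fj d xs.
Proof.
  destruct m as [|M]; [lia|]. assert (EM : (S M - 1)%nat = M) by lia.
  unfold algorithmA_traj in Htraj. rewrite EM in *.
  destruct Hparams as [beta [eta [lam [hstar [Hbeta [Heta [Hlam [[[i0 [Hi0 Hhi0]] Hmin] [Hal Het]]]]]]]]].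
  destruct Htraj as [Hrc [Hw0 Hdyn]].
  destruct (lambda2_gap n q a h Ha_nonneg HA3 Hh_pos Hh_left lam Hlam) as [Hn [Hlam0 Hgap]].
  assert (HM1 : 1 <= INR M) by (apply (le_INR 1); lia).
  assert (Hgam1 : 0 < gamma <= 1).
  { split; [apply Hgamma|]. apply Rle_trans with (/ INR M); [lra|].
    rewrite <- Rinv_1. apply Rinv_le_contravar; lra. }
  assert (Hhs : 0 < hstar) by (rewrite Hhi0; auto).
  destruct (graph_dissipation n a h Hh_pos Hh_sum lam alpha eta hstar Hn Hlam0 Hgap Heta Hal Hhs Hmin)
    as [p [r [kap [Hp [Hr [Hpr [Hkap Hgraph]]]]]]].
  assert (Hmar := parameter_margin (INR M) c gamma beta eta hstar ltac:(lra) (proj1 Hgamma) Hhs Heta Hbeta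
    (Rle_lt_trans _ _ _ (Rmax_l _ _) Het)).
  set (Rg := (1 + 2 * eta) / (8 * (1 + eta) ^ 2 * hstar)) in *.
  assert (HRg : 0 < Rg).
  { apply Rdiv_lt_0_compat; [lra|]. apply Rmult_lt_0_compat; [|auto].
    apply Rmult_lt_0_compat; [lra|apply pow_lt; lra]. }
  (* Arguments of the proximal steps with indices shifted by one: [j] refers to the [S j]-th
     nonsmooth term, and [j = M] to the [x]-equation. *)
  set (th := fun (t : R) j i k =>
    if Nat.eqb j M then x t i k - g0 i (x t i) k + v t i k + gamma * rsum M (fun j' => z t (S j') i k)
    else x t i k - gamma * z t (S j) i k).
  destruct (functional_choice (fun (tji : R * (nat * nat)) p' =>
    let t := fst tji in let j := fst (snd tji) in let i := snd (snd tji) in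
    0 < t -> (j <= M)%nat -> (i < n)%nat ->
    is_prox q (fj i (S j)) (th t j i) p' /\
    forall k, (k < q)%nat ->
      D (fun s => if Nat.eqb j M then x s i k else z s (S j) i k) t (p' k - x t i k))) as [ys0 Hys0].
  { intros [t [j i]]. cbn [fst snd].
    destruct (Rlt_dec 0 t) as [Ht|]; [|exists (fun _ => 0); tauto].
    destruct (Compare_dec.le_dec j M) as [Hj|]; [|exists (fun _ => 0); tauto].
    destruct (Compare_dec.lt_dec i n) as [Hi|]; [|exists (fun _ => 0); tauto].
    destruct (Hdyn t i Ht Hi) as [HX [HZ _]]. unfold th. destruct (Nat.eqb_spec j M) as [->|Hne].
    - destruct HX as [p' HX]. exists p'. auto.
    - destruct (HZ (S j)) as [p' HZ']; [lia|]. exists p'. auto. }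
  set (ys := fun t j i => ys0 (t, (j, i))).
  assert (Hys : forall t j i, 0 < t -> (j <= M)%nat -> (i < n)%nat ->
    is_prox q (fj i (S j)) (th t j i) (ys t j i) /\
    forall k, (k < q)%nat ->
      D (fun s => if Nat.eqb j M then x s i k else z s (S j) i k) t (ys t j i k - x t i k))
    by (intros t j i; exact (Hys0 (t, (j, i)))).
  clearbody ys. clear Hys0 ys0.
  assert (Hsub : forall t j i, 0 < t -> (j <= M)%nat -> (i < n)%nat ->
    finite (fj i (S j) (ys t j i)) /\
    forall y, finite (fj i (S j) y) -> erval (fj i (S j) (ys t j i))
      + rsum q (fun k => (th t j i k - ys t j i k) * (y k - ys t j i k)) <= erval (fj i (S j) y)).
  { intros t j i Ht Hj Hi. apply prox_subgradient; [|apply Hys; auto]. apply (HA2 i (S j)); [auto|lia]. }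
  destruct (strong_duality n q (S M) f0 g0 fj c d) as [xs [Hsol [Hdom Hdual]]]; auto.
  { lra. }
  { intros i Hi. destruct (HA1 i Hi) as [H1 [H2 H3]].
    apply (partial_cont q (f0 i) (g0 i) H1 (proj1 H2) (grad_cont q (f0 i) (g0 i) (hs0 i) H1 H2)). }
  { intros i y y' Hi. destruct (HA1 i Hi) as [H1 [H2 H3]]. now apply (strong_convexity q (f0 i) (g0 i) (hs0 i)). }
  { intros i j Hi Hj. destruct (HA2 i j Hi Hj) as [H1 [_ H2]]. tauto. }
  (* Affine minorants come from the trajectory itself, as the subgradients selected at time 1. *)
  { intros i j Hi Hj. destruct (Hsub 1 j i ltac:(lra) ltac:(lia) Hi) as [_ H].
    exists (fun k => th 1 j i k - ys 1 j i k),
      (erval (fj i (S j) (ys 1 j i)) - rsum q (fun k => (th 1 j i k - ys 1 j i k) * ys 1 j i k)).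
    intros y Hy. generalize (H y Hy).
    rewrite (rsum_ext q (fun k => (th 1 j i k - ys 1 j i k) * (y k - ys 1 j i k))
      (fun k => (th 1 j i k - ys 1 j i k) * y k - (th 1 j i k - ys 1 j i k) * ys 1 j i k)) by (intros; ring).
    rewrite rsum_minus. lra. }
  exists xs. split; [|exact Hsol].
  assert (Hdv : forall u, rsum n (fun i => (u i - rsum n (fun l => h l * u l)) ^ 2)
    <= 2 * (1 + INR n) * rsum n (fun i => (u i - rsum n u / INR n) ^ 2))
    by (intros; now apply hmean_dev).
  assert (HnR := pos_INR n).
  assert (Hlam2 : 0 < lam ^ 2) by now apply pow_lt.
  (* [c0] is the midpoint of [2 * ((1 + gamma) * INR M / 4 + Rg)] and [c], so [Hmar] gives both
     [c0 < c] and a positive margin. [C1] combines [hmean_dev] with [gap_lap]. *)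
  apply (primal_convergence n q M f0 g0 hs0 fj c d a h gamma alpha) with (v := v) (w := w)
    (z := fun t j => z t (S j)) (ys := ys) (c0 := c / 2 + (1 + gamma) * INR M / 4 + Rg) (Rg := Rg)
    (p := p) (r := r) (kap := kap) (C1 := 2 * (1 + INR n) / lam ^ 2) (C2 := 2 * (1 + INR n)) (hstar := hstar);
    auto; try lra.
  - intros i Hi. apply (HA1 i Hi).
  - intros i Hi. apply (HA1 i Hi).
  - intros i Hi. apply (HA1 i Hi).
  - intros t i k Ht Hi Hk. destruct (Hys t M i Ht (le_n M) Hi) as [_ H].
    rewrite Nat.eqb_refl in H. now apply H.
  - intros t j i k Ht Hj Hi Hk. destruct (Hys t j i Ht ltac:(lia) Hi) as [_ H].
    destruct (Nat.eqb_spec j M); [lia|]. now apply H.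
  - intros t i k Ht Hi Hk. now apply (Hdyn t i Ht Hi).
  - intros t i k Ht Hi Hk. now apply (Hdyn t i Ht Hi).
  - intros t j i Ht Hj Hi. now apply Hsub.
  - intros t j i y Ht Hj Hi Hy. destruct (Hsub t j i Ht Hj Hi) as [_ H].
    eapply Rle_trans; [|apply (H y Hy)]. right. f_equal. apply rsum_ext. intros k _.
    unfold ss, th, xd, zd, gr. destruct (Nat.eqb_spec j M) as [->|]; ring.
  - intros j i Hj Hi. apply (Hdom i j Hi). lia.
  - assert (0 < (1 + gamma) * INR M) by (apply Rmult_lt_0_compat; lra). lra.
  - intros u. now apply lap_left.
  - intros s i Hi. now apply lap_const.
  (* The [h]-mean of [w] has zero rate because [h] annihilates the Laplacian, and it starts at 0. *)
  - intros t k Ht Hk.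
    assert (Hwc := right_cont0_constant _ (right_cont0_rsum n h (fun s i => w s i k)
      ltac:(intros i Hi; apply (Hrc i k Hi Hk)))). cbv beta in Hwc.
    rewrite Hwc; auto.
    + rewrite (rsum_ext n _ (fun _ => 0)), rsum_const; [ring|]. intros i Hi. rewrite Hw0 by auto. ring.
    + intros s Hs. eapply dl_eq.
      * apply (dl_rsum n (fun s i => h i * w s i k)). intros i Hi. apply dl_scal. now apply (Hdyn s i Hs Hi).
      * rewrite (rsum_ext n _ (fun i => alpha * (h i * mulv n (lap n a) (fun j => v s j k) i)))
          by (intros; unfold mulv; ring).
        rewrite rsum_scal, lap_left by auto. ring.
  - apply Hsol.
  - apply Rmult_le_pos; [lra|]. apply Rlt_le, Rinv_0_lt_compat, Hlam2.
  - intros i Hi. split; [auto|]. now apply (h_le_1 n h).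
  - intros u. eapply Rle_trans; [apply Hdv|].
    assert (H := gap_lap n a h Hh_pos Hh_left Hh_sum lam Hn Hlam0 Hgap u).
    apply Rle_trans with (2 * (1 + INR n) / lam ^ 2 * (lam ^ 2 * rsum n (fun i => (u i - rsum n u / INR n) ^ 2))).
    + right. field. lra.
    + apply Rmult_le_compat_l; [|exact H]. apply Rmult_le_pos; [lra|]. apply Rlt_le, Rinv_0_lt_compat, Hlam2.
  - intros u. now apply (lapform_nonneg n a h).
Qed.
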